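(* Let $k$ be a field, $P$ a locally finite poset with an action of a finite group $W$, and $\{r_{xy}\}$ a $W$-invariant weak rank function on $P$. If $\kappa\in\mathscr{I}^W(P)$ is a $P$-kernel, then there exists a unique pair $f,g\in\mathscr{I}^W_{1/2}(P)$ such that $\bar f=\kappa f$ and $\bar g=g\kappa$.
   Context: $\operatorname{VRep}(G)$ is the ring of finite-dimensional virtual representations over $k$ of a finite group $G$. For $x\in P$, $W_x$ is its stabilizer, $W_{xy}:=W_x\cap W_y$, $W_{xyz}:=W_x\cap W_y\cap W_z$. The ring $I^W(P)\otimes\mathbb{Z}[t]$ consists of collections $f=\{f_{xy}(t)\in\operatorname{VRep}(W_{xy})\otimes\mathbb{Z}[t]\mid x\le y\}$ (polynomials with virtual-representation coefficients) such that $f_{xy}$ is the pullback of $f_{\sigma(x)\sigma(y)}$ along the conjugation isomorphism $W_{xy}\to W_{\sigma(x)\sigma(y)}$, $\gamma\mapsto\sigma\gamma\sigma^{-1}$, for every $\sigma\in W$; addition is componentwise and multiplication is $(fg)_{xz}=\sum_{x\le y\le z}\frac{|W_{xyz}|}{|W_{xz}|}\operatorname{Ind}_{W_{xyz}}^{W_{xz}}\big((\operatorname{Res}^{W_{xy}}_{W_{xyz}}f_{xy})\otimes(\operatorname{Res}^{W_{yz}}_{W_{xyz}}g_{yz})\big)$, where the fraction-weighted sum over each $W_{xz}$-orbit of $y$'s means the single term $\operatorname{Ind}(\cdots)$ for one representative. This is an associative ring with unit $\delta$ ($\delta_{xx}$ = trivial one-dimensional representation of $W_x$ in degree $0$, $\delta_{xy}=0$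 for $x<y$). A $W$-invariant weak rank function is a collection $r_{xy}\in\mathbb{N}$ ($x\le y$) with $r_{xy}>0$ for $x<y$, $r_{xy}+r_{yz}=r_{xz}$ for $x\le y\le z$, and $r_{\sigma(x)\sigma(y)}=r_{xy}$ for $\sigma\in W$. Define $\mathscr{I}^W(P):=\{f\mid \deg f_{xy}(t)\le r_{xy}\ \forall x\le y\}$ and $\mathscr{I}^W_{1/2}(P):=\{f\mid \deg f_{xy}(t)<r_{xy}/2\ \forall x<y,\ f_{xx}=\delta_{xx}\ \forall x\}$. On $\mathscr{I}^W(P)$ define the involution $\bar f_{xy}(t):=t^{r_{xy}}f_{xy}(t^{-1})$. An element $\kappa\in\mathscr{I}^W(P)$ is a $P$-kernel if $\kappa_{xx}=\delta_{xx}$ for all $x$ and $\bar\kappa=\kappa^{-1}$. *)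

(* Defs.v *)
From HB Require Import structures.
From mathcomp Require Import all_boot all_order all_algebra all_fingroup.
From mathcomp Require Import generic_quotient mxrepresentation character.
From mathcomp Require Import mxtens ring.
From mathcomp Require Import boolp classical_sets cardinality fsbigop.

Set Implicit Arguments.
Unset Strict Implicit.
Unset Printing Implicit Defensive.

Import Order.TTheory GRing.Theory.

Local Open Scope ring_scope.
Local Open Scope quotient_scope.

Section Grothendieck.
Variable S : comPzSemiRingType.
Implicit Types a b c : S * S.

(* The pair (a1, a2) stands for the formal difference a1 - a2. *)
Definition groth_rel a b : bool :=
  `[< exists u : S, a.1 + b.2 + u = b.1 + a.2 + u >].

Lemma groth_relP a b :
  reflect (exists u : S, a.1 + b.2 + u = b.1 + a.2 + u) (groth_rel a b).
Proof. exact: asboolP. Qed.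

Fact groth_rel_refl : reflexive groth_rel.
Proof. by move=> a; apply/groth_relP; exists 0. Qed.

Fact groth_rel_sym : symmetric groth_rel.
Proof.
by move=> a b; apply/groth_relP/groth_relP => -[u e]; exists u; rewrite e.
Qed.

Fact groth_rel_trans : transitive groth_rel.
Proof.
move=> [b1 b2] [a1 a2] [c1 c2] /groth_relP[u /= e1] /groth_relP[v /= e2].
apply/groth_relP; exists (b1 + b2 + u + v) => /=.
have -> : a1 + c2 + (b1 + b2 + u + v) = (a1 + b2 + u) + (b1 + c2 + v) by ring.
by rewrite e1 e2; ring.
Qed.

Canonical groth_equiv :=
  EquivRel groth_rel groth_rel_refl groth_rel_sym groth_rel_trans.

Definition groth : Type := {eq_quot groth_rel}.
HB.instance Definition _ := Choice.on groth.
HB.instance Definition _ := EqQuotient.on groth.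

Lemma groth_eqP a b :
  \pi_groth a = \pi_groth b <-> exists u : S, a.1 + b.2 + u = b.1 + a.2 + u.
Proof.
split=> [/eqP|h]; last by apply/eqP; rewrite piE; apply/groth_relP.
by rewrite piE => /groth_relP.
Qed.

Definition groth_zero : groth := \pi_groth (0, 0).
Definition groth_one : groth := \pi_groth (1, 0).
Definition groth_opp (x : groth) : groth := \pi_groth ((repr x).2, (repr x).1).
Definition groth_add (x y : groth) : groth :=
  \pi_groth ((repr x).1 + (repr y).1, (repr x).2 + (repr y).2).
Definition groth_mul (x y : groth) : groth :=
  \pi_groth ((repr x).1 * (repr y).1 + (repr x).2 * (repr y).2,
       (repr x).1 * (repr y).2 + (repr x).2 * (repr y).1).

Lemma repr_groth a :
  exists u : S, (repr (\pi_groth a)).1 + a.2 + u = a.1 + (repr (\pi_groth a)).2 + u.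
Proof. by apply/groth_eqP; rewrite reprK. Qed.

Lemma pi_groth_opp a : groth_opp (\pi_groth a) = \pi_groth (a.2, a.1).
Proof.
have [u e] := repr_groth a; apply/groth_eqP; exists u => /=.
set ra := repr _ in e *; transitivity (a.1 + ra.2 + u); first by ring.
by rewrite -e; ring.
Qed.

Lemma pi_groth_add a b :
  groth_add (\pi_groth a) (\pi_groth b) = \pi_groth (a.1 + b.1, a.2 + b.2).
Proof.
have [u ea] := repr_groth a; have [v eb] := repr_groth b.
apply/groth_eqP; exists (u + v) => /=.
set ra := repr _ in ea *; set rb := repr _ in eb *.
transitivity ((ra.1 + a.2 + u) + (rb.1 + b.2 + v)); first by ring.
by rewrite ea eb; ring.
Qed.

Lemma pi_groth_mul a b : groth_mul (\pi_groth a) (\pi_groth b) =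
  \pi_groth (a.1 * b.1 + a.2 * b.2, a.1 * b.2 + a.2 * b.1).
Proof.
have [u ea] := repr_groth a; have [v eb] := repr_groth b.
rewrite /groth_mul; set ra := repr _ in ea *; set rb := repr _ in eb *.
transitivity (\pi_groth (a.1 * rb.1 + a.2 * rb.2, a.1 * rb.2 + a.2 * rb.1)).
  apply/groth_eqP; exists (u * rb.1 + u * rb.2) => /=.
  transitivity ((ra.1 + a.2 + u) * rb.1 + (a.1 + ra.2 + u) * rb.2); first by ring.
  by rewrite ea -[in X in _ + X]ea; ring.
apply/groth_eqP; exists (a.1 * v + a.2 * v) => /=.
transitivity (a.1 * (rb.1 + b.2 + v) + a.2 * (b.1 + rb.2 + v)); first by ring.
by rewrite eb -[in X in _ + X]eb; ring.
Qed.

Lemma groth_addA : associative groth_add.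
Proof.
elim/quotW=> a; elim/quotW=> b; elim/quotW=> c.
rewrite (pi_groth_add b c) (pi_groth_add a b) !pi_groth_add /=.
by rewrite !addrA.
Qed.

Lemma groth_addC : commutative groth_add.
Proof.
elim/quotW=> a; elim/quotW=> b; rewrite !pi_groth_add /=.
by congr (\pi_groth (_, _)); rewrite addrC.
Qed.

Lemma groth_add0 : left_id groth_zero groth_add.
Proof.
elim/quotW=> a; rewrite pi_groth_add /= !add0r.
by case: a.
Qed.

Lemma groth_addN : left_inverse groth_zero groth_opp groth_add.
Proof.
elim/quotW=> a; rewrite (pi_groth_opp a) pi_groth_add /=.
by apply/groth_eqP; exists 0 => /=; ring.
Qed.

HB.instance Definition _ := GRing.isZmodule.Build groth
  groth_addA groth_addC groth_add0 groth_addN.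

Lemma groth_mulA : associative groth_mul.
Proof.
elim/quotW=> a; elim/quotW=> b; elim/quotW=> c.
rewrite (pi_groth_mul b c) (pi_groth_mul a b) !pi_groth_mul /=.
by congr (\pi_groth (_, _)); ring.
Qed.

Lemma groth_mulC : commutative groth_mul.
Proof.
elim/quotW=> a; elim/quotW=> b; rewrite !pi_groth_mul /=.
by congr (\pi_groth (_, _)); ring.
Qed.

Lemma groth_mul1 : left_id groth_one groth_mul.
Proof.
elim/quotW=> a; rewrite pi_groth_mul /= !mul1r !mul0r !addr0.
by case: a.
Qed.

Lemma groth_mulDl : left_distributive groth_mul +%R.
Proof.
elim/quotW=> a; elim/quotW=> b; elim/quotW=> c.
rewrite /GRing.add /= (pi_groth_add a b) (pi_groth_mul a c) (pi_groth_mul b c).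
rewrite pi_groth_mul pi_groth_add /=.
by congr (\pi_groth (_, _)); ring.
Qed.

HB.instance Definition _ := GRing.Zmodule_isComPzRing.Build groth
  groth_mulA groth_mulC groth_mul1 groth_mulDl.

End Grothendieck.

Section GrothendieckMap.
Variables (S T : comPzSemiRingType) (f : {additive S -> T}).

Definition groth_map (x : groth S) : groth T :=
  \pi_(groth T) (f (repr x).1, f (repr x).2).

Lemma pi_groth_map (a : S * S) :
  groth_map (\pi_(groth S) a) = \pi_(groth T) (f a.1, f a.2).
Proof.
have [u e] := repr_groth a; apply/groth_eqP; exists (f u) => /=.
by rewrite -!raddfD e.
Qed.

Fact groth_map_is_nmod_morphism : nmod_morphism groth_map.
Proof.
split; first by rewrite pi_groth_map /= !raddf0.
elim/quotW=> a; elim/quotW=> b.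
by rewrite /GRing.add /= (pi_groth_add a b) !pi_groth_map pi_groth_add /= !raddfD.
Qed.

HB.instance Definition _ := GRing.isNmodMorphism.Build (groth S) (groth T)
  groth_map groth_map_is_nmod_morphism.

End GrothendieckMap.

Section RepIso.
Variables (k : fieldType) (gT : finGroupType) (G : {group gT}).
Implicit Types V W : representation k G.

HB.instance Definition _ := gen_eqMixin (representation k G).
HB.instance Definition _ := gen_choiceMixin (representation k G).

Lemma mx_rsim_inv V W (B : 'M_(rdegree V, rdegree W)) (C : 'M_(rdegree W, rdegree V)) :
    B *m C = 1%:M -> C *m B = 1%:M ->
    (forall x, x \in G -> V x *m B = B *m W x) ->
  mx_rsim V W.
Proof.
move=> BC CB hB; have fB : row_free B by apply/row_freeP; exists C.
exists B => //; apply/eqP; rewrite eqn_leq -{1}(eqP fB) rank_leq_col /=.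
by have /eqP <- : row_free C by [apply/row_freeP; exists B]; rewrite rank_leq_col.
Qed.

Lemma mx_rsim_bij (I : finType) V W
    (p : I -> 'I_(rdegree V)) (q : I -> 'I_(rdegree W)) :
    bijective p -> bijective q ->
    (forall x, x \in G -> forall i j, V x (p i) (p j) = W x (q i) (q j)) ->
  mx_rsim V W.
Proof.
case=> p' pK p'K [q' qK q'K] h.
have dE i j : (q (p' i) == j) = (i == p (q' j)).
  by apply/eqP/eqP => [<-|->]; rewrite ?qK ?p'K ?pK ?q'K.
pose B : 'M[k]_(rdegree V, rdegree W) := \matrix_(i, j) (q (p' i) == j)%:R.
pose C : 'M[k]_(rdegree W, rdegree V) := \matrix_(j, i) (q (p' i) == j)%:R.
apply: (@mx_rsim_inv _ _ B C).
- apply/matrixP=> i j; rewrite !mxE (bigD1 (q (p' i))) //= big1 => [|l /negPf nl].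
    rewrite !mxE eqxx mul1r addr0 (inj_eq (can_inj qK)) (inj_eq (can_inj p'K)).
    by rewrite eq_sym.
  by rewrite !mxE eq_sym nl mul0r.
- apply/matrixP=> i j; rewrite !mxE (bigD1 (p (q' i))) //= big1 => [|l /negPf nl].
    by rewrite !mxE dE eqxx mul1r addr0 pK q'K.
  by rewrite !mxE dE nl mul0r.
- move=> x Gx; apply/matrixP=> i j; rewrite !mxE.
  rewrite (bigD1 (p (q' j))) //= big1 => [|l /negPf nl]; last first.
    by rewrite !mxE dE nl mulr0.
  rewrite [RHS](bigD1 (q (p' i))) //= [X in _ = _ + X]big1 => [|l /negPf nl].
    rewrite !mxE dE !eqxx mulr1 mul1r !addr0 -{1}[i]p'K h //.
    by rewrite q'K.
  by rewrite !mxE eq_sym nl mul0r.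
Qed.

Definition rep_iso V W : bool := `[< mx_rsim V W >].

Lemma rep_isoP V W : reflect (mx_rsim V W) (rep_iso V W).
Proof. exact: asboolP. Qed.

Fact rep_iso_refl : reflexive rep_iso.
Proof. by move=> V; apply/rep_isoP/mx_rsim_refl. Qed.

Fact rep_iso_sym : symmetric rep_iso.
Proof. by move=> V W; apply/rep_isoP/rep_isoP => /mx_rsim_sym. Qed.

Fact rep_iso_trans : transitive rep_iso.
Proof.
by move=> V U W /rep_isoP h1 /rep_isoP h2; apply/rep_isoP/(mx_rsim_trans h1).
Qed.

Canonical rep_iso_equiv :=
  EquivRel rep_iso rep_iso_refl rep_iso_sym rep_iso_trans.

Definition repclass : Type := {eq_quot rep_iso}.
HB.instance Definition _ := Choice.on repclass.
HB.instance Definition _ := EqQuotient.on repclass.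

Lemma repclass_eqP V W : \pi_repclass V = \pi_repclass W <-> mx_rsim V W.
Proof.
split=> [/eqP|h]; last by apply/eqP; rewrite piE; apply/rep_isoP.
by rewrite piE => /rep_isoP.
Qed.

Lemma repr_repclass V : mx_rsim (repr (\pi_repclass V)) V.
Proof. by apply/repclass_eqP; rewrite reprK. Qed.

Definition dsum_index V W (u : 'I_(rdegree V) + 'I_(rdegree W)) :
  'I_(rdegree (dadd_grepr V W)) := unsplit u.
Arguments dsum_index : simpl never.

Lemma dsum_index_bij V W : bijective (@dsum_index V W).
Proof. by exists (@fintype.split _ _) => i; [exact: unsplitK | exact: splitK]. Qed.

Definition dsum_mx m n (A : 'M[k]_m) (B : 'M[k]_n) (u v : 'I_m + 'I_n) : k :=
  match u, v with
  | inl i, inl j => A i j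
  | inr i, inr j => B i j
  | _, _ => 0
  end.

Lemma dsumE V W x u v :
  dadd_grepr V W x (dsum_index u) (dsum_index v) = dsum_mx (V x) (W x) u v.
Proof.
case: u v => [i|i] [j|j] /=.
- exact: block_mxEul.
- by rewrite [LHS]block_mxEur mxE.
- by rewrite [LHS]block_mxEdl mxE.
- exact: block_mxEdr.
Qed.

Definition tens_rep V W := Representation (prod_repr V W).

Definition tens_index V W (u : 'I_(rdegree V) * 'I_(rdegree W)) :
  'I_(rdegree (tens_rep V W)) := mxtens_index u.
Arguments tens_index : simpl never.

Lemma tens_index_bij V W : bijective (@tens_index V W).
Proof.
by exists (@mxtens_unindex _ _) => i; [exact: mxtens_indexK | exact: mxtens_unindexK].
Qed.

Lemma trowE n1 (A : 'rV[k]_n1) m2 n2 (B : 'M[k]_(m2, n2)) i j l :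
  trow A B i (mxtens_index (j, l)) = A 0 j * B i l.
Proof.
elim: n1 A j => [A []//|n1 IH A j] /=; rewrite mxE.
case: splitP => /= [c e|c e].
  have {e} [j0 cl] : j = 0 /\ c = l.
    case: (unliftP 0 j) e => [j' ->|-> e]; last first.
      by split=> //; apply/val_inj; rewrite /= -e.
    by rewrite /= /bump /= add1n mulSn => e; move: (ltn_ord c); rewrite -e -addnA ltnNge leq_addr.
  by rewrite !mxE cl j0; congr (A _ _ * _); apply: val_inj.
case: (unliftP 0 j) e => [j' ->|-> e]; last first.
  have el : val l = (n2 + c)%N by exact: e.
  by move: (ltn_ord l); rewrite [X in (X < _)%N]el ltnNge leq_addr.
rewrite /= /bump /= add1n mulSn -addnA => /addnI e.
have -> : c = mxtens_index (j', l) by apply: val_inj.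
by rewrite IH !mxE; congr (A _ _ * _); apply: val_inj.
Qed.

Lemma tprod_tensmx m1 n1 (A : 'M[k]_(m1, n1)) m2 n2 (B : 'M[k]_(m2, n2)) :
  tprod A B = A *t B.
Proof.
apply/matrixP=> i j; rewrite -[i]mxtens_unindexK -[j]mxtens_unindexK.
case: (mxtens_unindex i) (mxtens_unindex j) => {}i i' [{}j j']; rewrite tensmxE.
elim: m1 A i => [A []//|m1 IH A i] /=; rewrite mxE.
case: splitP => /= [c e|c e].
  have {e} [i0 ci] : i = 0 /\ c = i'.
    case: (unliftP 0 i) e => [l ->|-> e]; last first.
      by split=> //; apply/val_inj; rewrite /= -e.
    by rewrite /= /bump /= add1n mulSn => e; move: (ltn_ord c); rewrite -e -addnA ltnNge leq_addr.
  by rewrite trowE !mxE ci i0; congr (A _ _ * _); apply: val_inj.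
case: (unliftP 0 i) e => [l ->|-> e]; last first.
  have el : val i' = (m2 + c)%N by exact: e.
  by move: (ltn_ord i'); rewrite [X in (X < _)%N]el ltnNge leq_addr.
rewrite /= /bump /= add1n mulSn -addnA => /addnI e.
have -> : c = mxtens_index (l, i') by apply: val_inj.
by rewrite IH !mxE; congr (A _ _ * _); apply: val_inj.
Qed.

Lemma tensE V W x u v :
  tens_rep V W x (tens_index u) (tens_index v) = V x u.1 v.1 * W x u.2 v.2.
Proof. by case: u v => [i i'] [j j']; rewrite /= tprod_tensmx [LHS]tensmxE. Qed.

Lemma triv_mx_repr n : mx_repr G (fun _ : gT => 1%:M : 'M[k]_n).
Proof. by split=> // x y _ _; rewrite mulmx1. Qed.

Definition triv_rep : representation k G :=
  Representation (MxRepresentation (triv_mx_repr 1)).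

Lemma mx_rsim_invP V W : mx_rsim V W ->
  exists (B : 'M_(rdegree V, rdegree W)) (C : 'M_(rdegree W, rdegree V)),
    [/\ B *m C = 1%:M, C *m B = 1%:M &
        forall x, x \in G -> V x *m B = B *m W x].
Proof.
case: V W => n V [m W] /= -[B nm fB hB]; case: m / nm => /= in W B fB hB *.
by exists B, (invmx B); split=> //; rewrite ?mulmxV ?mulVmx -?row_free_unit.
Qed.

Lemma dadd_rsim V V' W W' :
  mx_rsim V V' -> mx_rsim W W' -> mx_rsim (dadd_grepr V W) (dadd_grepr V' W').
Proof.
move=> /mx_rsim_invP[B [C [BC CB h]]] /mx_rsim_invP[B' [C' [BC' CB' h']]].
apply: (@mx_rsim_inv (dadd_grepr V W) (dadd_grepr V' W') (block_mx B 0 0 B') (block_mx C 0 0 C')).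
- by rewrite mulmx_block !(mulmx0, mul0mx, addr0, add0r) BC BC' -scalar_mx_block.
- by rewrite mulmx_block !(mulmx0, mul0mx, addr0, add0r) CB CB' -scalar_mx_block.
- by move=> x Gx; rewrite /= !mulmx_block !(mulmx0, mul0mx, addr0, add0r) h ?h'.
Qed.

Lemma tens_rsim V V' W W' :
  mx_rsim V V' -> mx_rsim W W' -> mx_rsim (tens_rep V W) (tens_rep V' W').
Proof.
move=> /mx_rsim_invP[B [C [BC CB h]]] /mx_rsim_invP[B' [C' [BC' CB' h']]].
apply: (@mx_rsim_inv (tens_rep V W) (tens_rep V' W') (tprod B B') (tprod C C')).
- by rewrite -tprodE BC BC' tprod1.
- by rewrite -tprodE CB CB' tprod1.
- by move=> x Gx; rewrite /= -!tprodE h ?h'.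
Qed.

Lemma mx_rsim_rdegree0 V W : rdegree V = 0%N -> rdegree W = 0%N -> mx_rsim V W.
Proof.
move=> V0 W0; apply: (@mx_rsim_bij void _ _ (of_void _) (of_void _)) => //.
  by apply: inj_card_bij => [[]|]; rewrite card_ord V0.
by apply: inj_card_bij => [[]|]; rewrite card_ord W0.
Qed.

Lemma daddA_rsim V W U :
  mx_rsim (dadd_grepr V (dadd_grepr W U)) (dadd_grepr (dadd_grepr V W) U).
Proof.
pose I := ('I_(rdegree V) + ('I_(rdegree W) + 'I_(rdegree U)))%type.
pose p (u : I) := match u with inl i => inl i | inr v => inr (@dsum_index W U v) end.
pose q (u : I) := match u with
  inl i => inl (@dsum_index V W (inl i))
| inr (inl i) => inl (@dsum_index V W (inr i)) | inr (inr i) => inr i end.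
apply: (@mx_rsim_bij I _ _ (fun u => dsum_index (p u)) (fun u => dsum_index (q u))).
- apply: (bij_comp (dsum_index_bij _ _)).
  have [g gK Kg] := dsum_index_bij W U.
  by exists (fun u => match u with inl i => inl i | inr v => inr (g v) end)
    => -[i|i] //=; rewrite ?gK ?Kg.
- apply: (bij_comp (dsum_index_bij _ _)).
  have [g gK Kg] := dsum_index_bij V W.
  exists (fun u => match u with inl v => match g v with
      inl i => inl i | inr i => inr (inl i) end | inr v => inr (inr v) end).
    by case=> [i|[i|i]] //=; rewrite gK.
  by case=> [v|i] //=; rewrite -[in RHS](Kg v); case: (g v).
- by move=> x Gx [i|[i|i]] [j|[j|j]]; rewrite !dsumE /= ?dsumE.
Qed.

Lemma daddC_rsim V W : mx_rsim (dadd_grepr V W) (dadd_grepr W V).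
Proof.
pose s (A B : Type) (u : A + B) : B + A := match u with inl i => inr i | inr i => inl i end.
apply: (@mx_rsim_bij _ _ _ (@dsum_index V W) (fun u => @dsum_index W V (s _ _ u))).
- exact: dsum_index_bij.
- by apply: (bij_comp (dsum_index_bij _ _)); exists (@s _ _) => -[].
- by move=> x Gx [i|i] [j|j]; rewrite !dsumE.
Qed.

Lemma dadd0_rsim V : mx_rsim (dadd_grepr (@grepr0 k gT G) V) V.
Proof.
apply: (@mx_rsim_bij _ _ _ (fun i => @dsum_index (@grepr0 k gT G) V (inr i)) id).
- apply: (bij_comp (dsum_index_bij _ _)).
  by apply: inj_card_bij => [i j [->]|] //; rewrite card_sum !card_ord.
- by exists id.
- by move=> x Gx i j; rewrite dsumE.
Qed.

Lemma tensA_rsim V W U :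
  mx_rsim (tens_rep V (tens_rep W U)) (tens_rep (tens_rep V W) U).
Proof.
pose I := ('I_(rdegree V) * ('I_(rdegree W) * 'I_(rdegree U)))%type.
pose p (u : I) := (u.1, @tens_index W U u.2).
pose q (u : I) := (@tens_index V W (u.1, u.2.1), u.2.2).
apply: (@mx_rsim_bij I _ _ (fun u => tens_index (p u)) (fun u => tens_index (q u))).
- apply: (bij_comp (tens_index_bij _ _)).
  have [g gK Kg] := tens_index_bij W U.
  by exists (fun u => (u.1, g u.2)) => -[i j] /=; rewrite /p /= ?gK ?Kg.
- apply: (bij_comp (tens_index_bij _ _)).
  have [g gK Kg] := tens_index_bij V W.
  exists (fun u => ((g u.1).1, ((g u.1).2, u.2))) => [[i [j l]]|[i j]] /=.
    by rewrite gK.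
  by rewrite /q /= -surjective_pairing Kg.
- by move=> x Gx u v; rewrite tensE [RHS]tensE [X in _ * X = _]tensE [X in _ = X * _]tensE mulrA.
Qed.

Lemma tensC_rsim V W : mx_rsim (tens_rep V W) (tens_rep W V).
Proof.
pose s (A B : Type) (u : A * B) : B * A := (u.2, u.1).
apply: (@mx_rsim_bij _ _ _ (@tens_index V W) (fun u => @tens_index W V (s _ _ u))).
- exact: tens_index_bij.
- by apply: (bij_comp (tens_index_bij _ _)); exists (@s _ _) => -[].
- by move=> x Gx u v; rewrite !tensE /= mulrC.
Qed.

Lemma tens1_rsim V : mx_rsim (tens_rep triv_rep V) V.
Proof.
apply: (@mx_rsim_bij _ _ _ (fun i => @tens_index triv_rep V (ord0, i)) id).
- apply: (bij_comp (tens_index_bij _ _)).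
  by apply: inj_card_bij => [i j [->]|] //; rewrite card_prod !card_ord mul1n.
- by exists id.
- by move=> x Gx i j; rewrite tensE /= mxE mul1r.
Qed.

Lemma tens0_rsim V : mx_rsim (tens_rep (@grepr0 k gT G) V) (@grepr0 k gT G).
Proof. by apply: mx_rsim_rdegree0; rewrite //= mul0n. Qed.

Lemma tensDl_rsim V W U :
  mx_rsim (tens_rep (dadd_grepr V W) U)
          (dadd_grepr (tens_rep V U) (tens_rep W U)).
Proof.
pose I := (('I_(rdegree V) + 'I_(rdegree W)) * 'I_(rdegree U))%type.
pose p (u : I) := (@dsum_index V W u.1, u.2).
pose q (u : I) := match u.1 with
  inl i => inl (@tens_index V U (i, u.2)) | inr i => inr (@tens_index W U (i, u.2)) end.
apply: (@mx_rsim_bij I _ _ (fun u => tens_index (p u)) (fun u => dsum_index (q u))).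
- apply: (bij_comp (tens_index_bij _ _)).
  have [g gK Kg] := dsum_index_bij V W.
  by exists (fun u => (g u.1, u.2)) => -[i j] /=; rewrite /p /= ?gK ?Kg.
- apply: (bij_comp (dsum_index_bij _ _)).
  have [g gK Kg] := tens_index_bij V U; have [g' gK' Kg'] := tens_index_bij W U.
  exists (fun u => match u with inl v => (inl (g v).1, (g v).2)
      | inr v => (inr (g' v).1, (g' v).2) end).
    by case=> [[i|i] j]; rewrite /q /= ?gK ?gK'.
  by case=> [v|v]; rewrite /q /= -surjective_pairing ?Kg ?Kg'.
- by move=> x Gx [[i|i] i'] [[j|j] j'];
    rewrite tensE !dsumE /= ?tensE ?dsumE ?mul0r.
Qed.

Definition repclass_zero : repclass := \pi_repclass (@grepr0 k gT G).
Definition repclass_one : repclass := \pi_repclass triv_rep.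
Definition repclass_add (x y : repclass) : repclass :=
  \pi_repclass (dadd_grepr (repr x) (repr y)).
Definition repclass_mul (x y : repclass) : repclass :=
  \pi_repclass (tens_rep (repr x) (repr y)).

Lemma pi_repclass_add V W :
  repclass_add (\pi_repclass V) (\pi_repclass W) = \pi_repclass (dadd_grepr V W).
Proof. by apply/repclass_eqP/dadd_rsim; apply: repr_repclass. Qed.

Lemma pi_repclass_mul V W :
  repclass_mul (\pi_repclass V) (\pi_repclass W) = \pi_repclass (tens_rep V W).
Proof. by apply/repclass_eqP/tens_rsim; apply: repr_repclass. Qed.

Fact repclass_addA : associative repclass_add.
Proof.
elim/quotW=> V; elim/quotW=> W; elim/quotW=> U.
rewrite (pi_repclass_add W U) (pi_repclass_add V W) !pi_repclass_add.
exact/repclass_eqP/daddA_rsim.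
Qed.

Fact repclass_addC : commutative repclass_add.
Proof.
elim/quotW=> V; elim/quotW=> W.
rewrite (pi_repclass_add V W) (pi_repclass_add W V).
exact/repclass_eqP/daddC_rsim.
Qed.

Fact repclass_add0 : left_id repclass_zero repclass_add.
Proof.
by elim/quotW=> V; rewrite (pi_repclass_add _ V); apply/repclass_eqP/dadd0_rsim.
Qed.

HB.instance Definition _ := GRing.isNmodule.Build repclass
  repclass_addA repclass_addC repclass_add0.

Fact repclass_mulA : associative repclass_mul.
Proof.
elim/quotW=> V; elim/quotW=> W; elim/quotW=> U.
rewrite (pi_repclass_mul W U) (pi_repclass_mul V W) !pi_repclass_mul.
exact/repclass_eqP/tensA_rsim.
Qed.

Fact repclass_mulC : commutative repclass_mul.
Proof.
elim/quotW=> V; elim/quotW=> W.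
rewrite (pi_repclass_mul V W) (pi_repclass_mul W V).
exact/repclass_eqP/tensC_rsim.
Qed.

Fact repclass_mul1 : left_id repclass_one repclass_mul.
Proof.
by elim/quotW=> V; rewrite (pi_repclass_mul _ V); apply/repclass_eqP/tens1_rsim.
Qed.

Fact repclass_mulDl : left_distributive repclass_mul +%R.
Proof.
elim/quotW=> V; elim/quotW=> W; elim/quotW=> U; rewrite /GRing.add /=.
rewrite (pi_repclass_add V W) (pi_repclass_mul V U) (pi_repclass_mul W U).
rewrite pi_repclass_mul pi_repclass_add.
exact/repclass_eqP/tensDl_rsim.
Qed.

Fact repclass_mul0 : left_zero 0 repclass_mul.
Proof.
by elim/quotW=> V; rewrite (pi_repclass_mul _ V); apply/repclass_eqP/tens0_rsim.
Qed.

HB.instance Definition _ := GRing.Nmodule_isComPzSemiRing.Build repclass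
  repclass_mulA repclass_mulC repclass_mul1 repclass_mulDl repclass_mul0.

(* Formal differences of isomorphism classes of representations: [V] = [W] in
   VRep iff V (+) U and W (+) U are isomorphic for some U. *)
Definition VRep : Type := groth repclass.
HB.instance Definition _ := GRing.ComPzRing.on VRep.

Fact VRep_one_neq0 : (1 : VRep) != 0.
Proof.
apply/eqP => /groth_eqP[u /=]; rewrite !addr0 add0r.
elim/quotW: u => U; rewrite [LHS](pi_repclass_add triv_rep U) => /repclass_eqP.
by move/mxrank_rsim => /= /eqP; rewrite -[X in _ == X]add0n eqn_add2r.
Qed.

HB.instance Definition _ := GRing.PzSemiRing_isNonZero.Build VRep VRep_one_neq0.

End RepIso.

Section BlockMatrix.
Variables (k : fieldType) (m : nat).

(* Block matrix with blocks A i j all of the same size n x p, the entry (a, b)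
   of the block A i j being at (mxtens_index (i, a), mxtens_index (j, b)). *)
Definition blk_mx n p (A : 'I_m -> 'I_m -> 'M[k]_(n, p)) : 'M[k]_(m * n, m * p) :=
  \matrix_(u, v) A (mxtens_unindex u).1 (mxtens_unindex v).1
                   (mxtens_unindex u).2 (mxtens_unindex v).2.

Lemma blk_mxE n p (A : 'I_m -> 'I_m -> 'M[k]_(n, p)) i j a b :
  blk_mx A (mxtens_index (i, a)) (mxtens_index (j, b)) = A i j a b.
Proof. by rewrite mxE !mxtens_indexK. Qed.

Lemma eq_blk_mx n p (A B : 'I_m -> 'I_m -> 'M[k]_(n, p)) :
  (forall i j, A i j = B i j) -> blk_mx A = blk_mx B.
Proof. by move=> h; apply/matrixP => u v; rewrite !mxE h. Qed.

Lemma blk_mx1 n : blk_mx (fun i j => (i == j)%:R%:M) = 1%:M :> 'M[k]_(m * n).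
Proof.
apply/matrixP=> u v; rewrite -[u]mxtens_unindexK -[v]mxtens_unindexK.
case: (mxtens_unindex u) (mxtens_unindex v) => i a [j b].
rewrite blk_mxE !mxE (inj_eq (can_inj (@mxtens_indexK _ _))) xpair_eqE.
by do 2![case: eqP => _].
Qed.

Lemma mul_blk_mx n p q (A : 'I_m -> 'I_m -> 'M[k]_(n, p))
    (B : 'I_m -> 'I_m -> 'M[k]_(p, q)) :
  blk_mx A *m blk_mx B = blk_mx (fun i l => \sum_j A i j *m B j l).
Proof.
apply/matrixP=> u v; rewrite -[u]mxtens_unindexK -[v]mxtens_unindexK.
case: (mxtens_unindex u) (mxtens_unindex v) => i a [l b].
rewrite blk_mxE summxE mxE.
rewrite (reindex (@mxtens_index m p)) /=; last first.
  by exists (@mxtens_unindex m p) => w _; rewrite ?mxtens_indexK ?mxtens_unindexK.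
rewrite (eq_bigr (fun w => A i w.1 a w.2 * B w.1 l w.2 b)) => [|[j c] _]; last first.
  by rewrite !blk_mxE.
rewrite -(pair_bigA _ (fun j c => A i j a c * B j l c b)) /=.
by apply: eq_bigr => j _; rewrite mxE.
Qed.

End BlockMatrix.

Section Induced.
Variables (k : fieldType) (gT : finGroupType) (H G : {group gT}).
Hypothesis sHG : H \subset G.

Definition ind_transversal (i : 'I_#|lcosets H G|) : gT :=
  fingroup.repr (enum_val i).
Local Notation t := ind_transversal.

Lemma ind_transversal_coset i : enum_val i = (t i *: H)%g.
Proof.
rewrite /t; have /lcosetsP[y _ ->] := enum_valP i.
apply/esym/lcoset_eqP; exact: mem_repr (lcoset_refl H y).
Qed.

Lemma mem_ind_transversal i : t i \in G.
Proof.
have /lcosetsP[y Gy e] := enum_valP i.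
have : t i \in (y *: H)%g by rewrite -e ind_transversal_coset lcoset_refl.
by rewrite mem_lcoset => /(fintype.subsetP sHG) h; rewrite -(groupMl _ (groupVr Gy)).
Qed.

Lemma ind_transversal_inj i j y :
  ((t i)^-1 * y)%g \in H -> ((t j)^-1 * y)%g \in H -> i = j.
Proof.
rewrite -!mem_lcoset => /lcoset_eqP hi /lcoset_eqP hj.
by apply: enum_val_inj; rewrite !ind_transversal_coset -hi -hj.
Qed.

Lemma ind_transversal_ex y : y \in G -> exists i, ((t i)^-1 * y)%g \in H.
Proof.
move=> Gy; have yH : (y *: H)%g \in lcosets H G by apply/lcosetsP; exists y.
exists (enum_rank_in yH (y *: H)%g).
by rewrite -mem_lcoset -ind_transversal_coset enum_rankK_in // lcoset_refl.
Qed.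

Section Repr.
Variable (n : nat) (rH : mx_representation k H n).

Definition ext_mx (x : gT) : 'M[k]_n := if x \in H then rH x else 0.

(* Matrix of x on the induced representation in the basis t_i (x) e_a, where
   the t_i form a transversal of the left cosets of H in G:  one has
   x t_j = t_i h for a unique i, and then h = t_i^-1 x t_j lies in H. *)
Definition ind_mx (x : gT) : 'M[k]_(#|lcosets H G| * n) :=
  blk_mx (fun i j => ext_mx ((t i)^-1 * x * t j)%g).

Lemma ind_mx_repr : mx_repr G ind_mx.
Proof.
split=> [|x y Gx Gy].
  rewrite -blk_mx1; apply: eq_blk_mx => i j; rewrite mulg1 /ext_mx.
  case: eqP => [->|ne]; first by rewrite mulVg group1 repr_mx1.
  case: ifP => [h|_]; last by rewrite -scalemx1 scale0r.
  by case: ne; apply: (ind_transversal_inj h); rewrite mulVg group1.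
rewrite mul_blk_mx; apply: eq_blk_mx => i l.
have [j hj] := ind_transversal_ex (groupM Gy (mem_ind_transversal l)).
rewrite (bigD1 j) //= big1 ?addr0 => [|j' /eqP ne]; last first.
  rewrite /ext_mx [X in _ *m X]ifF ?mulmx0 //; apply/negP; rewrite -mulgA => h.
  exact: ne (ind_transversal_inj h hj).
rewrite /ext_mx -(mulgA (t j)^-1%g) hj.
have -> : ((t i)^-1 * (x * y) * t l =
           (t i)^-1 * x * t j * ((t j)^-1 * (y * t l)))%g.
  by rewrite !mulgA mulgK.
rewrite groupMr //; case: ifP => [h|_]; last by rewrite mul0mx.
by rewrite repr_mxM.
Qed.

Definition ind_repr := MxRepresentation ind_mx_repr.

End Repr.

Definition ind_rep (V : representation k H) : representation k G :=
  Representation (ind_repr V).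

Lemma ind_rsim (V W : representation k H) :
  mx_rsim V W -> mx_rsim (ind_rep V) (ind_rep W).
Proof.
case/mx_rsim_invP=> [B [C [BC CB h]]].
pose blkD m n (A : 'M[k]_(m, n)) :=
  blk_mx (fun i j : 'I_#|lcosets H G| => if i == j then A else 0).
have blkDM m n p (A : 'M_(m, n)) (A' : 'M_(n, p)) :
    blkD _ _ A *m blkD _ _ A' = blkD _ _ (A *m A').
  rewrite mul_blk_mx; apply: eq_blk_mx => i j.
  rewrite (bigD1 i) //= big1 => [|l /negPf nl]; last by rewrite eq_sym nl mul0mx.
  by rewrite eqxx addr0; case: ifP; rewrite ?mulmx0.
have blkD1 m : blkD m m 1%:M = 1%:M.
  rewrite -blk_mx1; apply: eq_blk_mx => i j; case: ifP => // _.
  by rewrite -scalemx1 scale0r.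
apply: (@mx_rsim_inv _ _ _ (ind_rep V) (ind_rep W) (blkD _ _ B) (blkD _ _ C)).
- by rewrite blkDM BC blkD1.
- by rewrite blkDM CB blkD1.
- move=> x Gx; rewrite /= /ind_mx !mul_blk_mx; apply: eq_blk_mx => i j.
  rewrite (bigD1 j) //= big1 => [|l /negPf nl]; last by rewrite nl mulmx0.
  rewrite [RHS](bigD1 i) //= [X in _ = _ + X]big1 => [|l /negPf nl].
    by rewrite !eqxx !addr0 /ext_mx; case: ifP => // Hx; rewrite ?mul0mx ?mulmx0 ?h.
  by rewrite eq_sym nl mul0mx.
Qed.

Lemma ind_dadd_rsim (V W : representation k H) :
  mx_rsim (ind_rep (dadd_grepr V W)) (dadd_grepr (ind_rep V) (ind_rep W)).
Proof.
pose m := #|lcosets H G|.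
pose I := ('I_m * ('I_(rdegree V) + 'I_(rdegree W)))%type.
pose p (u : I) : 'I_(rdegree (ind_rep (dadd_grepr V W))) :=
  mxtens_index (u.1, @dsum_index _ _ _ V W u.2).
pose q (u : I) := match u.2 with
  inl i => inl (mxtens_index (u.1, i)) | inr i => inr (mxtens_index (u.1, i)) end.
apply: (@mx_rsim_bij _ _ _ I _ _ p
  (fun u => @dsum_index _ _ _ (ind_rep V) (ind_rep W) (q u))).
- have [g gK Kg] := dsum_index_bij V W.
  exists (fun u => ((mxtens_unindex u).1, g (mxtens_unindex u).2)) => [[i a]|u].
    by rewrite mxtens_indexK /= gK.
  rewrite -[RHS]mxtens_unindexK [X in _ = mxtens_index X]surjective_pairing.
  by congr (mxtens_index (_, _)); exact: Kg.
- apply: (bij_comp (dsum_index_bij _ _)).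
  exists (fun u => match u with
    | inl v => ((mxtens_unindex v).1, inl (mxtens_unindex v).2)
    | inr v => ((mxtens_unindex v).1, inr (mxtens_unindex v).2) end).
    case=> i [a|a].
      exact: (congr1 (fun w => (w.1, inl w.2)) (mxtens_indexK (i, a))).
    exact: (congr1 (fun w => (w.1, inr w.2)) (mxtens_indexK (i, a))).
  by case=> v; [congr (inl _) | congr (inr _)];
    rewrite -[RHS]mxtens_unindexK -surjective_pairing.
- move=> x Gx [i a] [j b]; rewrite dsumE [LHS]blk_mxE /= /ext_mx.
  case: ifP => hx; rewrite ?dsumE; case: a b => [a|a] [b|b];
    rewrite /= ?mxE ?mxtens_indexK /= /ext_mx ?hx ?mxE //.
Qed.

End Induced.

Section Conjugation.
Variables (k : fieldType) (gT : finGroupType) (H G : {group gT}) (s : gT).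
Hypothesis sHG : forall h, h \in H -> (s * h * s^-1)%g \in G.

Lemma conj_mx_repr n (rG : mx_representation k G n) :
  mx_repr H (fun h => rG (s * h * s^-1)%g).
Proof.
split=> [|x y Hx Hy]; first by rewrite mulg1 mulgV repr_mx1.
by rewrite -repr_mxM ?sHG // !mulgA mulgKV.
Qed.

(* Pullback along H -> G, h |-> s h s^-1. *)
Definition conj_rep (V : representation k G) : representation k H :=
  Representation (MxRepresentation (conj_mx_repr V)).

Lemma conj_rsim (V W : representation k G) :
  mx_rsim V W -> mx_rsim (conj_rep V) (conj_rep W).
Proof. by case=> B nVW fB hB; exists B => // x Hx; apply/hB/sHG. Qed.

Lemma conj_dadd_rsim (V W : representation k G) :
  mx_rsim (conj_rep (dadd_grepr V W)) (dadd_grepr (conj_rep V) (conj_rep W)).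
Proof.
apply: (@mx_rsim_bij _ _ _ _ (conj_rep (dadd_grepr V W))
  (dadd_grepr (conj_rep V) (conj_rep W)) _ _ (@dsum_index_bij _ _ _ V W)
  (@dsum_index_bij _ _ _ (conj_rep V) (conj_rep W))).
by move=> x Hx i j; rewrite [RHS]dsumE; exact: (@dsumE _ _ _ V W (s * x * s^-1)%g).
Qed.

End Conjugation.

Section Restriction.
Variables (k : fieldType) (gT : finGroupType) (H G : {group gT}).
Hypothesis sHG : H \subset G.

Definition res_rep (V : representation k G) : representation k H :=
  Representation (subg_repr V sHG).

Lemma res_rsim (V W : representation k G) :
  mx_rsim V W -> mx_rsim (res_rep V) (res_rep W).
Proof. by case=> B nVW fB hB; exists B => // x Hx; apply/hB/(fintype.subsetP sHG). Qed.

Lemma res_dadd_rsim (V W : representation k G) :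
  mx_rsim (res_rep (dadd_grepr V W)) (dadd_grepr (res_rep V) (res_rep W)).
Proof.
apply: (@mx_rsim_bij _ _ _ _ (res_rep (dadd_grepr V W))
  (dadd_grepr (res_rep V) (res_rep W)) _ _ (@dsum_index_bij _ _ _ V W)
  (@dsum_index_bij _ _ _ (res_rep V) (res_rep W))).
by move=> x Hx i j; rewrite [RHS]dsumE; exact: (@dsumE _ _ _ V W x).
Qed.

End Restriction.

Section RepclassMap.
Variables (k : fieldType) (gT rT : finGroupType).
Variables (G : {group gT}) (H : {group rT}).
Variable F : representation k G -> representation k H.

Definition repclass_map (x : repclass k G) : repclass k H :=
  \pi_(repclass k H) (F (repr x)).

Hypothesis Fsim : forall V W : representation k G, mx_rsim V W -> mx_rsim (F V) (F W).
Hypothesis Fdadd : forall V W : representation k G,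
  mx_rsim (F (dadd_grepr V W)) (dadd_grepr (F V) (F W)).
Hypothesis F0 : rdegree (F (@grepr0 k gT G)) = 0%N.

Lemma pi_repclass_map V :
  repclass_map (\pi_(repclass k G) V) = \pi_(repclass k H) (F V).
Proof. exact/repclass_eqP/Fsim/repr_repclass. Qed.

Lemma repclass_map_nmod_morphism : nmod_morphism repclass_map.
Proof.
split; first by rewrite pi_repclass_map; apply/repclass_eqP/mx_rsim_rdegree0.
elim/quotW=> V; elim/quotW=> W; rewrite /GRing.add /=.
rewrite (pi_repclass_add V W) !pi_repclass_map pi_repclass_add.
exact/repclass_eqP/Fdadd.
Qed.

End RepclassMap.

Section VRepMaps.
Variables (k : fieldType) (gT : finGroupType) (H G : {group gT}).

Section Ind.
Hypothesis sHG : H \subset G.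

Definition repclass_ind : repclass k H -> repclass k G :=
  repclass_map (ind_rep sHG).

Fact repclass_ind_nmod_morphism : nmod_morphism repclass_ind.
Proof.
apply: repclass_map_nmod_morphism; [exact: ind_rsim | exact: ind_dadd_rsim |].
by rewrite /= muln0.
Qed.

HB.instance Definition _ := GRing.isNmodMorphism.Build _ _
  repclass_ind repclass_ind_nmod_morphism.

Definition VInd : VRep k H -> VRep k G := groth_map repclass_ind.

HB.instance Definition _ := GRing.Additive.on VInd.
End Ind.

Section Res.
Hypothesis sHG : H \subset G.

Definition repclass_res : repclass k G -> repclass k H :=
  repclass_map (res_rep sHG).

Fact repclass_res_nmod_morphism : nmod_morphism repclass_res.
Proof.
by apply: repclass_map_nmod_morphism; [exact: res_rsim | exact: res_dadd_rsim |].
Qed.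

HB.instance Definition _ := GRing.isNmodMorphism.Build _ _
  repclass_res repclass_res_nmod_morphism.

Definition VRes : VRep k G -> VRep k H := groth_map repclass_res.

HB.instance Definition _ := GRing.Additive.on VRes.
End Res.

Section Conj.
Variable s : gT.
Hypothesis sHG : forall h, h \in H -> (s * h * s^-1)%g \in G.

Definition repclass_conj : repclass k G -> repclass k H :=
  repclass_map (conj_rep sHG).

Fact repclass_conj_nmod_morphism : nmod_morphism repclass_conj.
Proof.
by apply: repclass_map_nmod_morphism; [exact: conj_rsim | exact: conj_dadd_rsim |].
Qed.

HB.instance Definition _ := GRing.isNmodMorphism.Build _ _
  repclass_conj repclass_conj_nmod_morphism.

Definition VConj : VRep k G -> VRep k H := groth_map repclass_conj.

HB.instance Definition _ := GRing.Additive.on VConj.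
End Conj.

End VRepMaps.

Record poset_action (W : finGroupType) d (P : porderType d) := PosetAction {
  pact :> W -> P -> P;
  pact1 : forall x, pact 1%g x = x;
  pactM : forall s t x, pact (s * t)%g x = pact s (pact t x);
  pact_le : forall s x y, (x <= y)%O -> (pact s x <= pact s y)%O
}.

Definition locally_finite d (P : porderType d) : Prop :=
  forall x z : P, finite_set [set y : P | (x <= y <= z)%O]%classic.

Section Stabilizers.
Variables (W : finGroupType) (d : Order.disp_t) (P : porderType d).
Variable act : poset_action W P.

Definition stab (x : P) : {set W} := [set s | act s x == x]%SET.

Lemma stab_group_set x : group_set (stab x).
Proof.
apply/group_setP; split=> [|s t]; first by rewrite inE pact1.
by rewrite !inE pactM => /eqP hs /eqP ->; rewrite hs.
Qed.

Canonical stab_group x : {group W} := Group (stab_group_set x).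

Definition stab2 (x y : P) : {group W} := (stab_group x :&: stab_group y)%G.
Definition stab3 (x y z : P) : {group W} :=
  (stab_group x :&: stab_group y :&: stab_group z)%G.

Lemma stab3_xy x y z : stab3 x y z \subset stab2 x y.
Proof. exact: subsetIl. Qed.

Lemma stab3_yz x y z : stab3 x y z \subset stab2 y z.
Proof. by rewrite /= -finset.setIA subsetIr. Qed.

Lemma stab3_xz x y z : stab3 x y z \subset stab2 x z.
Proof. by rewrite /= finset.setSI // subsetIl. Qed.

Lemma stab_conj s x g : g \in stab x -> (s * g * s^-1)%g \in stab (act s x).
Proof. by rewrite !inE !pactM -(pactM act s^-1%g) mulVg pact1 => /eqP ->. Qed.

Lemma stab2_conj s x y g : g \in stab2 x y ->
  (s * g * s^-1)%g \in stab2 (act s x) (act s y).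
Proof. by case/setIP=> gx gy; apply/setIP; split; apply: stab_conj. Qed.

(* A representative of the W_xz-orbit of y; it depends only on the orbit. *)
Definition orbit_repr (x z y : P) : P :=
  choose [pred y' | [exists s in stab2 x z, act s y == y']] y.

Definition weak_rank_function (r : P -> P -> nat) : Prop :=
  [/\ forall x y, (x < y)%O -> (0 < r x y)%N,
      forall x y z, (x <= y)%O -> (y <= z)%O -> (r x y + r y z = r x z)%N
    & forall s x y, (x <= y)%O -> r (act s x) (act s y) = r x y].

End Stabilizers.

Section Incidence.
Variables (k : fieldType) (W : finGroupType) (d : Order.disp_t).
Variables (P : porderType d) (act : poset_action W P).

(* Families (f_xy) with f_xy in VRep(W_xy)[t] for x <= y; the elements of
   I^W(P) (x) Z[t] are those satisfying inc_equivariant. *)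
Definition incidence : Type :=
  forall x y : P, (x <= y)%O -> {poly VRep k (stab2 act x y)}.

Implicit Types f g : incidence.

Definition inc_equivariant f : Prop :=
  forall (s : W) (x y : P) (le_xy : (x <= y)%O),
    f x y le_xy =
    map_poly (VConj (@stab2_conj _ _ _ act s x y))
             (f (act s x) (act s y) (pact_le act s le_xy)).

Definition inc_delta : incidence := fun x y _ => (x == y)%:R.

Definition interval (x z : P) : Type := {y : P | (x <= y <= z)%O}.
HB.instance Definition _ x z := Choice.on (interval x z).

Lemma interval_ge x z (y : interval x z) : (x <= val y)%O.
Proof. by case/andP: (valP y). Qed.

Lemma interval_le x z (y : interval x z) : (val y <= z)%O.
Proof. by case/andP: (valP y). Qed.

Definition inc_mul_term f g x z (y : interval x z) :
    {poly VRep k (stab2 act x z)} :=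
  map_poly (VInd (stab3_xz act x (val y) z))
    (map_poly (VRes (stab3_xy act x (val y) z)) (f x (val y) (interval_ge y)) *
     map_poly (VRes (stab3_yz act x (val y) z)) (g (val y) z (interval_le y))).

(* The sum has one term for each W_xz-orbit in the interval [x, z]. *)
Definition inc_mul f g : incidence := fun x z _ =>
  \sum_(y \in [set y : interval x z | orbit_repr act x z (val y) = val y]%classic)
    inc_mul_term f g y.

Definition inc_inverse f g : Prop :=
  inc_mul f g = inc_delta /\ inc_mul g f = inc_delta.

Variable r : P -> P -> nat.

Definition scrI f : Prop :=
  inc_equivariant f /\
  forall x y (le_xy : (x <= y)%O), (size (f x y le_xy) <= (r x y).+1)%N.

(* (size p).-1 is the degree of p, except that it is 0 for p = 0: this is
   harmless as the degree is only compared with r x y / 2 > 0. *)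
Definition scrI_half f : Prop :=
  [/\ inc_equivariant f,
      forall x y (le_xy : (x <= y)%O), (x < y)%O ->
        (2 * (size (f x y le_xy)).-1 < r x y)%N
    & forall x (le_xx : (x <= x)%O), f x x le_xx = inc_delta le_xx].

(* t^(r_xy) f_xy(t^-1), for f_xy of degree at most r_xy *)
Definition inc_bar f : incidence := fun x y le_xy =>
  \poly_(i < (r x y).+1) (f x y le_xy)`_(r x y - i).

Definition P_kernel (kappa : incidence) : Prop :=
  [/\ scrI kappa,
      forall x (le_xx : (x <= x)%O), kappa x x le_xx = inc_delta le_xx
    & inc_inverse kappa (inc_bar kappa)].

End Incidence.

(* Main.v *)
Require Import Defs.
From HB Require Import structures.
From mathcomp Require Import all_boot all_order all_algebra all_fingroup.
From mathcomp Require Import generic_quotient mxrepresentation character.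
From mathcomp Require Import mxtens ring zify finmap.
From mathcomp Require Import boolp classical_sets cardinality fsbigop.

(* Write Q f = kappa f - f. At x < z it involves only the values of f on proper
   subintervals, and bar f = kappa f says bar(f_xz) - f_xz = (Q f)_xz. Since
   deg f_xz < r_xz / 2, this forces f_xz to be minus the part of (Q f)_xz of
   degree less than r_xz / 2, whence uniqueness; it is solvable iff
   bar(Q f)_xz = - (Q f)_xz, which follows from bar kappa kappa = delta by
   induction, except that for even r_xz the middle coefficient must be shown to
   vanish rather than just to be killed by 2.  Two facts are thus needed.

   - VRep has no 2-torsion: Krull-Schmidt cancellation, with Fitting's lemma
     providing summands with local endomorphism ring.

   - Associativity of the product: a sum over G-orbits of induced
     representations Ind F(y) is the class of any representation of G graded by
     the G-set of the y's with stalks F(y).  Mackey's formula and the exchange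
     of two such sums amount to computing the class of one graded
     representation in two ways; by additivity it is enough to treat graded
     representations supported on one orbit, i.e. induced ones. *)

Set Implicit Arguments.
Unset Strict Implicit.
Unset Printing Implicit Defensive.

Import Order.TTheory GRing.Theory.

Local Open Scope ring_scope.
Local Open Scope quotient_scope.

(** * Direct summands and induction *)

(** The field is arbitrary, so neither characters nor complete reducibility are available:
    representations are compared by explicit isomorphisms, and [VRep] sees direct sums but not
    extensions. Hence the language of idempotents: a summand is always given as the image of an
    idempotent endomorphism, with explicit maps [i] and [p] through which it factors. The product
    picks one element in each orbit, and the group acting varies with the term. Restriction to a
    smaller stabilizer splits orbits and changes the chosen elements, so the two bracketings of a
    triple product have no common list of terms. A graded representation involves no chosen
    elements, which is why the comparison passes through it. Associativity is wanted for one
    identity, bar kappa (kappa f) = f, and its mirror image. The equations for f and g then become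
    one argument about an operator that differs from the identity by terms of lower rank. *)

Section Summand.
Variables (k : fieldType) (gT : finGroupType).
Implicit Types G H K : {group gT}.

(* The representation [V] of [H] is the image of the idempotent endomorphism
   [E] of the restriction of [R] to [H]. *)
Definition summand G H (R : representation k G) (E : 'M_(rdegree R))
    (V : representation k H) : Prop :=
  exists (i : 'M_(rdegree V, rdegree R)) (p : 'M_(rdegree R, rdegree V)),
    [/\ i *m p = 1%:M, p *m i = E &
        forall h, h \in H -> V h *m i = i *m R h /\ R h *m p = p *m V h].

Lemma summand1_rsim G (R V : representation k G) :
  summand (1%:M : 'M_(rdegree R)) V -> mx_rsim V R.
Proof. by move=> [i [p [ip pi h]]]; apply: (@mx_rsim_inv _ _ _ _ _ i p) => // x /h[]. Qed.

Lemma summand_ex G H (R : representation k G) (E : 'M_(rdegree R)) :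
    H \subset G -> E *m E = E -> (forall h, h \in H -> R h *m E = E *m R h) ->
  exists V : representation k H, summand E V.
Proof.
move=> sHG EE hE.
have [r [i [p [ip pi]]]] : exists r (i : 'M_(r, rdegree R)) (p : 'M_(rdegree R, r)),
    i *m p = 1%:M /\ p *m i = E.
  have pi : col_base E *m row_base E = E by exact: mulmx_base.
  (* [q] and [j] are one-sided inverses of the two factors of [E]; cancelling them on the two sides
     of p i p i = p i leaves i p = 1. *)
  have [q pq] : exists q, q *m col_base E = 1%:M by apply/row_fullP/col_base_full.
  have [j ij] : exists j, row_base E *m j = 1%:M by apply/row_freeP/row_base_free.
  exists (\rank E), (row_base E), (col_base E); split=> //.
  move: (row_base E) (col_base E) pi pq ij => i p pi pq ij.
  have : q *m (p *m i *m (p *m i)) *m j = q *m (p *m i) *m j by rewrite pi EE.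
  by rewrite -!mulmxA ij mulmx1 !mulmxA pq !mul1mx.
have repV : mx_repr H (fun h => i *m R h *m p).
  split=> [|x y Hx Hy]; first by rewrite repr_mx1 mulmx1.
  rewrite repr_mxM ?(fintype.subsetP sHG) // -!mulmxA; congr (_ *m _).
  rewrite [p *m _]mulmxA pi [E *m _]mulmxA -hE // -!mulmxA -pi -!mulmxA.
  by rewrite ip mulmx1.
exists (Representation (MxRepresentation repV)), i, p; split=> // h Hh /=.
split; last by rewrite 2!mulmxA pi -hE // -pi -!mulmxA ip mulmx1.
by rewrite -mulmxA pi -mulmxA hE // -pi -!mulmxA mulmxA ip mul1mx.
Qed.

Lemma summand_add G H (R : representation k G) (E E' : 'M_(rdegree R))
    (V V' : representation k H) :
    E *m E' = 0 -> E' *m E = 0 -> summand E V -> summand E' V' ->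
  summand (E + E') (dadd_grepr V V').
Proof.
move=> EE' E'E [i [p [ip pi h]]] [i' [p' [ip' pi' h']]].
have z : i *m p' = 0.
  rewrite -[i]mul1mx -ip -(mulmxA i) pi -[p']mulmx1 -ip' [p' *m _]mulmxA pi'.
  by rewrite mulmxA -(mulmxA i) EE' mulmx0 mul0mx.
have z' : i' *m p = 0.
  rewrite -[i']mul1mx -ip' -(mulmxA i') pi' -[p]mulmx1 -ip [p *m _]mulmxA pi.
  by rewrite mulmxA -(mulmxA i') E'E mulmx0 mul0mx.
exists (col_mx i i'), (row_mx p p'); split.
- by rewrite mul_col_row ip ip' z z' -scalar_mx_block.
- by rewrite mul_row_col pi pi'.
- move=> x Hx /=; have [a b] := h _ Hx; have [a' b'] := h' _ Hx.
  rewrite mul_block_col mul_mx_row mul_col_mx mul_row_block.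
  by rewrite !(mul0mx, mulmx0, addr0, add0r) a b a' b'.
Qed.

Lemma summand0 G H (R : representation k G) :
  summand (0 : 'M_(rdegree R)) (@grepr0 k gT H).
Proof. by exists 0, 0; split=> *; rewrite ?mulmx0 ?mul0mx //; apply/matrixP=> -[]. Qed.

Section Ind.
Variables (G H : {group gT}) (sHG : H \subset G).
Local Notation t := (@ind_transversal gT H G).
Local Notation m := #|lcosets H G|.

(** Block rows and columns over the cosets, in the indexing of [blk_mx]; maps into and out of an
    induced representation have this shape. *)
Definition row_blk q n (A : 'I_m -> 'M[k]_(q, n)) : 'M[k]_(q, m * n) :=
  \matrix_(a, v) A (mxtens_unindex v).1 a (mxtens_unindex v).2.

Definition col_blk q n (A : 'I_m -> 'M[k]_(n, q)) : 'M[k]_(m * n, q) :=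
  \matrix_(v, a) A (mxtens_unindex v).1 (mxtens_unindex v).2 a.

Lemma sum_blk n (F : 'I_(m * n) -> k) :
  \sum_v F v = \sum_j \sum_b F (mxtens_index (j, b)).
Proof.
rewrite pair_bigA /= (reindex (@mxtens_index m n)) /=.
  by apply: eq_bigr => -[].
by exists (@mxtens_unindex m n) => w _; rewrite ?mxtens_indexK ?mxtens_unindexK.
Qed.

Lemma eq_row_blk q n (A B : 'I_m -> 'M[k]_(q, n)) : A =1 B -> row_blk A = row_blk B.
Proof. by move=> h; apply/matrixP => u v; rewrite !mxE h. Qed.

Lemma eq_col_blk q n (A B : 'I_m -> 'M[k]_(n, q)) : A =1 B -> col_blk A = col_blk B.
Proof. by move=> h; apply/matrixP => u v; rewrite !mxE h. Qed.

Lemma mul_row_col_blk q n q' (A : 'I_m -> 'M[k]_(q, n)) (B : 'I_m -> 'M[k]_(n, q')) :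
  row_blk A *m col_blk B = \sum_j A j *m B j.
Proof.
apply/matrixP=> a b; rewrite mxE summxE sum_blk; apply: eq_bigr => j _.
by rewrite mxE; apply: eq_bigr => c _; rewrite !mxE mxtens_indexK.
Qed.

Lemma mul_col_row_blk q n n' (A : 'I_m -> 'M[k]_(n, q)) (B : 'I_m -> 'M[k]_(q, n')) :
  col_blk A *m row_blk B = blk_mx (fun i j => A i *m B j).
Proof. by apply/matrixP=> a b; rewrite !mxE; apply: eq_bigr => c _; rewrite !mxE. Qed.

Lemma mul_blk_col_blk q n p (A : 'I_m -> 'I_m -> 'M[k]_(n, p)) (B : 'I_m -> 'M[k]_(p, q)) :
  blk_mx A *m col_blk B = col_blk (fun i => \sum_j A i j *m B j).
Proof.
apply/matrixP=> a b; rewrite !mxE sum_blk summxE; apply: eq_bigr => j _.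
by rewrite mxE; apply: eq_bigr => c _; rewrite !mxE mxtens_indexK.
Qed.

Lemma mul_row_blk_blk q n p (A : 'I_m -> 'M[k]_(q, n)) (B : 'I_m -> 'I_m -> 'M[k]_(n, p)) :
  row_blk A *m blk_mx B = row_blk (fun j => \sum_i A i *m B i j).
Proof.
apply/matrixP=> a b; rewrite !mxE sum_blk summxE; apply: eq_bigr => j _.
by rewrite mxE; apply: eq_bigr => c _; rewrite !mxE mxtens_indexK.
Qed.

Lemma mul_mx_row_blk q n p (A : 'M[k]_(p, q)) (B : 'I_m -> 'M[k]_(q, n)) :
  A *m row_blk B = row_blk (fun j => A *m B j).
Proof. by apply/matrixP=> a b; rewrite !mxE; apply: eq_bigr => c _; rewrite !mxE. Qed.

Lemma mul_col_blk_mx q n p (A : 'I_m -> 'M[k]_(n, q)) (B : 'M[k]_(q, p)) :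
  col_blk A *m B = col_blk (fun j => A j *m B).
Proof. by apply/matrixP=> a b; rewrite !mxE; apply: eq_bigr => c _; rewrite !mxE. Qed.

Lemma ext_mxE n (rH : mx_representation k H n) x : x \in H -> ext_mx rH x = rH x.
Proof. by rewrite /ext_mx => ->. Qed.

(** Exactly one [t i] lies in the coset y H, so a single summand survives; for it, x t_i lies in H
    if and only if x y does. Most matrix identities about induction reduce to this one. *)
Lemma ext_mx_sum n (rH : mx_representation k H n) x y : y \in G ->
  \sum_i ext_mx rH (x * t i)%g *m ext_mx rH ((t i)^-1 * y)%g = ext_mx rH (x * y)%g.
Proof.
move=> Gy; have [j hj] := ind_transversal_ex H Gy.
rewrite (bigD1 j) //= big1 ?addr0 => [|j' /eqP ne]; last first.
  rewrite /ext_mx [X in _ *m X]ifF ?mulmx0 //; apply/negP => h.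
  exact: ne (ind_transversal_inj h hj).
rewrite /ext_mx hj.
have -> : (x * y = x * t j * ((t j)^-1 * y))%g by rewrite !mulgA mulgK.
by rewrite (groupMr _ hj); case: ifP => [h|_]; [rewrite -repr_mxM | rewrite mul0mx].
Qed.

Lemma ext_mx_tt n (rH : mx_representation k H n) i j :
  ext_mx rH ((t i)^-1 * t j)%g = (i == j)%:R%:M.
Proof.
rewrite /ext_mx; case: eqP => [->|ne]; first by rewrite mulVg group1 repr_mx1.
case: ifP => [h|_]; last by rewrite -scalemx1 scale0r.
by case: ne; apply: (ind_transversal_inj h); rewrite mulVg group1.
Qed.

(* Frobenius reciprocity's unit and counit. *)
Definition ind_in (V : representation k H) : 'M_(rdegree V, rdegree (ind_rep sHG V)) :=
  row_blk (fun j => ext_mx V (t j)).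
Definition ind_out (V : representation k H) : 'M_(rdegree (ind_rep sHG V), rdegree V) :=
  col_blk (fun j => ext_mx V (t j)^-1%g).

Lemma ind_inM V x : x \in G ->
  ind_in V *m ind_rep sHG V x = row_blk (fun j => ext_mx V (x * t j)%g).
Proof.
move=> Gx; rewrite mul_row_blk_blk; apply: eq_row_blk => j.
rewrite -[in RHS](mul1g (x * _)%g) -ext_mx_sum ?groupM ?mem_ind_transversal //.
by apply: eq_bigr => i _; rewrite mul1g mulgA.
Qed.

Lemma ind_outM V x : x \in G ->
  ind_rep sHG V x *m ind_out V = col_blk (fun j => ext_mx V ((t j)^-1 * x)%g).
Proof.
move=> Gx; rewrite mul_blk_col_blk; apply: eq_col_blk => j.
rewrite -[in RHS](mulg1 (_ * x)%g) -ext_mx_sum ?group1 //.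
by apply: eq_bigr => i _; rewrite mulg1.
Qed.

Lemma ind_in_out V x : x \in G ->
  ind_in V *m ind_rep sHG V x *m ind_out V = ext_mx V x.
Proof.
move=> Gx; rewrite ind_inM // mul_row_col_blk -[in RHS](mulg1 x) -ext_mx_sum //.
by apply: eq_bigr => i _; rewrite mulg1.
Qed.

Lemma ind_in_eqv (V : representation k H) h : h \in H ->
  V h *m ind_in V = ind_in V *m ind_rep sHG V h.
Proof.
move=> Hh; rewrite ind_inM ?(fintype.subsetP sHG) // mul_mx_row_blk.
apply: eq_row_blk => j; rewrite /ext_mx groupMl //.
by case: ifP => ?; rewrite ?repr_mxM ?mulmx0.
Qed.

Lemma ind_out_eqv (V : representation k H) h : h \in H ->
  ind_rep sHG V h *m ind_out V = ind_out V *m V h.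
Proof.
move=> Hh; rewrite ind_outM ?(fintype.subsetP sHG) // mul_col_blk_mx.
apply: eq_col_blk => j; rewrite /ext_mx groupMr //.
by case: ifP => ?; rewrite ?repr_mxM ?mul0mx.
Qed.

(** The translates of the copy of V exhaust the induced representation. In terms of [summand_ind]:
    its idempotent is the identity when R is Ind V itself, which the projection formula exploits. *)
Lemma ind_sum_proj V :
  \sum_j ind_rep sHG V (t j) *m ind_out V *m (ind_in V *m ind_rep sHG V (t j)^-1%g) = 1%:M.
Proof.
transitivity (blk_mx (fun i l : 'I_m => (i == l)%:R%:M) : 'M[k]_(m * rdegree V));
  last exact: blk_mx1.
rewrite (eq_bigr (fun j => blk_mx (fun i l =>
  ext_mx V ((t i)^-1 * t j)%g *m ext_mx V ((t j)^-1 * t l)%g))); last first.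
  move=> j _; rewrite ind_outM ?ind_inM ?groupV ?mem_ind_transversal //.
  by rewrite mul_col_row_blk.
apply/matrixP=> u v; rewrite -[u]mxtens_unindexK -[v]mxtens_unindexK.
case: (mxtens_unindex u) (mxtens_unindex v) => i a [l b].
rewrite summxE (eq_bigr _ (fun j _ => blk_mxE _ _ _ _ _)) blk_mxE -summxE.
by rewrite ext_mx_sum ?mem_ind_transversal // ext_mx_tt.
Qed.

(* [Ind V] is recognised inside [R] by the translates of a copy of [V]. *)
Lemma summand_ind (R : representation k G) (V : representation k H)
    (i : 'M_(rdegree V, rdegree R)) (p : 'M_(rdegree R, rdegree V)) :
    i *m p = 1%:M ->
    (forall h, h \in H -> V h *m i = i *m R h /\ R h *m p = p *m V h) ->
    (forall x, x \in G -> x \notin H -> i *m R x *m p = 0) ->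
  summand (\sum_j R (t j) *m p *m (i *m R (t j)^-1%g)) (ind_rep sHG V).
Proof.
move=> ip hip h0.
(* The compression of R to the copy of V is [ext_mx V] on all of G. Hence i R(t_a^-1 t_b) p is the
   identity for a = b and zero otherwise, which gives [I *m Q = 1%:M] below. *)
have iRp x : x \in G -> i *m R x *m p = ext_mx V x.
  move=> Gx; rewrite /ext_mx; case: ifP => [Hx|/negbT]; last exact: h0.
  by rewrite -(hip _ Hx).1 -mulmxA ip mulmx1.
have tG j : t j \in G by exact: mem_ind_transversal sHG j.
have tVG j : (t j)^-1%g \in G by rewrite groupV.
pose I : 'M_(rdegree (ind_rep sHG V), rdegree R) := col_blk (fun j => i *m R (t j)^-1%g).
pose Q : 'M_(rdegree R, rdegree (ind_rep sHG V)) := row_blk (fun j => R (t j) *m p).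
exists I, Q; split; first 1 last.
- exact: mul_row_col_blk.
- move=> x Gx; split.
    rewrite mul_blk_col_blk mul_col_blk_mx; apply: eq_col_blk => a.
    have [j hj] := ind_transversal_ex H (groupM (groupVr Gx) (tG a)).
    have hj' : ((t a)^-1 * x * t j)%g \in H by rewrite -groupV !invMg !invgK.
    rewrite (bigD1 j) //= big1 ?addr0 => [|j' /eqP ne]; last first.
      rewrite /ext_mx ifF ?mul0mx //; apply/negP; rewrite -groupV !invMg !invgK => h.
      exact: ne (ind_transversal_inj h hj).
    rewrite /= ext_mxE // mulmxA (hip _ hj').1 -!mulmxA -!repr_mxM ?groupM //.
    by rewrite mulgK.
  rewrite mul_mx_row_blk mul_row_blk_blk; apply: eq_row_blk => b.
  have [j hj] := ind_transversal_ex H (groupM Gx (tG b)); rewrite mulgA in hj.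
  rewrite (bigD1 j) //= big1 ?addr0 => [|j' /eqP ne]; last first.
    rewrite /ext_mx ifF ?mulmx0 //; apply/negP; rewrite -mulgA => h.
    by apply: ne (ind_transversal_inj h _); rewrite mulgA.
  rewrite -mulgA ext_mxE mulgA // -mulmxA -(hip _ hj).2 !mulmxA -!repr_mxM ?groupM //.
  by rewrite !mulgA mulgV mul1g.
- rewrite mul_col_row_blk -blk_mx1; apply: eq_blk_mx => a b.
  rewrite -(ext_mx_tt V) -iRp ?groupM // mulmxA -[_ *m R _ *m R _]mulmxA.
  by rewrite -repr_mxM.
Qed.

End Ind.
End Summand.

(** * Restriction, conjugation and induction of virtual representations *)

Section VRepTheory.
Variables (k : fieldType) (gT : finGroupType).
Implicit Types G H K : {group gT}.

Lemma tprod_sumr n (F : finType) m1 m2 (A : 'M[k]_n) (B : F -> 'M[k]_(m1, m2)) :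
  \sum_j tprod A (B j) = tprod A (\sum_j B j).
Proof.
apply/matrixP=> u v; rewrite -[u]mxtens_unindexK -[v]mxtens_unindexK.
case: (mxtens_unindex u) (mxtens_unindex v) => a a' [b b'].
rewrite summxE tprod_tensmx tensmxE summxE mulr_sumr.
by apply: eq_bigr => j _; rewrite tprod_tensmx tensmxE.
Qed.

Lemma tprod0r n m1 m2 (A : 'M[k]_n) : tprod A (0 : 'M_(m1, m2)) = 0.
Proof. by rewrite tprod_tensmx tensmx0. Qed.

(** The maps 1 tensor [ind_in] and 1 tensor [ind_out] put a copy of Res A tensor V inside A tensor
    Ind V. Since A(t_j) A(t_j)^-1 = 1, the translates of its idempotent only move the second factor,
    and they sum to 1 by [ind_sum_proj]; so [summand_ind] yields the whole space. *)
Lemma projection_rsim G H (sHG : H \subset G) (A : representation k G)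
    (V : representation k H) :
  mx_rsim (ind_rep sHG (tens_rep (res_rep sHG A) V)) (tens_rep A (ind_rep sHG V)).
Proof.
apply: summand1_rsim.
set t := @ind_transversal gT H G.
have tG j : t j \in G by exact: mem_ind_transversal sHG j.
pose i := tprod (1%:M : 'M_(rdegree A)) (ind_in sHG V).
pose p := tprod (1%:M : 'M_(rdegree A)) (ind_out sHG V).
have <- : \sum_j tens_rep A (ind_rep sHG V) (t j) *m p *m
    (i *m tens_rep A (ind_rep sHG V) (t j)^-1%g) = 1%:M.
  rewrite -tprod1 -(ind_sum_proj sHG V) -tprod_sumr; apply: eq_bigr => j _.
  by rewrite /i /p /= -!tprodE mulmx1 mul1mx -repr_mxM ?groupV // mulgV repr_mx1.
have ip0 : ind_in sHG V *m ind_out sHG V = 1%:M.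
  by rewrite -[ind_in _ _]mulmx1 -(repr_mx1 (ind_rep sHG V)) ind_in_out // ext_mxE ?repr_mx1.
apply: summand_ind.
- by rewrite -tprodE mulmx1 ip0 tprod1.
- move=> h Hh; rewrite /= -!tprodE !(mulmx1, mul1mx).
  by rewrite (ind_in_eqv sHG) // (ind_out_eqv sHG).
- move=> x Gx Hx; rewrite /= -!tprodE ind_in_out //.
  by rewrite /ext_mx (negPf Hx) tprod0r.
Qed.

Lemma repclass_ind_pi G H (sHG : H \subset G) (V : representation k H) :
  repclass_ind sHG (\pi_(repclass k H) V) = \pi_(repclass k G) (ind_rep sHG V).
Proof. exact: pi_repclass_map (@ind_rsim _ _ _ _ sHG) V. Qed.

Lemma repclass_res_pi G H (sHG : H \subset G) (V : representation k G) :
  repclass_res sHG (\pi_(repclass k G) V) = \pi_(repclass k H) (res_rep sHG V).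
Proof. exact: pi_repclass_map (@res_rsim _ _ _ _ sHG) V. Qed.

Lemma repclass_conj_pi G H s (sHG : forall h, h \in H -> (s * h * s^-1)%g \in G)
    (V : representation k G) :
  repclass_conj sHG (\pi_(repclass k G) V) = \pi_(repclass k H) (conj_rep sHG V).
Proof. exact: pi_repclass_map (@conj_rsim _ _ _ _ _ sHG) V. Qed.

Definition vclass G (a : repclass k G) : VRep k G := \pi_(groth (repclass k G)) (a, 0).

Lemma vclass_nmod_morphism G : nmod_morphism (@vclass G).
Proof.
split=> // a b; rewrite /vclass [RHS](pi_groth_add (a, 0) (b, 0)) /=.
by rewrite addr0.
Qed.

HB.instance Definition _ G := GRing.isNmodMorphism.Build (repclass k G) (VRep k G)
  (@vclass G) (@vclass_nmod_morphism G).

Lemma vclassM G (a b : repclass k G) : vclass (a * b) = vclass a * vclass b.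
Proof.
rewrite /vclass [RHS](pi_groth_mul (a, 0) (b, 0)) /=.
by rewrite !(mul0r, mulr0) addr0 addr0.
Qed.

(** The identities below are additive in each argument, so this reduces them to honest
    representations, for which an explicit isomorphism can be given. *)
Lemma VRepP G (v : VRep k G) : exists a b : repclass k G, v = vclass a - vclass b.
Proof.
elim/quotW: v => -[a b]; exists a, b; apply/eqP; rewrite eq_sym subr_eq; apply/eqP.
rewrite [RHS](pi_groth_add (a, b) (b, 0)) /=.
by apply/groth_eqP; exists 0; rewrite /= !addr0 addrC.
Qed.

Lemma VInd_vclass G H (sHG : H \subset G) (a : repclass k H) :
  VInd sHG (vclass a) = vclass (repclass_ind sHG a).
Proof. by rewrite /VInd pi_groth_map /= raddf0. Qed.

Lemma VRes_vclass G H (sHG : H \subset G) (a : repclass k G) :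
  VRes sHG (vclass a) = vclass (repclass_res sHG a).
Proof. by rewrite /VRes pi_groth_map /= raddf0. Qed.

Lemma VConj_vclass G H s (sHG : forall h, h \in H -> (s * h * s^-1)%g \in G)
    (a : repclass k G) :
  VConj sHG (vclass a) = vclass (repclass_conj sHG a).
Proof. by rewrite /VConj pi_groth_map /= raddf0. Qed.

Lemma repclassP G (a : repclass k G) : exists V, a = \pi_(repclass k G) V.
Proof. by exists (repr a); rewrite reprK. Qed.

Lemma repclassM G (V V' : representation k G) :
  \pi_(repclass k G) V * \pi_(repclass k G) V' = \pi_(repclass k G) (tens_rep V V').
Proof. exact: pi_repclass_mul. Qed.

Lemma repclassD G (V V' : representation k G) :
  \pi_(repclass k G) V + \pi_(repclass k G) V' = \pi_(repclass k G) (dadd_grepr V V').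
Proof. exact: pi_repclass_add. Qed.

Lemma eq_mx_rsim G n (r r' : mx_representation k G n) :
  {in G, r =1 r'} -> mx_rsim r r'.
Proof.
move=> h; exists 1%:M => // [|x Gx]; first by rewrite row_free_unit unitmx1.
by rewrite mulmx1 mul1mx h.
Qed.

Lemma VInd_projection G H (sHG : H \subset G) (a : VRep k G) (b : VRep k H) :
  a * VInd sHG b = VInd sHG (VRes sHG a * b).
Proof.
have [a1 [a2 ->]] := VRepP a; have [b1 [b2 ->]] := VRepP b.
suff P u v : vclass u * VInd sHG (vclass v) = VInd sHG (VRes sHG (vclass u) * vclass v).
  by rewrite !(raddfB, mulrBl, mulrBr) /= !P addrACA.
rewrite VInd_vclass VRes_vclass -!vclassM VInd_vclass; congr vclass.
have [A ->] := repclassP u; have [V ->] := repclassP v.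
rewrite repclass_ind_pi repclass_res_pi !repclassM repclass_ind_pi.
by apply/esym/repclass_eqP/projection_rsim.
Qed.

Lemma VResM G H (sHG : H \subset G) : {morph VRes (k := k) sHG : a b / a * b}.
Proof.
move=> a b; have [a1 [a2 ->]] := VRepP a; have [b1 [b2 ->]] := VRepP b.
suff P u v : VRes sHG (vclass u * vclass v) = VRes sHG (vclass u) * VRes sHG (vclass v).
  by rewrite !(raddfB, mulrBl, mulrBr) /= !P.
rewrite !VRes_vclass -!vclassM VRes_vclass; congr vclass.
have [A ->] := repclassP u; have [V ->] := repclassP v.
rewrite (repclassM A V) !repclass_res_pi repclassM.
by apply/repclass_eqP/eq_mx_rsim.
Qed.

Lemma VRes1 G H (sHG : H \subset G) : VRes sHG (1 : VRep k G) = 1.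
Proof.
have -> : (1 : VRep k G) = vclass 1 by [].
rewrite VRes_vclass; congr vclass; rewrite [LHS]repclass_res_pi.
by apply/repclass_eqP/eq_mx_rsim.
Qed.

HB.instance Definition _ G H (sHG : H \subset G) :=
  GRing.isMonoidMorphism.Build (VRep k G) (VRep k H) (VRes sHG)
    (VRes1 sHG, @VResM G H sHG).

Lemma VConjM G H s (sHG : forall h, h \in H -> (s * h * s^-1)%g \in G) :
  {morph VConj (k := k) sHG : a b / a * b}.
Proof.
move=> a b; have [a1 [a2 ->]] := VRepP a; have [b1 [b2 ->]] := VRepP b.
suff P u v : VConj sHG (vclass u * vclass v) = VConj sHG (vclass u) * VConj sHG (vclass v).
  by rewrite !(raddfB, mulrBl, mulrBr) /= !P.
rewrite !VConj_vclass -!vclassM VConj_vclass; congr vclass.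
have [A ->] := repclassP u; have [V ->] := repclassP v.
rewrite (repclassM A V) !repclass_conj_pi repclassM.
by apply/repclass_eqP/eq_mx_rsim.
Qed.

Lemma VConj1 G H s (sHG : forall h, h \in H -> (s * h * s^-1)%g \in G) :
  VConj sHG (1 : VRep k G) = 1.
Proof.
have -> : (1 : VRep k G) = vclass 1 by [].
rewrite VConj_vclass; congr vclass; rewrite [LHS]repclass_conj_pi.
by apply/repclass_eqP/eq_mx_rsim.
Qed.

HB.instance Definition _ G H s (sHG : forall h, h \in H -> (s * h * s^-1)%g \in G) :=
  GRing.isMonoidMorphism.Build (VRep k G) (VRep k H) (VConj sHG)
    (VConj1 sHG, @VConjM G H s sHG).

Lemma VRes_trans G H K (sHG : H \subset G) (sKH : K \subset H) (sKG : K \subset G)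
    (a : VRep k G) :
  VRes sKH (VRes sHG a) = VRes sKG a.
Proof.
have [u [v ->]] := VRepP a; rewrite !raddfB /= !VRes_vclass.
suff P (w : repclass k G) : repclass_res sKH (repclass_res sHG w) = repclass_res sKG w by rewrite !P.
have [V ->] := repclassP w; rewrite !repclass_res_pi.
by apply/repclass_eqP/eq_mx_rsim.
Qed.

Lemma VRes_conj G H G' H' s (sHG : H \subset G) (sHG' : H' \subset G')
    (cG : forall h, h \in G -> (s * h * s^-1)%g \in G')
    (cH : forall h, h \in H -> (s * h * s^-1)%g \in H') (a : VRep k G') :
  VRes sHG (VConj cG a) = VConj cH (VRes sHG' a).
Proof.
have [u [v ->]] := VRepP a; rewrite !raddfB /= !VConj_vclass !VRes_vclass !VConj_vclass.
suff P (w : repclass k G') : repclass_res sHG (repclass_conj cG w) = repclass_conj cH (repclass_res sHG' w).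
  by rewrite !P.
have [V ->] := repclassP w; rewrite (repclass_conj_pi cG) !repclass_res_pi repclass_conj_pi.
by apply/repclass_eqP/eq_mx_rsim.
Qed.

Lemma VInd_id G (sGG : G \subset G) (a : VRep k G) : VInd sGG a = a.
Proof.
have [u [v ->]] := VRepP a; rewrite !raddfB /= !VInd_vclass.
suff P (w : repclass k G) : repclass_ind sGG w = w by rewrite !P.
have [V ->] := repclassP w; rewrite repclass_ind_pi; apply/repclass_eqP.
have card1 : #|lcosets G G| = 1%N by rewrite card_lcosets indexgg.
apply: mx_rsim_sym; apply: (@mx_rsim_inv _ _ _ _ _ (ind_in sGG V) (ind_out sGG V)).
- by rewrite -[ind_in _ _]mulmx1 -(repr_mx1 (ind_rep sGG V)) ind_in_out // ext_mxE ?repr_mx1.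
- rewrite -(ind_sum_proj sGG V).
  have o : 'I_#|lcosets G G| by rewrite card1; exact: ord0.
  have all_eq (i j : 'I_#|lcosets G G|) : i = j.
    apply: val_inj; have := ltn_ord j; have := ltn_ord i.
    by rewrite [X in (i < X)%N]card1 [X in (j < X)%N]card1 !ltnS !leqn0 /= => /eqP -> /eqP ->.
  (* With a single coset the decomposition of the identity has one term; moving the equivariant maps
     past the action of [t o] cancels it against its inverse and leaves [ind_out *m ind_in]. *)
  rewrite (big_pred1 o) => [|i]; last by rewrite /= (all_eq i o) eqxx.
  have tG := mem_ind_transversal sGG o.
  rewrite ind_out_eqv // -mulmxA (mulmxA (V _)) (ind_in_eqv sGG) // -!mulmxA -repr_mxM ?groupV //.
  by rewrite mulgV repr_mx1 mulmx1.
- by move=> x Gx; exact: ind_in_eqv.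
Qed.

End VRepTheory.

(** * Krull-Schmidt cancellation *)

Section KrullSchmidt.
Variables (k : fieldType) (gT : finGroupType) (G : {group gT}).
Implicit Types V W X A B : representation k G.

Definition rep_hom V W (f : 'M_(rdegree V, rdegree W)) : Prop :=
  forall x, x \in G -> V x *m f = f *m W x.

(** For a nonzero representation this says that the endomorphism ring is local. The zero
    representation qualifies too, so positive degree is stated separately where it matters. *)
Definition rep_local X : Prop :=
  forall a, @rep_hom X X a -> a \in unitmx \/ 1%:M - a \in unitmx.

Lemma mulmx1C_eq m n (A : 'M[k]_(m, n)) (B : 'M_(n, m)) :
  m = n -> A *m B = 1%:M -> B *m A = 1%:M.
Proof. by move=> e; case: n / e A B => A B /mulmx1C. Qed.

Lemma rep_hom_mul V W U (f : 'M_(rdegree V, rdegree W)) (g : 'M_(rdegree W, rdegree U)) :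
  rep_hom f -> rep_hom g -> rep_hom (f *m g).
Proof. by move=> hf hg x Gx; rewrite mulmxA hf // -mulmxA hg // mulmxA. Qed.

Lemma rep_hom_sub V W (f g : 'M_(rdegree V, rdegree W)) :
  rep_hom f -> rep_hom g -> rep_hom (f - g).
Proof. by move=> hf hg x Gx; rewrite mulmxBr mulmxBl hf // hg. Qed.

Lemma rep_hom1 V : @rep_hom V V 1%:M.
Proof. by move=> x Gx; rewrite mulmx1 mul1mx. Qed.

Lemma rep_hom_inv V (f : 'M_(rdegree V)) :
  f \in unitmx -> @rep_hom V V f -> @rep_hom V V (invmx f).
Proof.
move=> uf hf x Gx.
by rewrite -[V x in LHS]mul1mx -(mulVmx uf) -!mulmxA (mulmxA f) -hf // mulmxK // ?mulmxA.
Qed.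

Lemma dadd_rsimP A B C D : mx_rsim (dadd_grepr A B) (dadd_grepr C D) ->
  exists (a : 'M_(rdegree A, rdegree C)) (b : 'M_(rdegree A, rdegree D))
    (c : 'M_(rdegree B, rdegree C)) (d : 'M_(rdegree B, rdegree D))
    (a' : 'M_(rdegree C, rdegree A)) (b' : 'M_(rdegree C, rdegree B))
    (c' : 'M_(rdegree D, rdegree A)) (d' : 'M_(rdegree D, rdegree B)),
  [/\ block_mx a b c d *m block_mx a' b' c' d' = 1%:M,
      block_mx a' b' c' d' *m block_mx a b c d = 1%:M,
      [/\ rep_hom a, rep_hom b, rep_hom c & rep_hom d] &
      [/\ rep_hom a', rep_hom b', rep_hom c' & rep_hom d']].
Proof.
move=> /mx_rsim_invP[/= f [g [fg gf hf]]].
have hg x : x \in G -> dadd_grepr C D x *m g = g *m dadd_grepr A B x.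
  move=> Gx; rewrite -[LHS]mul1mx -[in LHS]gf -!mulmxA (mulmxA f) -[f *m _]hf //.
  by rewrite -mulmxA fg mulmx1.
move: fg gf hf hg; rewrite -[f]submxK -[g]submxK /=.
move: (ulsubmx f) (ursubmx f) (dlsubmx f) (drsubmx f) => a b c d.
move: (ulsubmx g) (ursubmx g) (dlsubmx g) (drsubmx g) => a' b' c' d' fg gf hf hg.
exists a, b, c, d, a', b', c', d'; split=> //; split=> x Gx.
1-4: by have := hf x Gx; rewrite !mulmx_block !(mul0mx, mulmx0, addr0, add0r); case/eq_block_mx.
all: by have := hg x Gx; rewrite !mulmx_block !(mul0mx, mulmx0, addr0, add0r); case/eq_block_mx.
Qed.

(** Gaussian elimination: when the corner a is invertible, its Schur complement d - c a^-1 b is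
    inverse to the corner d' of the inverse matrix, and it is equivariant. *)
Lemma rep_cancel_unit X A B (a : 'M_(rdegree X)) (b : 'M_(rdegree X, rdegree B))
    (c : 'M_(rdegree A, rdegree X)) (d : 'M_(rdegree A, rdegree B))
    (a' : 'M_(rdegree X)) (b' : 'M_(rdegree X, rdegree A))
    (c' : 'M_(rdegree B, rdegree X)) (d' : 'M_(rdegree B, rdegree A)) :
    block_mx a b c d *m block_mx a' b' c' d' = 1%:M ->
    block_mx a' b' c' d' *m block_mx a b c d = 1%:M ->
    @rep_hom X X a -> rep_hom b -> rep_hom c -> rep_hom d -> a \in unitmx ->
  mx_rsim A B.
Proof.
rewrite !mulmx_block !scalar_mx_block => /eq_block_mx[_ e1 _ e2] /eq_block_mx[_ _ e3 e4].
move=> ha hb hc hd ua.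
apply: (@mx_rsim_inv _ _ _ _ _ (d - c *m invmx a *m b) d').
- have bE : b *m d' = - (a *m b') by apply/eqP; rewrite -addr_eq0 addrC e1.
  by rewrite mulmxBl -[_ *m b *m d']mulmxA bE mulmxN opprK mulmxA mulmxKV // addrC.
- have cE : d' *m c = - (c' *m a) by apply/eqP; rewrite -addr_eq0 addrC e3.
  by rewrite mulmxBr !mulmxA cE !mulNmx opprK mulmxK // addrC.
- apply: rep_hom_sub => //; apply: rep_hom_mul => //; apply: rep_hom_mul => //.
  exact: rep_hom_inv.
Qed.

(** The upper left corner of f g = 1 reads a a' + b c' = 1, so locality makes a a' or b c'
    invertible. In the first case a itself is invertible; the second is brought to it by a column
    operation on f, compensated by the inverse row operation on g. *)
Lemma rep_local_cancel X A B : rep_local X ->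
  mx_rsim (dadd_grepr X A) (dadd_grepr X B) -> mx_rsim A B.
Proof.
move=> locX /dadd_rsimP[a [b [c [d [a' [b' [c' [d' []]]]]]]]].
move=> fg gf [ha hb hc hd] [ha' hb' hc' hd'].
have : a *m a' + b *m c' = 1%:M.
  by move: fg; rewrite mulmx_block scalar_mx_block => /eq_block_mx[].
move=> /esym e; have bc : 1%:M - a *m a' = b *m c' by rewrite e addrC addKr.
have [|u|] := locX (a *m a'); first exact: rep_hom_mul.
  have /andP[ua _] : (a \in unitmx) && (a' \in unitmx) by rewrite -unitmx_mul.
  exact: rep_cancel_unit fg gf ha hb hc hd ua.
rewrite bc => ubc.
(* Replacing [a] by [a + b y = 1] reduces to the case of a unit. *)
pose y := c' *m (invmx (b *m c') *m (1%:M - a)).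
have hy : rep_hom y.
  apply: rep_hom_mul => //; apply: rep_hom_mul; first by apply: rep_hom_inv => //; apply: rep_hom_mul.
  by apply: rep_hom_sub => //; exact: rep_hom1.
pose L : 'M_(rdegree X + rdegree B) := block_mx 1%:M 0 y 1%:M.
pose L' : 'M_(rdegree X + rdegree B) := block_mx 1%:M 0 (- y) 1%:M.
have LL' : L *m L' = 1%:M.
  by rewrite mulmx_block !(mul0mx, mulmx0, mul1mx, mulmx1, addr0, add0r) subrr -scalar_mx_block.
have L'L : L' *m L = 1%:M by exact: mulmx1C.
have byE : a + b *m y = 1%:M by rewrite /y !mulmxA mulmxV // mul1mx addrC subrK.
have fL : block_mx a b c d *m L = block_mx 1%:M b (c + d *m y) d.
  by rewrite mulmx_block !(mul0mx, mulmx0, mul1mx, mulmx1, addr0, add0r) byE.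
have Lg : L' *m block_mx a' b' c' d' = block_mx a' b' (- (y *m a') + c') (- (y *m b') + d').
  by rewrite mulmx_block !(mul0mx, mulmx0, mul1mx, mulmx1, addr0, add0r) !mulNmx.
apply: (@rep_cancel_unit X A B 1%:M b (c + d *m y) d a' b' (- (y *m a') + c') (- (y *m b') + d')).
- by rewrite -fL -Lg mulmxA -(mulmxA _ L) LL' mulmx1.
- by rewrite -fL -Lg mulmxA -(mulmxA L') gf mulmx1.
- exact: rep_hom1.
- by [].
- by move=> x Gx; rewrite mulmxDr mulmxDl hc // (rep_hom_mul hd hy).
- by [].
- exact: unitmx1.
Qed.

Lemma rep_split_summand V X (i : 'M_(rdegree X, rdegree V)) (p : 'M_(rdegree V, rdegree X)) :
  i *m p = 1%:M -> rep_hom i -> rep_hom p -> exists W, mx_rsim V (dadd_grepr X W).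
Proof.
move=> ip hi hp; pose E := p *m i.
have EE : E *m E = E by rewrite /E mulmxA -(mulmxA p) ip mulmx1.
have sX : summand E X by exists i, p; split=> // x Gx; rewrite hi // hp.
have [|||W sW] := @summand_ex _ _ G G V (1%:M - E) => //.
- by rewrite mulmxBl mul1mx mulmxBr mulmx1 EE subrr subr0.
- by move=> x Gx; rewrite mulmxBl mulmxBr mulmx1 mul1mx (rep_hom_mul hp hi).
exists W; apply/mx_rsim_sym/summand1_rsim.
have -> : 1%:M = E + (1%:M - E) by rewrite addrC subrK.
by apply: summand_add => //; rewrite (mulmxBl, mulmxBr) ?mulmxBr (mulmx1, mul1mx) EE subrr.
Qed.

(** Exchange property. The identity of X is the sum of its composites through B and through C;
    locality makes one of them invertible, and inverting it exhibits X as a summand of that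
    factor. *)
Lemma rep_local_split X A B C : rep_local X ->
    mx_rsim (dadd_grepr X A) (dadd_grepr B C) ->
  (exists W, mx_rsim B (dadd_grepr X W)) \/ (exists W, mx_rsim C (dadd_grepr X W)).
Proof.
move=> locX /dadd_rsimP[a [b [c [d [a' [b' [c' [d' []]]]]]]]].
move=> fg gf [ha hb hc hd] [ha' hb' hc' hd'].
have : a *m a' + b *m c' = 1%:M.
  by move: fg; rewrite mulmx_block scalar_mx_block => /eq_block_mx[].
move=> /esym e; have bc : 1%:M - a *m a' = b *m c' by rewrite e addrC addKr.
have split D (i : 'M_(rdegree X, rdegree D)) (p : 'M_(rdegree D, rdegree X)) :
    rep_hom i -> rep_hom p -> i *m p \in unitmx -> exists W, mx_rsim D (dadd_grepr X W).
  move=> hi hp u; apply: (@rep_split_summand D X i (p *m invmx (i *m p))) => //.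
    by rewrite mulmxA mulmxV.
  by apply: rep_hom_mul => //; apply: rep_hom_inv => //; apply: rep_hom_mul.
have [|u|] := locX (a *m a'); first exact: rep_hom_mul.
  by left; apply: split u.
by rewrite bc => u; right; apply: split u.
Qed.

(* Fitting's lemma, by Bezout applied to the characteristic polynomial. *)
Lemma fitting_idempotent n (a : 'M[k]_n) :
    a \notin unitmx -> 1%:M - a \notin unitmx ->
  exists e : 'M[k]_n, [/\ e *m e = e, e != 0, e != 1%:M &
    forall b : 'M[k]_n, b *m a = a *m b -> b *m e = e *m b].
Proof.
case: n a => [|n] a nua nub.
  by move: nua; rewrite unitmxE det_mx00 unitr1.
have [m [q q0 chiE]] : exists m : nat, exists2 q : {poly k}, ~~ root q 0 & char_poly a = q * 'X^m.
  have [m [q h e]] := multiplicity_XsubC (char_poly a) 0.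
  exists m, q; first by apply: (implyP h); rewrite monic_neq0 // char_poly_monic.
  by rewrite e subr0.
(* With exponent m+1 rather than m, the idempotent always contains a factor a; so e = 1 would invert
   a, without a separate proof that m > 0. *)
have cop : coprimep ('X^(m.+1) : {poly k}) q.
  by apply: coprimep_expl; rewrite coprimep_sym coprimepX.
have /Bezout_eq1_coprimepP[[u v] /= uv] := cop.
pose h : {rmorphism {poly k} -> 'M[k]_n.+1} := horner_mx a.
have hX j : a ^+ j = h 'X^j by rewrite rmorphXn /= /h horner_mx_X.
have h1 : h u * a ^+ m.+1 + h v * h q = 1.
  by rewrite hX -!rmorphM -rmorphD uv rmorph1.
have CH : h q * a ^+ m = 0.
  by rewrite hX -rmorphM -chiE; exact: Cayley_Hamilton.
pose e := h u * a ^+ m.+1.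
have comm p p' : h p * h p' = h p' * h p by rewrite -!rmorphM mulrC.
(* The product e (1 - e) contains q(a) a^m, which is the characteristic polynomial evaluated at
   a. *)
have e0 : e * (1 - e) = 0.
  have -> : 1 - e = h v * h q by rewrite -h1 addrC addKr.
  rewrite /e exprSr hX -!mulrA.
  have -> : a = h 'X by rewrite /h /= horner_mx_X.
  have -> : h u * (h 'X^m * (h 'X * (h v * h q))) = h u * (h 'X * (h v * (h q * h 'X^m))).
    by rewrite -!rmorphM; congr (h _); ring.
  by rewrite -hX CH !mulr0.
exists e; split.
- by apply/eqP; rewrite eq_sym -subr_eq0 -[e in X in X - _]mulr1 -mulrBr e0.
(* If e = 0 then v(a) q(a) = 1, so q(a) a^m = 0 makes a nilpotent and the geometric series inverts 1
   - a. *)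
- apply: contra nub => /eqP ez.
  have an : a ^+ m.+1 = 0.
    have hv1 : h v * h q = 1 by rewrite -h1 -/e ez add0r.
    by rewrite -[LHS]mul1r -hv1 exprSr -[_ * h q * _]mulrA [h q * _]mulrA CH mul0r mulr0.
  have : (1%:M - a) *m (\sum_(i < m.+1) a ^+ i) = 1%:M.
    have := subrX1 a m.+1; rewrite an sub0r => /(congr1 -%R).
    by rewrite opprK -mulNr opprB => /esym.
  by case/mulmx1_unit.
- apply: contra nua => /eqP eo.
  have : (h u * a ^+ m) *m a = 1%:M by rewrite -eo /e exprSr mulrA.
  by case/mulmx1_unit.
- move=> b ba; rewrite /e hX -rmorphM.
  by apply: comm_mx_horner.
Qed.

(** Strong induction on the degree. An endomorphism violating locality has a Fitting idempotent,
    equivariant because it commutes with whatever commutes with the endomorphism. Being neither 0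
    nor 1, it has a nonzero image of smaller degree. *)
Lemma rep_local_summand V : (0 < rdegree V)%N ->
  exists X W, [/\ (0 < rdegree X)%N, rep_local X & mx_rsim V (dadd_grepr X W)].
Proof.
have [n] := ubnP (rdegree V); elim: n V => // n IH V /ltnSE leV V0.
have [locV|nloc] := pselect (rep_local V).
  exists V, (@grepr0 k gT G); split=> //.
  exact: mx_rsim_trans (mx_rsim_sym (dadd0_rsim V)) (daddC_rsim _ _).
have [a [ha nua nub]] : exists a, [/\ @rep_hom V V a, a \notin unitmx & 1%:M - a \notin unitmx].
  apply: contrapT => na; apply: nloc => a ha.
  by apply: contrapT => /not_orP[n1 n2]; apply: na; exists a; split=> //; apply/negP.
have [e [ee e0 e1 he]] := fitting_idempotent nua nub.
have hom_e : @rep_hom V V e by move=> x Gx; apply: he; apply: ha.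
have [|||U [i [p [ip pi hip]]]] := @summand_ex _ _ G G V e => //.
have [W VE] := rep_split_summand ip (fun x Gx => (hip x Gx).1) (fun x Gx => (hip x Gx).2).
have dimV : rdegree V = (rdegree U + rdegree W)%N by exact: mxrank_rsim VE.
have U0 : (0 < rdegree U)%N.
  rewrite lt0n; apply: contra e0 => /eqP U0; rewrite -pi.
  move: i p {ip pi hip VE dimV} => i p; apply/eqP/matrixP => s t.
  by rewrite !mxE big1 // => -[j ltj]; exfalso; rewrite U0 in ltj.
have W0 : (0 < rdegree W)%N.
  rewrite lt0n; apply: contra e1 => /eqP W0; rewrite W0 addn0 in dimV.
  by apply/eqP; rewrite -pi; exact: (mulmx1C_eq (esym dimV) ip).
have [|//|X [W' [X0 locX UE]]] := IH U.
  by rewrite (leq_trans _ leV) // dimV -addn1 leq_add2l.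
exists X, (dadd_grepr W' W); split=> //.
apply: mx_rsim_trans VE _; apply: mx_rsim_trans (dadd_rsim UE (mx_rsim_refl _)) _.
exact: mx_rsim_sym (daddA_rsim _ _ _).
Qed.

Local Notation cl := (\pi_(repclass k G)).

(** Local summands of U are cancelled one at a time, by induction on its degree, so no full
    decomposition into indecomposables has to be compared. *)
Lemma repclass_cancel (u a b : repclass k G) : u + a = u + b -> a = b.
Proof.
have [U ->] := repclassP u; have [n] := ubnP (rdegree U).
elim: n U a b => // n IH U a b /ltnSE leU.
have [U0|] := posnP (rdegree U).
  have -> : cl U = 0 by apply/repclass_eqP/mx_rsim_rdegree0.
  by rewrite !add0r.
case/rep_local_summand=> X [W [X0 locX UE]].
have -> : cl U = cl X + cl W by rewrite repclassD; apply/repclass_eqP.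
rewrite -!addrA => h; apply: (IH W).
  by rewrite (leq_trans _ leU) // (mxrank_rsim UE) /= -[X in (X < _)%N]add0n ltn_add2r.
have [A Ae] := repclassP (cl W + a); have [B Be] := repclassP (cl W + b).
rewrite Ae Be; apply/repclass_eqP/(rep_local_cancel locX)/repclass_eqP.
by rewrite -!repclassD -Ae -Be.
Qed.

(** A local summand X of V is one of B + B, hence of B by the exchange property. Writing a = X + W
    and b = X + W' and cancelling X twice leaves W + W = W' + W', in smaller degree. *)
Lemma repclass_double_inj (a b : repclass k G) : a + a = b + b -> a = b.
Proof.
have [V ->] := repclassP a; have [n] := ubnP (rdegree V).
elim: n V b => // n IH V b /ltnSE leV.
have [B ->] := repclassP b; have [V0|] := posnP (rdegree V).
  rewrite !repclassD => /repclass_eqP/mxrank_rsim /= /eqP.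
  rewrite V0 eq_sym addn_eq0 => /andP[/eqP B0 _].
  by apply/repclass_eqP/mx_rsim_rdegree0.
case/rep_local_summand=> X [W [X0 locX VE]].
have VE' : cl V = cl X + cl W by rewrite repclassD; apply/repclass_eqP.
rewrite VE' => h.
have [] : (exists W, mx_rsim B (dadd_grepr X W)) \/ (exists W, mx_rsim B (dadd_grepr X W)).
- apply: (@rep_local_split X (dadd_grepr W (dadd_grepr X W)) B B locX).
  by apply/repclass_eqP; rewrite -!repclassD -h -!addrA.
- 1-2: move=> [W' /repclass_eqP]; rewrite -repclassD => BE.
all: rewrite BE; congr (_ + _); apply: IH.
1,3: by rewrite (leq_trans _ leV) // (mxrank_rsim VE) /= -[X in (X < _)%N]add0n ltn_add2r.
all: apply: (@repclass_cancel (cl X + cl X)).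
all: by rewrite addrACA [RHS]addrACA h BE.
Qed.

Lemma VRep_double_eq0 (v : VRep k G) : v + v = 0 -> v = 0.
Proof.
have [a [b ->]] := VRepP v; rewrite addrACA -opprD => /eqP; rewrite subr_eq0 -!raddfD => /eqP.
move=> /groth_eqP[u /=]; rewrite !addr0 ![_ + u]addrC => /repclass_cancel/repclass_double_inj ->.
by rewrite subrr.
Qed.

End KrullSchmidt.

(** * Graded representations *)

Section GradedRep.
Variables (k : fieldType) (W : finGroupType).
Implicit Types G H : {group W}.

(** Forgetting the order of [poset_action] lets the same lemmas serve P and the pairs in P x P with
    the diagonal action. *)
Record left_action (T : choiceType) := LeftAction {
  lact :> W -> T -> T;
  lact1 : forall x, lact 1%g x = x;
  lactM : forall s t x, lact (s * t)%g x = lact s (lact t x)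
}.

Definition class_summand G H (R : representation k G) (E : 'M_(rdegree R))
    (c : repclass k H) : Prop :=
  exists2 V, c = \pi_(repclass k H) V & summand E V.

Lemma class_summand_sum G H (I : eqType) (r : seq I) (R : representation k G)
    (E : I -> 'M_(rdegree R)) (c : I -> repclass k H) :
    uniq r -> {in r &, forall i j, i != j -> E i *m E j = 0} ->
    {in r, forall i, class_summand (E i) (c i)} ->
  class_summand (\sum_(i <- r) E i) (\sum_(i <- r) c i).
Proof.
elim: r => [|i r IH] /= => [_ _ _|/andP[ir ur] orth Ec].
  by rewrite !big_nil; exists (@grepr0 k W H) => //; exact: summand0.
rewrite !big_cons.
have [V cV sV] := Ec i (mem_head _ _).
have [|j jr|V' cV' sV'] := IH ur.
- by move=> j l jr lr; apply: orth; rewrite inE ?jr ?lr orbT.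
- by apply: Ec; rewrite inE jr orbT.
have neq j : j \in r -> (i != j) && (j != i).
  by move=> jr; rewrite [j == i]eq_sym andbb; apply: contraNneq ir => ->.
exists (dadd_grepr V V'); first by rewrite cV cV' repclassD.
apply: summand_add => //; rewrite ?mulmx_sumr ?mulmx_suml big_seq big1 // => j jr;
  by apply: orth; rewrite ?mem_head ?inE ?jr ?orbT //; have /andP[] := neq j jr.
Qed.

Section Action.
Variables (T : choiceType) (to : left_action T).

Lemma lactK s : cancel (to s) (to s^-1%g).
Proof. by move=> x; rewrite -lactM mulVg lact1. Qed.

Lemma lactVK s : cancel (to s^-1%g) (to s).
Proof. by move=> x; rewrite -lactM mulgV lact1. Qed.

Definition orbitb G (y y' : T) : bool := [exists g in G, to g y == y'].

Lemma orbitbP G y y' : reflect (exists2 g, g \in G & to g y = y') (orbitb G y y').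
Proof. by apply: (iffP existsP) => [[g /andP[Gg /eqP]]|[g Gg <-]]; exists g => //; rewrite Gg /=. Qed.

Lemma orbitb_refl G y : orbitb G y y.
Proof. by apply/orbitbP; exists 1%g; rewrite ?lact1. Qed.

Lemma orbitb_sym G y y' : orbitb G y y' = orbitb G y' y.
Proof.
by apply/orbitbP/orbitbP => -[g Gg <-]; exists g^-1%g; rewrite ?groupV ?lactK.
Qed.

Lemma orbitb_trans G y y' y'' : orbitb G y y' -> orbitb G y' y'' -> orbitb G y y''.
Proof.
move=> /orbitbP[g Gg <-] /orbitbP[h Gh <-]; apply/orbitbP.
by exists (h * g)%g; rewrite ?groupM ?lactM.
Qed.

(** Convertible with [orbit_repr] when G is the stabilizer W_xz, so the sums over these
    representatives are those of the product. *)
Definition orbit_rep G (y : T) : T := choose (orbitb G y) y.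

Lemma orbit_rep_orbit G y : orbitb G y (orbit_rep G y).
Proof. exact: chooseP (orbitb_refl G y). Qed.

Lemma eq_orbit_rep G y y' : orbitb G y y' -> orbit_rep G y = orbit_rep G y'.
Proof.
move=> yy'; rewrite /orbit_rep (choose_id (orbitb_refl G y) yy'); apply: eq_choose => z.
apply/idP/idP; last exact: orbitb_trans.
by apply: orbitb_trans; rewrite orbitb_sym.
Qed.

Definition stabilizer_family G (K : T -> {group W}) : Prop :=
  forall y g, (g \in K y) = (g \in G) && (to g y == y).

(** The ambient type may be infinite, as P may be, so finite G-sets are represented by lists in
    it. *)
Definition stable G (s : seq T) : Prop := forall g y, g \in G -> y \in s -> to g y \in s.

Lemma orbit_rep_in G s y : stable G s -> y \in s -> orbit_rep G y \in s.
Proof. by move=> st ys; have /orbitbP[g Gg <-] := orbit_rep_orbit G y; apply: st. Qed.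

Lemma orbit_rep_id G y : orbit_rep G (orbit_rep G y) = orbit_rep G y.
Proof. by apply/esym/eq_orbit_rep/orbit_rep_orbit. Qed.

Lemma sum_orbit_rep G s (M : nmodType) y (c : M) : uniq s -> stable G s -> y \in s ->
  \sum_(z <- s | (orbit_rep G z == z) && orbitb G z y) c = c.
Proof.
move=> us st ys; rewrite big_mkcond (bigD1_seq (orbit_rep G y)) ?orbit_rep_in //=.
rewrite orbit_rep_id eqxx orbitb_sym orbit_rep_orbit /= big1 ?addr0 // => z nz.
case: ifP => // /andP[/eqP zE zy]; case/eqP: nz.
by rewrite -zE; apply: eq_orbit_rep.
Qed.

(** A direct sum decomposition of R indexed by s, whose pieces G permutes as it permutes s; [e y] is
    the projection onto the piece at y. *)
Definition graded G (R : representation k G) (s : seq T) (e : T -> 'M_(rdegree R)) : Prop :=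
  [/\ \sum_(y <- s) e y = 1%:M,
      {in s &, forall y y', e y *m e y' = if y == y' then e y else 0}
    & forall g y, g \in G -> y \in s -> R g *m e y = e (to g y) *m R g].

Arguments graded {G} R s e.

Lemma stabilizer_family_conj G (K : T -> {group W}) y y0 g : stabilizer_family G K ->
  g \in G -> to g y = y0 -> forall h, h \in K y -> (g * h * g^-1)%g \in K y0.
Proof.
move=> HK Gg <- h; rewrite !HK => /andP[Gh /eqP hy].
by rewrite !groupM ?groupV //= !lactM lactK hy.
Qed.

Lemma class_summand_conj G (K : T -> {group W}) (R : representation k G) (s : seq T)
    (e : T -> 'M_(rdegree R)) y y0 g
    (c : forall h, h \in K y -> (g * h * g^-1)%g \in K y0) a :
    graded R s e -> stabilizer_family G K -> y0 \in s -> y \in s -> g \in G -> to g y = y0 ->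
    @class_summand G (K y0) R (e y0) a ->
  @class_summand G (K y) R (e y) (repclass_conj c a).
Proof.
move=> [_ _ eqv] HK y0s ys Gg gy [V -> [i [p [ip pi h]]]].
exists (conj_rep c V); first exact: repclass_conj_pi.
have gVg : R g^-1%g *m R g = 1%:M by rewrite -repr_mxM ?groupV // mulVg repr_mx1.
have ggV : R g *m R g^-1%g = 1%:M by rewrite -repr_mxM ?groupV // mulgV repr_mx1.
exists (i *m R g), (R g^-1%g *m p); split.
- by rewrite -mulmxA (mulmxA (R g)) ggV mul1mx.
- by rewrite -mulmxA (mulmxA p) pi -gy -eqv // mulmxA gVg mul1mx.
move=> x Kx; have Gx : x \in G by move: Kx; rewrite HK => /andP[].
have [hi hp] := h _ (c _ Kx); split=> /=.
  by rewrite mulmxA hi -!mulmxA -!repr_mxM ?groupM ?groupV // mulgKV.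
rewrite -mulmxA -hp !mulmxA -!repr_mxM ?groupM ?groupV //.
by rewrite !mulgA mulVg mul1g.
Qed.

(** The pieces over one orbit add up to a subrepresentation, which [summand_ind] identifies as
    induced from the piece at the representative. The idempotents of distinct orbits are orthogonal
    and sum to 1. *)
Lemma graded_recognition G (K : T -> {group W}) (sK : forall y, K y \subset G) (R : representation k G)
    (s : seq T) (e : T -> 'M_(rdegree R)) (F : forall y, repclass k (K y)) :
    uniq s -> stable G s -> stabilizer_family G K -> graded R s e ->
    {in s, forall y, class_summand (e y) (F y)} ->
  \sum_(y <- s | orbit_rep G y == y) repclass_ind (sK y) (F y) = \pi_(repclass k G) R.
Proof.
move=> us st HK [sum1 orth eqv] Fe.
pose E y := \sum_(z <- s | orbitb G y z) e z.
pose r := [seq y <- s | orbit_rep G y == y].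
have rs y : y \in r -> y \in s by rewrite mem_filter => /andP[].
have : class_summand (\sum_(y <- r) E y) (\sum_(y <- r) repclass_ind (sK y) (F y)).
  apply: class_summand_sum => [|y y' yr yr' ne|y yr]; first exact: filter_uniq.
    rewrite mulmx_suml big_seq_cond big1 // => z /andP[zs yz].
    rewrite mulmx_sumr big_seq_cond big1 // => z' /andP[zs' yz'].
    rewrite orth //; case: eqP => // zz'; case/eqP: ne.
    move: yr yr'; rewrite !mem_filter => /andP[/eqP <- _] /andP[/eqP <- _].
    by apply/eq_orbit_rep/(orbitb_trans yz); rewrite zz' orbitb_sym.
  have ys := rs y yr; have [V FV [i [p [ip pi h]]]] := Fe y ys.
  exists (ind_rep (sK y) V); first by rewrite FV repclass_ind_pi.
  set t := @ind_transversal W (K y) G.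
  have tG j : t j \in G by exact: mem_ind_transversal (sK y) j.
  (* The points t_j y run through the orbit of y exactly once, and R(t_j) e_y R(t_j)^-1 is the
     projection at t_j y. *)
  have -> : E y = \sum_j R (t j) *m p *m (i *m R (t j)^-1%g).
    transitivity (\sum_j e (to (t j) y)).
      rewrite -(big_map (fun j => to (t j) y) xpredT e) /E -[LHS]big_filter.
      apply: perm_big; apply: uniq_perm; first exact: filter_uniq.
        rewrite map_inj_in_uniq ?index_enum_uniq // => j j' _ _ jj'.
        apply: (@ind_transversal_inj _ (K y) G j j' (t j')); rewrite ?mulVg ?group1 //.
        by rewrite HK groupM ?groupV //= lactM -/t -jj' lactK.
      move=> z; rewrite mem_filter; apply/andP/mapP => [[/orbitbP[g Gg gz] zs]|[j _ ->]].
        have [j hj] := ind_transversal_ex (K y) Gg; exists j; first by rewrite mem_index_enum.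
        by move: hj; rewrite HK lactM gz => /andP[_ /eqP <-]; rewrite lactVK.
      by split; [apply/orbitbP; exists (t j) | exact: st].
    apply: eq_bigr => j _; rewrite -mulmxA (mulmxA p) pi mulmxA eqv // -mulmxA.
    by rewrite -repr_mxM ?groupV // mulgV repr_mx1 mulmx1.
  (* An x outside the stabilizer moves y, so e_y R(x) e_y = e_y e_(xy) R(x) vanishes by
     orthogonality. *)
  apply: summand_ind => // x Gx; rewrite HK Gx /= => nx.
  have ie : i = i *m e y by rewrite -pi mulmxA ip mul1mx.
  have ep : p = e y *m p by rewrite -pi -mulmxA ip mulmx1.
  have -> : i *m R x *m p = i *m (e y *m (R x *m e y)) *m p.
    by rewrite [in LHS]ie [in LHS]ep !mulmxA.
  rewrite eqv // (mulmxA (e y)) orth ?st // eq_sym (negPf nx).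
  by rewrite mul0mx mulmx0 mul0mx.
rewrite !big_filter.
suff -> : \sum_(y <- s | orbit_rep G y == y) E y = 1%:M.
  by move=> [V -> /summand1_rsim sV]; apply/repclass_eqP.
rewrite /E (exchange_big_dep xpredT) //= -sum1 big_seq [RHS]big_seq.
by apply: eq_bigr => y ys; rewrite sum_orbit_rep.
Qed.

(** For an equivariant family F, seen as a virtual vector bundle on the G-set s, this is the class
    of its space of sections. *)
Definition gam G (K : T -> {group W}) (sK : forall y, K y \subset G) (s : seq T)
    (F : forall y, VRep k (K y)) : VRep k G :=
  \sum_(y <- s | orbit_rep G y == y) VInd (sK y) (F y).

Definition stalk_family G (K : T -> {group W}) (R : representation k G) (s : seq T) (e : T -> 'M_(rdegree R))
    (F : forall y, VRep k (K y)) : Prop :=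
  {in s, forall y, exists2 c, F y = vclass c & @class_summand G (K y) R (e y) c}.

Arguments stalk_family {G K} R s e F.

Lemma gam_stalk G (K : T -> {group W}) (sK : forall y, K y \subset G)
    (R : representation k G) (s : seq T) (e : T -> 'M_(rdegree R))
    (F : forall y, VRep k (K y)) :
    uniq s -> stable G s -> stabilizer_family G K -> graded R s e -> stalk_family R s e F ->
  gam sK s F = vclass (\pi_(repclass k G) R).
Proof.
move=> us st HK gr Fe.
have [c cP] : exists c : forall y, repclass k (K y),
    {in s, forall y, F y = vclass (c y) /\ class_summand (e y) (c y)}.
  suff /all_sig[c cP] y : {c : repclass k (K y) |
      y \in s -> F y = vclass c /\ @class_summand G (K y) R (e y) c}.
    by exists c => y; apply: cP.
  apply: cid; case: (boolP (y \in s)) => [/Fe[c Fc sc]|_]; first by exists c.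
  by exists 0.
rewrite -(graded_recognition sK us st HK gr (fun y ys => (cP y ys).2)) raddf_sum.
rewrite /gam big_seq_cond [RHS]big_seq_cond.
by apply: eq_bigr => y /andP[ys _]; rewrite (cP y ys).1 VInd_vclass.
Qed.

Section OrbitFamily.
Variables (G : {group W}) (K : T -> {group W}) (HK : stabilizer_family G K).
Variable y0 : T.

(** The family spread over the orbit of [y0] from the value v. An element carrying y to [y0] is
    picked arbitrarily; the proofs only use that some such element was picked, so independence of
    the choice never has to be shown. *)
Definition orbit_family (v : VRep k (K y0)) (y : T) : VRep k (K y) :=
  if pselect (exists2 g, g \in G & to g y = y0) is left ex then
    let: exist2 g Gg gy := cid2 ex in VConj (stabilizer_family_conj HK Gg gy) v
  else 0.

Lemma orbit_familyB u v y : orbit_family (u - v) y = orbit_family u y - orbit_family v y.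
Proof.
rewrite /orbit_family; case: pselect => [ex|_]; last by rewrite subr0.
by case: (cid2 ex) => g Gg gy; rewrite raddfB.
Qed.

Lemma orbit_family_conj v y : orbitb G y y0 ->
  exists g (Gg : g \in G) (gy : to g y = y0),
    orbit_family v y = VConj (stabilizer_family_conj HK Gg gy) v.
Proof.
move=> /orbitbP yy0; rewrite /orbit_family; case: pselect => // ex.
by case: (cid2 ex) => g Gg gy; exists g, Gg, gy.
Qed.

Lemma orbit_family0 v y : ~~ orbitb G y y0 -> orbit_family v y = 0.
Proof. by rewrite /orbit_family; case: pselect => // ex /orbitbP. Qed.

Variables (sK : forall y, K y \subset G) (s : seq T).
Hypotheses (us : uniq s) (st : stable G s) (y0s : y0 \in s).
Variable V : representation k (K y0).
Local Notation t := (@ind_transversal W (K y0) G).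

(** The block t_i V of the induced representation is placed in degree t_i y0. *)
Definition orbit_grading (y : T) : 'M_(rdegree (ind_rep (sK y0) V)) :=
  blk_mx (fun i j => ((i == j) && (to (t i) y0 == y))%:R%:M : 'M[k]_(rdegree V)).

Lemma orbit_graded : graded (ind_rep (sK y0) V) s orbit_grading.
Proof.
have tG j : t j \in G by exact: mem_ind_transversal (sK y0) j.
split=> [|y y' ys ys'|g y Gg ys].
- transitivity (blk_mx (fun i l => (i == l)%:R%:M) : 'M[k]_(#|lcosets (K y0) G| * rdegree V));
    last exact: blk_mx1.
  apply/matrixP=> u v; rewrite -[u]mxtens_unindexK -[v]mxtens_unindexK.
  case: (mxtens_unindex u) (mxtens_unindex v) => i a [l b].
  rewrite summxE (eq_bigr _ (fun y _ => blk_mxE _ _ _ _ _)) blk_mxE.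
  rewrite (bigD1_seq (to (t i) y0)) ?st //= eqxx andbT big1 ?addr0 // => y.
  by rewrite eq_sym => /negPf ->; rewrite andbF !mxE mul0rn.
- rewrite mul_blk_mx; transitivity (blk_mx (fun i j =>
    ((i == j) && (to (t i) y0 == y) && (y == y'))%:R%:M) : 'M[k]_(#|lcosets (K y0) G| * rdegree V)).
    apply: eq_blk_mx => i l; rewrite (bigD1 i) //= big1 ?addr0 => [|j ne]; last first.
      by rewrite eq_sym (negPf ne) /= -scalemx1 scale0r mul0mx.
    rewrite eqxx /= -scalar_mxM -natrM mulnb; congr (_%:R%:M).
    by case: (to (t i) y0 =P y) => [->|_]; case: (i == l); rewrite ?andbF //= ?andbT.
  case: eqP => _; first by apply: eq_blk_mx => i j; rewrite andbT.
  apply/matrixP=> u v; rewrite -[u]mxtens_unindexK -[v]mxtens_unindexK.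
  case: (mxtens_unindex u) (mxtens_unindex v) => i a [l b].
  by rewrite blk_mxE andbF !mxE mul0rn.
- rewrite !mul_blk_mx; apply: eq_blk_mx => i l.
  rewrite (bigD1 l) //= big1 ?addr0 => [|j ne]; last first.
    by rewrite (negPf ne) /= -scalemx1 scale0r mulmx0.
  rewrite [RHS](bigD1 i) //= [X in _ = _ + X]big1 ?addr0 => [|j ne]; last first.
    by rewrite eq_sym (negPf ne) /= -scalemx1 scale0r mul0mx.
  rewrite !eqxx /= /ext_mx; case: ifP => [h|_]; last by rewrite mul0mx mulmx0.
  rewrite mul_mx_scalar mul_scalar_mx; congr (_%:R *: _).
  (* A nonzero block (i, l) of g has t_i^-1 g t_l in the stabilizer of [y0], so g carries the degree
     of block l to that of block i. *)
  move: h; rewrite HK !lactM => /andP[_ /eqP h].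
  have -> : to (t i) y0 = to g (to (t l) y0) by rewrite -(lactVK (t i) (to g _)) h.
  by rewrite (can_eq (lactK g)).
Qed.

Lemma orbit_stalk_family :
  stalk_family (ind_rep (sK y0) V) s orbit_grading (orbit_family (vclass (\pi_(repclass k (K y0)) V))).
Proof.
have tG j : t j \in G by exact: mem_ind_transversal (sK y0) j.
have S0 : @class_summand G (K y0) (ind_rep (sK y0) V) (orbit_grading y0) (\pi_(repclass k (K y0)) V).
  exists V => //; exists (ind_in (sK y0) V), (ind_out (sK y0) V); split.
  - by rewrite -[ind_in _ _]mulmx1 -(repr_mx1 (ind_rep (sK y0) V)) ind_in_out // ext_mxE ?repr_mx1.
  - rewrite mul_col_row_blk; apply: eq_blk_mx => i j; rewrite /ext_mx groupV.
    have -> : (to (t i) y0 == y0) = (t i \in K y0) by rewrite HK tG.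
    case: ifP => hi; last by rewrite andbF mul0mx -scalemx1 scale0r.
    case: ifP => hj; last first.
      rewrite mulmx0; case: eqP => [e|]; first by rewrite -e hi in hj.
      by rewrite -scalemx1 scale0r.
    have -> : i = j by apply: (@ind_transversal_inj _ (K y0) G i j 1%g); rewrite mulg1 groupV.
    by rewrite eqxx -repr_mxM ?groupV // mulVg repr_mx1.
  - by move=> h Kh; rewrite ind_in_eqv // ind_out_eqv.
move=> y ys; case: (boolP (orbitb G y y0)) => [yy0|nyy0].
  have [g [Gg [gy ->]]] := orbit_family_conj (vclass (\pi_(repclass k (K y0)) V)) yy0.
  eexists; first exact: VConj_vclass.
  exact: class_summand_conj orbit_graded HK y0s ys Gg gy S0.
rewrite orbit_family0 //; exists 0; first by rewrite raddf0.
exists (@grepr0 k W (K y)) => //.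
suff -> : orbit_grading y = 0 by exact: summand0.
apply/matrixP=> u v; rewrite -[u]mxtens_unindexK -[v]mxtens_unindexK.
case: (mxtens_unindex u) (mxtens_unindex v) => i a [l b].
rewrite blk_mxE; case: (altP (to (t i) y0 =P y)) => [e|_]; last by rewrite andbF !mxE mul0rn.
by case/negP: nyy0; rewrite orbitb_sym; apply/orbitbP; exists (t i).
Qed.

End OrbitFamily.

Definition equivariant G (K : T -> {group W}) (s : seq T) (F : forall y, VRep k (K y)) : Prop :=
  forall g y (c : forall h, h \in K y -> (g * h * g^-1)%g \in K (to g y)),
    g \in G -> y \in s -> F y = VConj c (F (to g y)).

(* An equivariant family is a sum of families supported on one orbit, and these
   are differences of stalk families of induced representations. *)
Lemma equivariant_eq0 G (K : T -> {group W}) (sK : forall y, K y \subset G) (s : seq T) (M : zmodType)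
    (Phi : (forall y, VRep k (K y)) -> M) :
    uniq s -> stable G s -> stabilizer_family G K ->
    (forall F F', {in s, forall y, F y = F' y} -> Phi F = Phi F') ->
    (forall F F', Phi (fun y => F y - F' y) = Phi F - Phi F') ->
    (forall (R : representation k G) (e : T -> 'M_(rdegree R)) F,
      graded R s e -> stalk_family R s e F -> Phi F = 0) ->
  forall F, equivariant G s F -> Phi F = 0.
Proof.
move=> us st HK ext sub Phi0 F eqvF.
have Phi00 : Phi (fun _ => 0) = 0.
  rewrite -(subrr (Phi (fun _ => 0))) -sub; apply: ext => y _.
  by rewrite subr0.
have PhiD F1 F2 : Phi (fun y => F1 y + F2 y) = Phi F1 + Phi F2.
  have -> : Phi (fun y => F1 y + F2 y) = Phi (fun y => F1 y - (0 - F2 y)).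
    by apply: ext => y _; rewrite sub0r opprK.
  by rewrite sub sub Phi00 sub0r opprK.
have Phi_orbit y0 (v : VRep k (K y0)) : y0 \in s -> Phi (orbit_family HK v) = 0.
  move=> y0s; have [a [b ->]] := VRepP v.
  rewrite (ext _ _ (fun y _ => orbit_familyB HK _ _ y)) sub.
  suff Pc c : Phi (orbit_family HK (vclass c : VRep k (K y0))) = 0 by rewrite !Pc subrr.
  have [V ->] := repclassP c.
  exact: Phi0 (orbit_graded HK sK us st y0s V) (orbit_stalk_family HK sK us st y0s V).
have Phi_sum r : {subset r <= s} ->
    Phi (fun y => \sum_(y0 <- r) orbit_family HK (F y0) y) = 0.
  elim: r => [|y0 r IH] rs; first by rewrite -Phi00; apply: ext => y _; rewrite big_nil.
  rewrite (ext _ (fun y => orbit_family HK (F y0) y + \sum_(y1 <- r) orbit_family HK (F y1) y)).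
    rewrite PhiD IH ?addr0; last by move=> y yr; apply: rs; rewrite inE yr orbT.
    by apply: Phi_orbit; apply: rs; exact: mem_head.
  by move=> y _; rewrite big_cons.
rewrite -(Phi_sum [seq y <- s | orbit_rep G y == y]); last first.
  by move=> y; rewrite mem_filter => /andP[].
(* At y only the family attached to the representative of its own orbit contributes, and
   equivariance of F identifies its value with [F y]. *)
apply: ext => y ys; rewrite big_filter.
rewrite -[LHS](sum_orbit_rep (F y) us st ys) [LHS]big_mkcondr /=.
rewrite big_seq_cond [RHS]big_seq_cond; apply: eq_bigr => y0 /andP[y0s _].
rewrite orbitb_sym; case: ifP => [yy0|/negbT nyy0]; last by rewrite orbit_family0.
have [g [Gg [gy ->]]] := orbit_family_conj HK (F y0) yy0.
by case: y0 / gy {yy0 y0s} => *; apply: eqvF.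
Qed.

Lemma gamB G (K : T -> {group W}) (sK : forall y, K y \subset G) s (F F' : forall y, VRep k (K y)) :
  gam sK s (fun y => F y - F' y) = gam sK s F - gam sK s F'.
Proof. by rewrite /gam -sumrB; apply: eq_bigr => y _; rewrite raddfB. Qed.

Lemma eq_gam G (K : T -> {group W}) (sK : forall y, K y \subset G) s (F F' : forall y, VRep k (K y)) :
  {in s, forall y, F y = F' y} -> gam sK s F = gam sK s F'.
Proof.
move=> h; rewrite /gam big_seq_cond [RHS]big_seq_cond.
by apply: eq_bigr => y /andP[ys _]; rewrite h.
Qed.

(* Mackey's formula. *)
Lemma VRes_gam G G' (K K' : T -> {group W}) (sK : forall y, K y \subset G) (sK' : forall y, K' y \subset G')
    (sG : G' \subset G) (sKK : forall y, K' y \subset K y) s (F : forall y, VRep k (K y)) :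
    uniq s -> stable G s -> stabilizer_family G K -> stabilizer_family G' K' ->
    equivariant G s F ->
  VRes sG (gam sK s F) = gam sK' s (fun y => VRes (sKK y) (F y)).
Proof.
move=> us st HK HK' eqvF; apply/eqP; rewrite -subr_eq0; apply/eqP.
move: F eqvF; apply: (equivariant_eq0 sK us st HK) => [F F' FF'|F F'|R e F gr Fe].
- by congr (VRes _ _ - _); apply: eq_gam => y ys; rewrite FF'.
- rewrite gamB raddfB /= (@eq_gam _ _ sK' s _ (fun y => VRes (sKK y) (F y) - VRes (sKK y) (F' y))).
    by rewrite gamB !opprD addrACA.
  by move=> y _; rewrite raddfB.
- have [sum1 orth eqv] := gr.
  have sGG g : g \in G' -> g \in G by exact: (fintype.subsetP sG).
  rewrite (gam_stalk sK us st HK gr Fe).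
  (* The same projections grade the restriction of R: the stalks are restricted and only the orbits
     get smaller, so no double cosets have to be enumerated. *)
  rewrite (@gam_stalk G' K' sK' (res_rep sG R) s e) // => [|g y /sGG Gg ys||y ys].
  + by rewrite VRes_vclass repclass_res_pi subrr.
  + exact: st.
  + by split=> // g y /sGG Gg ys; exact: eqv.
  + have [c Fc [V cV [i [p [ip pi h]]]]] := Fe y ys.
    exists (repclass_res (sKK y) c); first by rewrite Fc VRes_vclass.
    exists (res_rep (sKK y) V); first by rewrite cV repclass_res_pi.
    by exists i, p; split=> // x /(fintype.subsetP (sKK y)); exact: h.
Qed.

(** Transport of structure: the pullback of a representation graded by s' is graded by s through the
    translation y |-> t y. *)
Lemma gam_conj G G' (K K' : T -> {group W}) (sK : forall y, K y \subset G) (sK' : forall y, K' y \subset G')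
    t (cG : forall h, h \in G -> (t * h * t^-1)%g \in G')
    (cK : forall y h, h \in K y -> (t * h * t^-1)%g \in K' (to t y)) s s' (F' : forall y, VRep k (K' y)) :
    uniq s -> uniq s' -> stable G s -> stable G' s' ->
    (forall y, (to t y \in s') = (y \in s)) ->
    stabilizer_family G K -> stabilizer_family G' K' -> equivariant G' s' F' ->
  gam sK s (fun y => VConj (cK y) (F' (to t y))) = VConj cG (gam sK' s' F').
Proof.
move=> us us' st st' ss' HK HK' eqvF; apply/eqP; rewrite -subr_eq0; apply/eqP.
move: F' eqvF; apply: (equivariant_eq0 sK' us' st' HK') => [F F' FF'|F F'|R e F gr Fe].
- by rewrite (eq_gam sK' FF'); congr (_ - _); apply: eq_gam => y ys; rewrite FF' // ss'.
- rewrite gamB raddfB /= (@eq_gam _ _ sK s _ (fun y =>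
    VConj (cK y) (F (to t y)) - VConj (cK y) (F' (to t y)))).
    by rewrite gamB !opprD addrACA.
  by move=> y _; rewrite raddfB.
- have [sum1 orth eqv] := gr.
  rewrite (gam_stalk sK' us' st' HK' gr Fe).
  rewrite (@gam_stalk G K sK (conj_rep cG R) s (fun y => e (to t y))) // => [||y ys].
  + by rewrite VConj_vclass repclass_conj_pi subrr.
  + split=> [|y y' ys ys'|g y Gg ys] /=.
    * rewrite -(big_map (to t) xpredT e) -sum1; apply: perm_big.
      apply: uniq_perm => //; first by rewrite map_inj_uniq //; exact: can_inj (lactK t).
      move=> y; rewrite -[y](lactVK t) ss' mem_map //; exact: can_inj (lactK t).
    * by rewrite orth ?ss' // (can_eq (lactK t)).
    * by rewrite eqv ?cG ?ss' // !lactM lactK.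
  + have [|c Fc [V cV [i [p [ip pi h]]]]] := Fe (to t y); first by rewrite ss'.
    exists (repclass_conj (cK y) c); first by rewrite Fc VConj_vclass.
    exists (conj_rep (cK y) V); first by rewrite cV repclass_conj_pi.
    by exists i, p; split=> // x /(cK y); exact: h.
Qed.

End Action.

End GradedRep.

Arguments graded {k W T} to {G} R s e.
Arguments stalk_family {k W T G K} R s e F.

(** * Gradings by pairs and the exchange of orbit sums *)

Section GradedFibration.
Variables (k : fieldType) (W : finGroupType).
Implicit Types G H : {group W}.
Variables (T1 T2 : choiceType) (to1 : left_action W T1) (to2 : left_action W T2).

(** Summing the projections over the fibre [s2 y] grades R by [s1] alone; the stalk at y is a
    representation of [K1 y], in turn graded by the fibre. Two uses of [gam_stalk] evaluate the
    iterated sum, and the result retains no trace of which coordinate came first. *)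
Lemma gam_gam_stalk G (K1 : T1 -> {group W}) (K2 : T1 -> T2 -> {group W})
    (sK1 : forall y, K1 y \subset G) (sK2 : forall y x, K2 y x \subset K1 y)
    (s1 : seq T1) (s2 : T1 -> seq T2) (R : representation k G)
    (e : T1 -> T2 -> 'M_(rdegree R)) (F : forall y x, VRep k (K2 y x)) :
    uniq s1 -> stable to1 G s1 -> stabilizer_family to1 G K1 ->
    (forall y, uniq (s2 y)) ->
    (forall g y x, g \in G -> (to2 g x \in s2 (to1 g y)) = (x \in s2 y)) ->
    (forall y, stabilizer_family to2 (K1 y) (K2 y)) ->
    \sum_(y <- s1) \sum_(x <- s2 y) e y x = 1%:M ->
    (forall y y' x x', y \in s1 -> y' \in s1 -> x \in s2 y -> x' \in s2 y' ->
      e y x *m e y' x' = if (y == y') && (x == x') then e y x else 0) ->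
    (forall g y x, g \in G -> y \in s1 -> x \in s2 y -> R g *m e y x = e (to1 g y) (to2 g x) *m R g) ->
    (forall y x, y \in s1 -> x \in s2 y ->
      exists2 c, F y x = vclass c & @class_summand k W G (K2 y x) R (e y x) c) ->
  gam to1 sK1 s1 (fun y => gam to2 (sK2 y) (s2 y) (F y)) = vclass (\pi_(repclass k G) R).
Proof.
move=> us1 st1 HK1 us2 st2 HK2 sum1 orth eqv Fe.
pose E y := \sum_(x <- s2 y) e y x.
have eE y x : y \in s1 -> x \in s2 y -> e y x *m E y = e y x.
  move=> ys xs; rewrite mulmx_sumr (bigD1_seq x) //= orth // !eqxx big_seq_cond big1 ?addr0 //.
  by move=> x' /andP[xs' /negPf ne]; rewrite orth // eqxx eq_sym ne.
have Ee y x : y \in s1 -> x \in s2 y -> E y *m e y x = e y x.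
  move=> ys xs; rewrite mulmx_suml (bigD1_seq x) //= orth // !eqxx big_seq_cond big1 ?addr0 //.
  by move=> x' /andP[xs' /negPf ne]; rewrite orth // eqxx ne.
have EE y : y \in s1 -> E y *m E y = E y.
  by move=> ys; rewrite {1}/E mulmx_suml [RHS]/E big_seq [RHS]big_seq; apply: eq_bigr => x xs; rewrite eE.
have eqvE g y : g \in G -> y \in s1 -> R g *m E y = E (to1 g y) *m R g.
  move=> Gg ys; rewrite /E mulmx_sumr mulmx_suml.
  rewrite [RHS](perm_big (map (to2 g) (s2 y))) /=.
    by rewrite big_map big_seq [RHS]big_seq; apply: eq_bigr => x xs; rewrite eqv.
  apply: uniq_perm => //; first by rewrite map_inj_uniq //; exact: can_inj (lactK to2 g).
  by move=> x; rewrite -[x](lactVK to2 g) st2 // mem_map //; exact: can_inj (lactK to2 g).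
have grE : graded to1 R s1 E.
  split=> // y y' ys ys'; case: (altP (y =P y')) => [<-|ne]; first exact: EE.
  rewrite mulmx_suml big_seq big1 // => x xs; rewrite mulmx_sumr big_seq big1 // => x' xs'.
  by rewrite orth // (negPf ne).
apply: (gam_stalk _ us1 st1 HK1 grE) => y ys.
have K1s h : h \in K1 y -> h \in G by rewrite HK1 => /andP[].
have K1y h : h \in K1 y -> to1 h y = y by rewrite HK1 => /andP[_ /eqP].
have [|h Kh|V [i [p [ip pi hip]]]] := @summand_ex _ _ G (K1 y) R (E y) (sK1 y).
- exact: EE.
- by rewrite eqvE ?K1s // K1y.
exists (\pi_(repclass k (K1 y)) V); last by exists V => //; exists i, p.
(* The projection [e y x] is dominated by [E y], so compressing it to the image V of [E y] loses
   nothing. *)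
pose e' x : 'M_(rdegree V) := i *m e y x *m p.
apply: (@gam_stalk k W T2 to2 (K1 y) (K2 y) (sK2 y) V (s2 y) e') => // [g x Kg xs||x xs].
- by rewrite -[X in _ \in s2 X](K1y g Kg) st2 // K1s.
- split=> [|x x' xs xs'|g x Kg xs].
  + rewrite /e' -mulmx_suml -mulmx_sumr -/(E y) -pi mulmxA ip mul1mx; exact: ip.
  + rewrite /e' -!mulmxA (mulmxA p) pi (mulmxA (E y)) Ee // (mulmxA (e y x)) orth // eqxx /=.
    by case: eqP => _ //; rewrite mul0mx mulmx0.
  + rewrite /e' !mulmxA (hip _ Kg).1 -(mulmxA i) eqv ?K1s // K1y // -!mulmxA.
    by rewrite (hip _ Kg).2.
- have [c Fc [V' cV [i' [p' [ip' pi' hip']]]]] := Fe y x ys xs.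
  exists c => //; exists V' => //; exists (i' *m p), (i *m p').
  have ie : i' *m e y x = i' by rewrite -pi' mulmxA ip' mul1mx.
  split.
  + rewrite mulmxA -(mulmxA i') pi -ie -(mulmxA i') eE // ie; exact: ip'.
  + by rewrite mulmxA -(mulmxA i) pi'.
  + move=> h Kh; have K1h : h \in K1 y by exact: (fintype.subsetP (sK2 y x)).
    rewrite mulmxA (hip' _ Kh).1 -!mulmxA (hip _ K1h).2; split=> //.
    by rewrite mulmxA (hip _ K1h).1 -!mulmxA (hip' _ Kh).2.
Qed.

End GradedFibration.

Section Fubini.
Variables (k : fieldType) (W : finGroupType) (T1 T2 : choiceType).
Implicit Types G H : {group W}.
Variables (to1 : left_action W T1) (to2 : left_action W T2).

Definition diag_action : left_action W (T1 * T2)%type.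
Proof.
exists (fun g z => (to1 g z.1, to2 g z.2)).
- by case=> x y; rewrite !lact1.
- by move=> s t [x y]; rewrite !lactM.
Defined.

(** Both sides are additive in F, so F may be taken to be the stalks of a representation R graded by
    the pairs in s. Each side is then the class of R by [gam_gam_stalk], [s2 y] and [t1 x] being the
    fibres of s over its two projections. *)
Lemma gam_fubini G (K1 : T1 -> {group W}) (K2 : T2 -> {group W})
    (K : T1 * T2 -> {group W})
    (sK1 : forall y, K1 y \subset G) (sK2 : forall x, K2 x \subset G)
    (sK12 : forall y x, K (y, x) \subset K1 y) (sK21 : forall x y, K (y, x) \subset K2 x)
    (s : seq (T1 * T2)) (s1 : seq T1) (s2 : T1 -> seq T2)
    (t2 : seq T2) (t1 : T2 -> seq T1) (F : forall z, VRep k (K z)) :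
    uniq s -> stable diag_action G s -> stabilizer_family diag_action G K ->
    uniq s1 -> stable to1 G s1 -> stabilizer_family to1 G K1 ->
    uniq t2 -> stable to2 G t2 -> stabilizer_family to2 G K2 ->
    (forall y, uniq (s2 y)) -> (forall x, uniq (t1 x)) ->
    (forall y, stabilizer_family to2 (K1 y) (fun x => K (y, x))) ->
    (forall x, stabilizer_family to1 (K2 x) (fun y => K (y, x))) ->
    (forall g y x, g \in G -> (to2 g x \in s2 (to1 g y)) = (x \in s2 y)) ->
    (forall g x y, g \in G -> (to1 g y \in t1 (to2 g x)) = (y \in t1 x)) ->
    (forall y x, ((y, x) \in s) = (y \in s1) && (x \in s2 y)) ->
    (forall y x, ((y, x) \in s) = (x \in t2) && (y \in t1 x)) ->
    equivariant diag_action G s F ->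
  gam to1 sK1 s1 (fun y => gam to2 (sK12 y) (s2 y) (fun x => F (y, x))) =
  gam to2 sK2 t2 (fun x => gam to1 (sK21 x) (t1 x) (fun y => F (y, x))).
Proof.
move=> us st HK us1 st1 HK1 ut2 st2 HK2 us2 ut1 HK12 HK21 st12 st21 ss1 ss2 eqvF.
apply/eqP; rewrite -subr_eq0; apply/eqP.
have sK z : K z \subset G by case: z => y x; apply: fintype.subset_trans (sK12 y x) (sK1 y).
move: F eqvF; apply: (equivariant_eq0 sK us) => // [F F' FF'|F F'|R e F gr Fe].
- congr (_ - _); apply: eq_gam => y ys; apply: eq_gam => x xs; apply: FF'.
    by rewrite ss1 ys.
  by rewrite ss2 ys.
- rewrite (@eq_gam k W _ to1 _ _ sK1 s1 _ (fun y => gam to2 (sK12 y) (s2 y) (fun x => F (y, x)) -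
      gam to2 (sK12 y) (s2 y) (fun x => F' (y, x)))); last by move=> y _; rewrite gamB.
  rewrite (@eq_gam k W _ to2 _ _ sK2 t2 _ (fun x => gam to1 (sK21 x) (t1 x) (fun y => F (y, x)) -
      gam to1 (sK21 x) (t1 x) (fun y => F' (y, x)))); last by move=> x _; rewrite gamB.
  by rewrite !gamB !opprD addrACA.
- have [sum1 orth eqv] := gr.
  have orth' y y' x x' : (y, x) \in s -> (y', x') \in s ->
      e (y, x) *m e (y', x') = if (y == y') && (x == x') then e (y, x) else 0.
    by move=> h h'; rewrite orth.
  have sum12 : \sum_(y <- s1) \sum_(x <- s2 y) e (y, x) = 1%:M.
    transitivity (\sum_(z <- [seq (y, x) | y <- s1, x <- s2 y]) e z); first by rewrite big_allpairs_dep.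
    rewrite -sum1; apply: perm_big; apply: uniq_perm => //.
      by apply: allpairs_uniq_dep => // -[y x] [y' x'] _ _ [-> ->].
    move=> [y x]; rewrite ss1; apply/allpairsPdep/andP => [[y' [x' [? ? [-> ->]]]]//|[ys xs]].
    by exists y, x.
  have sum21 : \sum_(x <- t2) \sum_(y <- t1 x) e (y, x) = 1%:M.
    transitivity (\sum_(z <- [seq (y, x) | x <- t2, y <- t1 x]) e z); first by rewrite big_allpairs_dep.
    rewrite -sum1; apply: perm_big.
    apply: uniq_perm => //.
      by apply: allpairs_uniq_dep => // -[x y] [x' y'] _ _ [-> ->].
    move=> [y x]; rewrite ss2; apply/allpairsPdep/andP => [[x' [y' [? ? [-> ->]]]]//|[xs ys]].
    by exists x, y.
  rewrite (@gam_gam_stalk _ _ _ _ to1 to2 G K1 (fun y x => K (y, x)) sK1 sK12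
    s1 s2 R (fun y x => e (y, x))) //.
  + rewrite (@gam_gam_stalk _ _ _ _ to2 to1 G K2 (fun x y => K (y, x)) sK2 sK21
      t2 t1 R (fun x y => e (y, x))) ?subrr //.
    * by move=> x x' y y' xs xs' ys ys'; rewrite orth' ?ss2 ?xs ?xs' // andbC.
    * by move=> g x y Gg xs ys; rewrite eqv // ss2 xs.
    * by move=> x y xs ys; apply: (Fe (y, x)); rewrite ss2 xs.
  + by move=> y y' x x' ys ys' xs xs'; rewrite orth' ?ss1 ?ys ?ys'.
  + by move=> g y x Gg ys xs; rewrite eqv // ss1 ys.
  + by move=> y x ys xs; apply: (Fe (y, x)); rewrite ss1 ys.
Qed.

End Fubini.

(** * The incidence algebra *)

Section PolyGam.
Variables (k : fieldType) (W : finGroupType).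
Implicit Types G H : {group W}.

Lemma VRes_id G (sGG : G \subset G) (a : VRep k G) : VRes sGG a = a.
Proof.
have [u [v ->]] := VRepP a; rewrite !raddfB /= !VRes_vclass.
suff P (w : repclass k G) : repclass_res sGG w = w by rewrite !P.
have [V ->] := repclassP w; rewrite repclass_res_pi.
exact/repclass_eqP/eq_mx_rsim.
Qed.

(** Meant for the extreme terms y = x and y = z of a product, where the triple stabilizer has the
    elements of the double one but is a different term, so its [VRep] is a different type. *)
Lemma VInd_VRes_eq G H (sHG sHG' : H \subset G) (a : VRep k G) :
  G \subset H -> VInd sHG (VRes sHG' a) = a.
Proof.
rewrite (bool_irrelevance sHG' sHG) => {sHG'} sGH.
have e : H = G by apply/val_inj/eqP; rewrite finset.eqEsubset sHG.
by move: sHG {sGH}; case: G / e a => a sHG; rewrite VRes_id VInd_id.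
Qed.

Section Action.
Variables (T : choiceType) (to : left_action W T).

Definition pgam G (K : T -> {group W}) (sK : forall y, K y \subset G) (s : seq T)
    (F : forall y, {poly VRep k (K y)}) : {poly VRep k G} :=
  \sum_(y <- s | orbit_rep to G y == y) map_poly (VInd (sK y)) (F y).

Lemma coef_pgam G (K : T -> {group W}) (sK : forall y, K y \subset G) s
    (F : forall y, {poly VRep k (K y)}) n :
  (pgam sK s F)`_n = gam to sK s (fun y => (F y)`_n).
Proof. by rewrite coef_sum; apply: eq_bigr => y _; rewrite coef_map. Qed.

Definition pequivariant G (K : T -> {group W}) (s : seq T)
    (F : forall y, {poly VRep k (K y)}) : Prop :=
  forall g y (c : forall h, h \in K y -> (g * h * g^-1)%g \in K (to g y)),
    g \in G -> y \in s -> F y = map_poly (VConj c) (F (to g y)).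

Lemma coef_pequivariant G (K : T -> {group W}) s (F : forall y, {poly VRep k (K y)}) n :
  pequivariant G s F -> equivariant to G s (fun y => (F y)`_n).
Proof. by move=> eqv g y c Gg ys; rewrite (eqv g y c Gg ys) coef_map. Qed.

Lemma eq_pgam G (K : T -> {group W}) (sK : forall y, K y \subset G) s
    (F F' : forall y, {poly VRep k (K y)}) :
  {in s, forall y, F y = F' y} -> pgam sK s F = pgam sK s F'.
Proof.
move=> h; rewrite /pgam big_seq_cond [RHS]big_seq_cond.
by apply: eq_bigr => y /andP[ys _]; rewrite h.
Qed.

Lemma VRes_pgam G G' (K K' : T -> {group W}) (sK : forall y, K y \subset G)
    (sK' : forall y, K' y \subset G') (sG : G' \subset G)
    (sKK : forall y, K' y \subset K y) s (F : forall y, {poly VRep k (K y)}) :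
    uniq s -> stable to G s -> stabilizer_family to G K -> stabilizer_family to G' K' ->
    pequivariant G s F ->
  map_poly (VRes sG) (pgam sK s F) = pgam sK' s (fun y => map_poly (VRes (sKK y)) (F y)).
Proof.
move=> us st HK HK' eqv; apply/polyP => n; rewrite coef_map !coef_pgam /=.
rewrite (VRes_gam sK sK' sG sKK us st HK HK' (coef_pequivariant n eqv)).
by apply: eq_gam => y _; rewrite coef_map.
Qed.

Lemma pgam_conj G G' (K K' : T -> {group W}) (sK : forall y, K y \subset G)
    (sK' : forall y, K' y \subset G')
    t (cG : forall h, h \in G -> (t * h * t^-1)%g \in G')
    (cK : forall y h, h \in K y -> (t * h * t^-1)%g \in K' (to t y)) s s'
    (F' : forall y, {poly VRep k (K' y)}) :
    uniq s -> uniq s' -> stable to G s -> stable to G' s' ->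
    (forall y, (to t y \in s') = (y \in s)) ->
    stabilizer_family to G K -> stabilizer_family to G' K' -> pequivariant G' s' F' ->
  pgam sK s (fun y => map_poly (VConj (cK y)) (F' (to t y))) = map_poly (VConj cG) (pgam sK' s' F').
Proof.
move=> us us' st st' ss' HK HK' eqv; apply/polyP => n; rewrite coef_map !coef_pgam /=.
rewrite -(gam_conj sK sK' cG cK us us' st st' ss' HK HK' (coef_pequivariant n eqv)).
by apply: eq_gam => y _; rewrite coef_map.
Qed.

Lemma mul_pgam G (K : T -> {group W}) (sK : forall y, K y \subset G) s
    (F : forall y, {poly VRep k (K y)}) (a : {poly VRep k G}) :
  a * pgam sK s F = pgam sK s (fun y => map_poly (VRes (sK y)) a * F y).
Proof.
rewrite mulr_sumr; apply: eq_bigr => y _; apply/polyP => n.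
rewrite coef_map !coefM raddf_sum; apply: eq_bigr => i _.
by rewrite !coef_map VInd_projection.
Qed.

End Action.

Lemma pgam_fubini (T1 T2 : choiceType) (to1 : left_action W T1) (to2 : left_action W T2)
    G (K1 : T1 -> {group W}) (K2 : T2 -> {group W}) (K : T1 * T2 -> {group W})
    (sK1 : forall y, K1 y \subset G) (sK2 : forall x, K2 x \subset G)
    (sK12 : forall y x, K (y, x) \subset K1 y) (sK21 : forall x y, K (y, x) \subset K2 x)
    (s : seq (T1 * T2)) (s1 : seq T1) (s2 : T1 -> seq T2)
    (t2 : seq T2) (t1 : T2 -> seq T1) (F : forall z, {poly VRep k (K z)}) :
    uniq s -> stable (diag_action to1 to2) G s ->
    stabilizer_family (diag_action to1 to2) G K ->
    uniq s1 -> stable to1 G s1 -> stabilizer_family to1 G K1 ->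
    uniq t2 -> stable to2 G t2 -> stabilizer_family to2 G K2 ->
    (forall y, uniq (s2 y)) -> (forall x, uniq (t1 x)) ->
    (forall y, stabilizer_family to2 (K1 y) (fun x => K (y, x))) ->
    (forall x, stabilizer_family to1 (K2 x) (fun y => K (y, x))) ->
    (forall g y x, g \in G -> (to2 g x \in s2 (to1 g y)) = (x \in s2 y)) ->
    (forall g x y, g \in G -> (to1 g y \in t1 (to2 g x)) = (y \in t1 x)) ->
    (forall y x, ((y, x) \in s) = (y \in s1) && (x \in s2 y)) ->
    (forall y x, ((y, x) \in s) = (x \in t2) && (y \in t1 x)) ->
    pequivariant (diag_action to1 to2) G s F ->
  pgam to1 sK1 s1 (fun y => pgam to2 (sK12 y) (s2 y) (fun x => F (y, x))) =
  pgam to2 sK2 t2 (fun x => pgam to1 (sK21 x) (t1 x) (fun y => F (y, x))).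
Proof.
move=> us st HK us1 st1 HK1 ut2 st2 HK2 us2 ut1 HK12 HK21 st12 st21 ss1 ss2 eqvF.
apply/polyP => n; rewrite !coef_pgam.
rewrite (eq_gam to1 sK1 (fun y _ => coef_pgam to2 (sK12 y) (s2 y) (fun x => F (y, x)) n)).
rewrite [RHS](eq_gam to2 sK2 (fun x _ => coef_pgam to1 (sK21 x) (t1 x) (fun y => F (y, x)) n)).
exact: (gam_fubini sK1 sK2 sK12 sK21 us st HK us1 st1 HK1 ut2 st2 HK2 us2 ut1 HK12
  HK21 st12 st21 ss1 ss2 (coef_pequivariant n eqvF)).
Qed.

Lemma map_VRes_trans G H (K : {group W}) (sHG : H \subset G) (sKH : K \subset H) (sKG : K \subset G)
    (a : {poly VRep k G}) :
  map_poly (VRes sKH) (map_poly (VRes sHG) a) = map_poly (VRes sKG) a.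
Proof. by apply/polyP => n; rewrite !coef_map /= (VRes_trans sHG sKH sKG). Qed.

End PolyGam.

Section IncidenceProduct.
Variables (k : fieldType) (W : finGroupType) (d : Order.disp_t).
Variables (P : porderType d) (act : poset_action W P).
Hypothesis locfinP : locally_finite P.
Local Notation incidence := (incidence k act).
Implicit Types f g : incidence.

Definition poset_left_action : left_action W P := LeftAction (pact1 act) (pactM act).
Local Notation to := poset_left_action.

Lemma pact_leE s x y : (act s x <= act s y)%O = (x <= y)%O.
Proof.
apply/idP/idP; last exact: pact_le.
by move=> /(pact_le act s^-1%g); rewrite -!pactM mulVg !pact1.
Qed.

Lemma pact_eqE s x y : (act s x == act s y) = (x == y).
Proof. exact: can_eq (lactK to s) _ _. Qed.

(** Extension by zero, which makes the factors of a product term functions of y on all of P, the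
    type on which W acts. *)
Definition inc_tot f x y : {poly VRep k (stab2 act x y)} :=
  if pselect (x <= y)%O is left le_xy then f x y le_xy else 0.

Lemma inc_totE f x y (le_xy : (x <= y)%O) : inc_tot f x y = f x y le_xy.
Proof.
rewrite /inc_tot; case: pselect => // le_xy'; congr (f _ _ _); exact: bool_irrelevance.
Qed.

Lemma inc_tot0 f x y : ~~ (x <= y)%O -> inc_tot f x y = 0.
Proof. by rewrite /inc_tot; case: pselect => // h /negP. Qed.

Lemma inc_tot_equivariant f s x y x' y'
    (c : forall h, h \in stab2 act x y -> (s * h * s^-1)%g \in stab2 act x' y') :
    inc_equivariant f -> act s x = x' -> act s y = y' ->
  inc_tot f x y = map_poly (VConj c) (inc_tot f x' y').
Proof.
move=> eqv ex ey; case: x' / ex c => c; case: y' / ey c => c.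
case: (boolP (x <= y)%O) => [le_xy|nle]; last first.
  by rewrite !inc_tot0 ?pact_leE // raddf0.
rewrite inc_totE (eqv s) (inc_totE f (pact_le act s le_xy)).
by congr (map_poly (VConj _) _); exact: Prop_irrelevance.
Qed.

Lemma inc_tot_res_equivariant f s x y x' y' (H H' : {group W})
    (sH : H \subset stab2 act x y) (sH' : H' \subset stab2 act x' y')
    (c : forall h, h \in H -> (s * h * s^-1)%g \in H') :
    inc_equivariant f -> act s x = x' -> act s y = y' ->
  map_poly (VRes sH) (inc_tot f x y) =
  map_poly (VConj c) (map_poly (VRes sH') (inc_tot f x' y')).
Proof.
move=> eqv ex ey.
have c' h : h \in stab2 act x y -> (s * h * s^-1)%g \in stab2 act x' y'.
  by rewrite -ex -ey; exact: stab2_conj.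
rewrite (inc_tot_equivariant c' eqv ex ey); apply/polyP => n.
by rewrite !coef_map /= (VRes_conj sH sH' c' c).
Qed.

Definition itv_seq (x z : P) : seq P := enum_fset (fset_set [set y : P | (x <= y <= z)%O]%classic).

Lemma mem_itv_seq x z y : (y \in itv_seq x z) = (x <= y <= z)%O.
Proof.
rewrite -[LHS]/(y \in fset_set _) in_fset_set; last exact: locfinP.
by apply/idP/idP => [/set_mem|h] //; exact: mem_set.
Qed.

Lemma itv_seq_uniq x z : uniq (itv_seq x z).
Proof. exact: fset_uniq. Qed.

Lemma stab2_fix x z (g : W) : (g \in stab2 act x z) = (act g x == x) && (act g z == z).
Proof. by rewrite !inE. Qed.

Lemma stab3_family x z : stabilizer_family to (stab2 act x z) (fun y => stab3 act x y z).
Proof. by move=> y g; rewrite !inE /= -!andbA; congr (_ && _); rewrite andbC. Qed.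

Lemma itv_seq_stable x z : stable to (stab2 act x z) (itv_seq x z).
Proof.
move=> g y; rewrite stab2_fix !mem_itv_seq => /andP[/eqP gx /eqP gz].
by move=> xyz; rewrite /= -gx -gz !pact_leE.
Qed.

Definition tot_mul f g x z : {poly VRep k (stab2 act x z)} :=
  pgam to (fun y => stab3_xz act x y z) (itv_seq x z)
    (fun y => map_poly (VRes (stab3_xy act x y z)) (inc_tot f x y) *
              map_poly (VRes (stab3_yz act x y z)) (inc_tot g y z)).

Lemma inc_mulE f g x z (le_xz : (x <= z)%O) : inc_mul f g le_xz = tot_mul f g x z.
Proof.
rewrite /inc_mul; set A := [set y : Defs.interval x z | _]%classic.
have finA : finite_set A.
  apply: (@sub_finite_set _ _ (val @^-1` [set y : P | (x <= y <= z)%O]%classic)%classic).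
    by move=> y _; exact: (valP y).
  by apply: finite_preimage (locfinP x z) => y y' _ _; exact: val_inj.
pose F y := map_poly (VInd (stab3_xz act x y z))
   (map_poly (VRes (stab3_xy act x y z)) (inc_tot f x y) *
    map_poly (VRes (stab3_yz act x y z)) (inc_tot g y z)).
rewrite fsbig_finite //= (eq_bigr (fun y => F (val y))) => [|y _]; last first.
  by rewrite /inc_mul_term /F -!inc_totE.
rewrite -(big_map val xpredT F) /tot_mul /pgam -/F -[RHS]big_filter.
apply: perm_big; apply: uniq_perm.
- by rewrite map_inj_uniq ?fset_uniq //; exact: val_inj.
- exact/filter_uniq/itv_seq_uniq.
move=> y; rewrite mem_filter mem_itv_seq; apply/mapP/andP => [[u uA ->]|[/eqP ry xyz]].
  split; last exact: (valP u).
  by move: uA; rewrite in_fset_set // in_setE => /= uA; apply/eqP.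
exists (exist _ y xyz : Defs.interval x z) => //.
by rewrite in_fset_set // in_setE.
Qed.

Lemma inc_tot_mul f g x z : (x <= z)%O -> inc_tot (inc_mul f g) x z = tot_mul f g x z.
Proof. by move=> le_xz; rewrite inc_totE inc_mulE. Qed.

Lemma tot_mul_term_equivariant f g x z : inc_equivariant f -> inc_equivariant g ->
  pequivariant to (stab2 act x z) (itv_seq x z)
    (fun y => map_poly (VRes (stab3_xy act x y z)) (inc_tot f x y) *
              map_poly (VRes (stab3_yz act x y z)) (inc_tot g y z)).
Proof.
move=> eqvf eqvg s y c; rewrite stab2_fix => /andP[/eqP sx /eqP sz] _.
rewrite rmorphM /=; congr (_ * _); exact: inc_tot_res_equivariant.
Qed.

Lemma inc_mul_equivariant f g :
  inc_equivariant f -> inc_equivariant g -> inc_equivariant (inc_mul f g).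
Proof.
move=> eqvf eqvg s x z le_xz; rewrite !inc_mulE.
have cK y h : h \in stab3 act x y z ->
    (s * h * s^-1)%g \in stab3 act (act s x) (to s y) (act s z).
  case/setIP=> /setIP[hx hy] hz.
  by apply/setIP; split; [apply/setIP; split|]; apply: stab_conj.
rewrite /tot_mul.
rewrite -(@pgam_conj _ _ _ to _ _ (fun y => stab3 act x y z) _ (fun y => stab3_xz act x y z)
  (fun y => stab3_xz act (act s x) y (act s z)) s _ cK (itv_seq x z)).
- apply: eq_pgam => y _; rewrite rmorphM /=.
  by congr (_ * _); exact: inc_tot_res_equivariant.
- exact: itv_seq_uniq.
- exact: itv_seq_uniq.
- exact: itv_seq_stable.
- exact: itv_seq_stable.
- by move=> y; rewrite !mem_itv_seq !pact_leE.
- exact: stab3_family.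
- exact: stab3_family.
- exact: tot_mul_term_equivariant.
Qed.

Definition stab4 x y z w : {group W} := (stab2 act x y :&: stab2 act z w)%G.

Lemma stab4_xyw x y z w : stab4 x y z w \subset stab3 act x y w.
Proof. by apply/fintype.subsetP => g; rewrite !inE => /andP[/andP[-> ->] /andP[_ ->]]. Qed.

Lemma stab4_xzw x y z w : stab4 x y z w \subset stab3 act x z w.
Proof. by apply/fintype.subsetP => g; rewrite !inE => /andP[/andP[-> _] /andP[-> ->]]. Qed.

Lemma stab4_yzw x y z w : stab4 x y z w \subset stab3 act y z w.
Proof. by apply/fintype.subsetP => g; rewrite !inE => /andP[/andP[_ ->] /andP[-> ->]]. Qed.

Lemma stab4_xyz x y z w : stab4 x y z w \subset stab3 act x y z.
Proof. by apply/fintype.subsetP => g; rewrite !inE => /andP[/andP[-> ->] /andP[-> _]]. Qed.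

Lemma stab4_xy x y z w : stab4 x y z w \subset stab2 act x y.
Proof. exact: subsetIl. Qed.

Lemma stab4_zw x y z w : stab4 x y z w \subset stab2 act z w.
Proof. exact: subsetIr. Qed.

Lemma stab4_yz x y z w : stab4 x y z w \subset stab2 act y z.
Proof. by apply/fintype.subsetP => g; rewrite !inE => /andP[/andP[_ ->] /andP[-> _]]. Qed.

(** Passing from W_xz to W_xzw splits the orbits of y; Mackey's formula absorbs this and replaces
    the stabilizers by quadruple ones. *)
Lemma VRes_tot_mul_l f g x z w : inc_equivariant f -> inc_equivariant g ->
  map_poly (VRes (stab3_xy act x z w)) (tot_mul f g x z) =
  pgam to (fun y => stab4_xzw x y z w) (itv_seq x z)
    (fun y => map_poly (VRes (stab4_xy x y z w)) (inc_tot f x y) *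
              map_poly (VRes (stab4_yz x y z w)) (inc_tot g y z)).
Proof.
move=> eqvf eqvg.
rewrite (@VRes_pgam _ _ _ to _ _ _ (fun y => stab4 x y z w) _ (fun y => stab4_xzw x y z w)
  _ (fun y => stab4_xyz x y z w)).
- apply: eq_pgam => y _; rewrite rmorphM /=.
  by rewrite !(map_VRes_trans _ _ (stab4_xy x y z w)) !(map_VRes_trans _ _ (stab4_yz x y z w)).
- exact: itv_seq_uniq.
- exact: itv_seq_stable.
- exact: stab3_family.
- move=> y s; rewrite !inE /=; case: (act s x == x); case: (act s y == y) => //=.
    by rewrite andbT.
  by rewrite andbF.
- exact: tot_mul_term_equivariant.
Qed.

Lemma VRes_tot_mul_r f g x y w : inc_equivariant f -> inc_equivariant g ->
  map_poly (VRes (stab3_yz act x y w)) (tot_mul f g y w) =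
  pgam to (fun z => stab4_xyw x y z w) (itv_seq y w)
    (fun z => map_poly (VRes (stab4_yz x y z w)) (inc_tot f y z) *
              map_poly (VRes (stab4_zw x y z w)) (inc_tot g z w)).
Proof.
move=> eqvf eqvg.
rewrite (@VRes_pgam _ _ _ to _ _ _ (fun z => stab4 x y z w) _ (fun z => stab4_xyw x y z w)
  _ (fun z => stab4_yzw x y z w)).
- apply: eq_pgam => z _; rewrite rmorphM /=.
  by rewrite !(map_VRes_trans _ _ (stab4_yz x y z w)) !(map_VRes_trans _ _ (stab4_zw x y z w)).
- exact: itv_seq_uniq.
- exact: itv_seq_stable.
- exact: stab3_family.
- move=> z s; rewrite !inE /=; case: (act s x == x); case: (act s y == y) => //=.
  by rewrite andbC.
- exact: tot_mul_term_equivariant.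
Qed.

(** On each side Mackey's formula carries the restriction of the inner product into its sum, and the
    projection formula carries in the remaining factor. What results are the two iterated orbit sums
    of one family on the chains x <= y <= z <= w. *)
Lemma inc_mulA f g (h : incidence) : inc_equivariant f -> inc_equivariant g -> inc_equivariant h ->
  inc_mul f (inc_mul g h) = inc_mul (inc_mul f g) h.
Proof.
move=> eqvf eqvg eqvh.
apply/functional_extensionality_dep => x; apply/functional_extensionality_dep => w.
apply/functional_extensionality_dep => le_xw; rewrite !inc_mulE.
pose F (u : P * P) : {poly VRep k (stab4 x u.1 u.2 w)} :=
  map_poly (VRes (stab4_xy x u.1 u.2 w)) (inc_tot f x u.1) *
  (map_poly (VRes (stab4_yz x u.1 u.2 w)) (inc_tot g u.1 u.2) *
   map_poly (VRes (stab4_zw x u.1 u.2 w)) (inc_tot h u.2 w)).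
transitivity (pgam to (fun y => stab3_xz act x y w) (itv_seq x w)
  (fun y => pgam to (fun z => stab4_xyw x y z w) (itv_seq y w) (fun z => F (y, z)))).
  apply: eq_pgam => y; rewrite mem_itv_seq => /andP[xy yw].
  rewrite inc_tot_mul // VRes_tot_mul_r // mul_pgam; apply: eq_pgam => z _.
  by rewrite (map_VRes_trans _ _ (stab4_xy x y z w)).
transitivity (pgam to (fun z => stab3_xz act x z w) (itv_seq x w)
  (fun z => pgam to (fun y => stab4_xzw x y z w) (itv_seq x z) (fun y => F (y, z)))); last first.
  apply: eq_pgam => z; rewrite mem_itv_seq => /andP[xz zw].
  rewrite inc_tot_mul // VRes_tot_mul_l // mulrC mul_pgam; apply: eq_pgam => y _.
  by rewrite (map_VRes_trans _ _ (stab4_zw x y z w)) mulrC -mulrA.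
pose s := [seq u <- [seq (y, z) | y <- itv_seq x w, z <- itv_seq x w] | (u.1 <= u.2)%O].
have sE y z : ((y, z) \in s) = [&& x <= y, y <= z & z <= w]%O.
  rewrite mem_filter /=; apply/andP/and3P => [[yz /allpairsP[[y' z'] /= [ys zs [ey ez]]]]|[xy yz zw]].
    by move: yz ys zs; rewrite ey ez !mem_itv_seq => -> /andP[-> _] /andP[_ ->].
  split=> //; apply/allpairsP; exists (y, z); split=> //=; rewrite mem_itv_seq.
    by rewrite xy (le_trans yz zw).
  by rewrite (le_trans xy yz) zw.
apply: (@pgam_fubini _ _ P P to to _ (fun y => stab3 act x y w) (fun z => stab3 act x z w)
  (fun u => stab4 x u.1 u.2 w) _ _ _ _ s).
- apply/filter_uniq/allpairs_uniq; try exact: itv_seq_uniq.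
  by move=> [y z] [y' z'] _ _ /= [-> ->].
- move=> a [y z]; rewrite stab2_fix => /andP[/eqP gx /eqP gw]; rewrite !sE.
  by move=> xyzw; rewrite /= -gx -gw !pact_leE.
- move=> [y z] a; rewrite !inE /= xpair_eqE.
  by case: (act a x == x); case: (act a y == y); case: (act a z == z); case: (act a w == w).
- exact: itv_seq_uniq.
- exact: itv_seq_stable.
- exact: stab3_family.
- exact: itv_seq_uniq.
- exact: itv_seq_stable.
- exact: stab3_family.
- by move=> y; exact: itv_seq_uniq.
- by move=> y; exact: itv_seq_uniq.
- move=> y z a; rewrite !inE /=.
  by case: (act a x == x); case: (act a y == y); case: (act a z == z); case: (act a w == w).
- move=> z y a; rewrite !inE /=.
  by case: (act a x == x); case: (act a y == y); case: (act a z == z); case: (act a w == w).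
- move=> a y z; rewrite stab2_fix => /andP[_ /eqP gw].
  by rewrite !mem_itv_seq /= -{1}gw !pact_leE.
- move=> a z y; rewrite stab2_fix => /andP[/eqP gx _].
  by rewrite !mem_itv_seq /= -{1}gx !pact_leE.
- move=> y z; rewrite sE !mem_itv_seq; apply/and3P/andP => [[xy yz zw]|[/andP[-> _] /andP[-> ->]]//].
  by rewrite xy yz zw (le_trans yz zw).
- move=> y z; rewrite sE !mem_itv_seq; apply/and3P/andP => [[xy yz zw]|[/andP[_ ->] /andP[-> ->]]//].
  by rewrite xy yz zw (le_trans xy yz).
- move=> a [y z] c; rewrite stab2_fix => /andP[/eqP gx /eqP gw] _.
  by rewrite /F !rmorphM /=; congr (_ * (_ * _)); exact: inc_tot_res_equivariant.
Qed.

End IncidenceProduct.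

(** * Kernels *)

Section Reversal.
Variable R : comNzRingType.
Implicit Types p q : {poly R}.

(** [inc_bar] at one pair, with n for the rank. Coefficients of p beyond n are lost, hence the size
    bounds in [rev_polyM]. *)
Definition rev_poly n p : {poly R} := \poly_(i < n.+1) p`_(n - i).

Lemma coef_rev_poly n p i : (rev_poly n p)`_i = if (i <= n)%N then p`_(n - i) else 0.
Proof. by rewrite coef_poly ltnS. Qed.

Lemma rev_polyD n p q : rev_poly n (p + q) = rev_poly n p + rev_poly n q.
Proof. by apply/polyP => i; rewrite coefD !coef_rev_poly coefD; case: ifP; rewrite ?addr0. Qed.

Lemma rev_polyZ n a p : rev_poly n (a *: p) = a *: rev_poly n p.
Proof. by apply/polyP => i; rewrite coefZ !coef_rev_poly coefZ; case: ifP; rewrite ?mulr0. Qed.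

Lemma rev_poly0 n : rev_poly n 0 = 0.
Proof. by apply/polyP => i; rewrite coef_rev_poly !coef0; case: ifP. Qed.

Lemma rev_poly_sum n I (r : seq I) (P : pred I) (F : I -> {poly R}) :
  rev_poly n (\sum_(i <- r | P i) F i) = \sum_(i <- r | P i) rev_poly n (F i).
Proof. exact: (big_morph _ (rev_polyD n) (rev_poly0 n)). Qed.

Lemma rev_polyXn n m : (m <= n)%N -> rev_poly n 'X^m = 'X^(n - m).
Proof.
move=> le_mn; apply/polyP => i; rewrite coef_rev_poly !coefXn.
case: leqP => [le_in|lt_ni].
  by congr (nat_of_bool _)%:R; apply/eqP/eqP => [<-|->]; rewrite subKn.
by rewrite gtn_eqF // (leq_ltn_trans (leq_subr _ _) lt_ni).
Qed.

Lemma rev_polyM m n p q : (size p <= m.+1)%N -> (size q <= n.+1)%N ->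
  rev_poly (m + n) (p * q) = rev_poly m p * rev_poly n q.
Proof.
have expand l (u : {poly R}) : (size u <= l.+1)%N -> u = \sum_(i < l.+1) u`_i *: 'X^i.
  by move=> szu; rewrite -poly_def; apply/polyP => i; rewrite coef_poly; case: ltnP => // h;
    rewrite nth_default // (leq_trans szu).
move=> /expand -> /expand ->; rewrite mulr_suml !rev_poly_sum mulr_suml.
apply: eq_bigr => i _; rewrite mulr_sumr !rev_poly_sum mulr_sumr.
apply: eq_bigr => j _; rewrite -scalerAl -scalerAr -exprD !rev_polyZ.
rewrite !rev_polyXn ?leq_add // -1?ltnS // -scalerAl -scalerAr -exprD.
congr (_ *: (_ *: 'X^ _)).
have := ltn_ord i; have := ltn_ord j; rewrite !ltnS => hj hi.
by rewrite subnDA addnC -addnBA // addnC -addnBA.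
Qed.

End Reversal.

Lemma map_rev_poly (R S : comNzRingType) (f : {additive R -> S}) n p :
  map_poly f (rev_poly n p) = rev_poly n (map_poly f p).
Proof.
apply/polyP => i; rewrite coef_map !coef_rev_poly coef_map /=.
by case: ifP => _; rewrite ?raddf0.
Qed.

Section IncidenceAlgebra.
Variables (k : fieldType) (W : finGroupType) (d : Order.disp_t).
Variables (P : porderType d) (act : poset_action W P).
Hypothesis locfinP : locally_finite P.
Variable r : P -> P -> nat.
Hypothesis rankr : weak_rank_function act r.
Local Notation incidence := (incidence k act).
Local Notation to := (poset_left_action act).
Implicit Types f g : incidence.

Definition inc_deg f : Prop :=
  forall x y (le_xy : (x <= y)%O), (size (f x y le_xy) <= (r x y).+1)%N.

Lemma rank_gt0 x y : (x < y)%O -> (0 < r x y)%N.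
Proof. by case: rankr => h _ _; exact: h. Qed.

Lemma rankD x y z : (x <= y)%O -> (y <= z)%O -> (r x y + r y z = r x z)%N.
Proof. by case: rankr => _ h _; exact: h. Qed.

Lemma rank_act s x y : (x <= y)%O -> r (act s x) (act s y) = r x y.
Proof. by case: rankr => _ _ h; exact: h. Qed.

Lemma rank_refl x : r x x = 0%N.
Proof. by apply/eqP; rewrite -(eqn_add2l (r x x)) addn0 rankD. Qed.

Lemma inc_ext f g : (forall x y le_xy, f x y le_xy = g x y le_xy) -> f = g.
Proof. by move=> h; do 3![apply/functional_extensionality_dep => ?]; exact: h. Qed.

Lemma size_inc_tot f x y : inc_deg f -> (size (inc_tot f x y) <= (r x y).+1)%N.
Proof.
move=> degf; case: (boolP (x <= y)%O) => [le_xy|nle]; first by rewrite inc_totE.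
by rewrite inc_tot0 // size_poly0.
Qed.

Lemma inc_tot_bar f x y : (x <= y)%O ->
  inc_tot (inc_bar r f) x y = rev_poly (r x y) (inc_tot f x y).
Proof. by move=> le_xy; rewrite !inc_totE. Qed.

Lemma inc_mul_deg f g : inc_deg f -> inc_deg g -> inc_deg (inc_mul f g).
Proof.
move=> degf degg x z le_xz; rewrite inc_mulE // /tot_mul /pgam big_seq_cond.
apply: (big_ind (fun p : {poly VRep k (stab2 act x z)} => (size p <= (r x z).+1)%N)).
- by rewrite size_poly0.
- by move=> p q hp hq; rewrite (leq_trans (size_polyD _ _)) // geq_max hp.
move=> y /andP[]; rewrite mem_itv_seq // => /andP[xy yz] _.
rewrite (leq_trans (size_poly _ _)) // (leq_trans (size_polyMleq _ _)) //.
have := leq_trans (size_poly _ _) (size_inc_tot x y degf) :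
  (size (map_poly (VRes (stab3_xy act x y z)) (inc_tot f x y)) <= _)%N.
have := leq_trans (size_poly _ _) (size_inc_tot y z degg) :
  (size (map_poly (VRes (stab3_yz act x y z)) (inc_tot g y z)) <= _)%N.
by rewrite -(rankD xy yz); lia.
Qed.

Lemma inc_bar_mul f g : inc_deg f -> inc_deg g ->
  inc_bar r (inc_mul f g) = inc_mul (inc_bar r f) (inc_bar r g).
Proof.
move=> degf degg; apply: inc_ext => x z le_xz; rewrite inc_mulE //.
rewrite -[LHS]/(rev_poly (r x z) (inc_mul f g le_xz)) inc_mulE // /tot_mul /pgam.
rewrite rev_poly_sum big_seq_cond [RHS]big_seq_cond; apply: eq_bigr => y /andP[].
rewrite mem_itv_seq // => /andP[xy yz] _; rewrite -map_rev_poly; congr (map_poly _ _).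
rewrite !inc_tot_bar // !map_rev_poly -(rankD xy yz) rev_polyM //;
  by rewrite (leq_trans (size_poly _ _)) // size_inc_tot.
Qed.

Lemma inc_bar_equivariant f : inc_equivariant f -> inc_equivariant (inc_bar r f).
Proof.
move=> eqv s x y le_xy; rewrite -[LHS]/(rev_poly (r x y) (f x y le_xy)) (eqv s).
by rewrite -map_rev_poly -(rank_act s le_xy).
Qed.

Lemma inc_bar_deg f : inc_deg (inc_bar r f).
Proof. by move=> x y le_xy; exact: size_poly. Qed.

Lemma orbit_rep_fix (T : choiceType) (to' : left_action W T) (G : {group W}) y :
  (forall s, s \in G -> to' s y = y) -> orbit_rep to' G y = y.
Proof. by move=> fixy; have /orbitbP[g Gg <-] := orbit_rep_orbit to' G y; exact: fixy. Qed.

Lemma inc_mul_unipotent_l (kappa : incidence) f x z (le_xz : (x <= z)%O) :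
    (forall y (le_yy : (y <= y)%O), kappa y y le_yy = 1) ->
  inc_mul kappa f le_xz = f x z le_xz +
    \sum_(y <- itv_seq x z | (orbit_rep to (stab2 act x z) y == y) && (y != x))
      map_poly (VInd (stab3_xz act x y z))
        (map_poly (VRes (stab3_xy act x y z)) (inc_tot kappa x y) *
         map_poly (VRes (stab3_yz act x y z)) (inc_tot f y z)).
Proof.
move=> k1; rewrite inc_mulE // /tot_mul /pgam -big_filter (bigD1_seq x) /=; last first.
- exact/filter_uniq/itv_seq_uniq.
- rewrite mem_filter mem_itv_seq // lexx le_xz orbit_rep_fix ?eqxx // => g.
  by rewrite stab2_fix => /andP[/eqP].
rewrite big_filter_cond; congr (_ + _).
rewrite (inc_totE kappa (lexx x)) k1 rmorph1 mul1r inc_totE.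
apply/polyP => n; rewrite !coef_map /=; apply: VInd_VRes_eq.
by apply/fintype.subsetP => g; rewrite !inE => /andP[-> ->].
Qed.

Lemma inc_mul_unipotent_r (kappa : incidence) f x z (le_xz : (x <= z)%O) :
    (forall y (le_yy : (y <= y)%O), kappa y y le_yy = 1) ->
  inc_mul f kappa le_xz = f x z le_xz +
    \sum_(y <- itv_seq x z | (orbit_rep to (stab2 act x z) y == y) && (y != z))
      map_poly (VInd (stab3_xz act x y z))
        (map_poly (VRes (stab3_xy act x y z)) (inc_tot f x y) *
         map_poly (VRes (stab3_yz act x y z)) (inc_tot kappa y z)).
Proof.
move=> k1; rewrite inc_mulE // /tot_mul /pgam -big_filter (bigD1_seq z) /=; last first.
- exact/filter_uniq/itv_seq_uniq.
- rewrite mem_filter mem_itv_seq // lexx le_xz orbit_rep_fix ?eqxx // => g.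
  by rewrite stab2_fix => /andP[_ /eqP].
rewrite big_filter_cond; congr (_ + _).
rewrite (inc_totE kappa (lexx z)) k1 rmorph1 mulr1 inc_totE.
apply/polyP => n; rewrite !coef_map /=; apply: VInd_VRes_eq.
by apply/fintype.subsetP => g; rewrite !inE => /andP[-> ->].
Qed.

Lemma inc_delta_refl x (le_xx : (x <= x)%O) : @inc_delta k W d P act x x le_xx = 1.
Proof. by rewrite /inc_delta eqxx. Qed.

Lemma inc_tot_delta x y : x != y -> inc_tot (@inc_delta k W d P act) x y = 0.
Proof.
move=> ne; case: (boolP (x <= y)%O) => [le_xy|nle]; last exact: inc_tot0.
by rewrite inc_totE /inc_delta (negPf ne).
Qed.

Lemma inc_mul1l f : inc_mul (@inc_delta k W d P act) f = f.
Proof.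
apply: inc_ext => x z le_xz; rewrite inc_mul_unipotent_l; last exact: inc_delta_refl.
rewrite big1 ?addr0 // => y /andP[_ ne].
by rewrite inc_tot_delta 1?eq_sym // raddf0 mul0r raddf0.
Qed.

Lemma inc_mul1r f : inc_mul f (@inc_delta k W d P act) = f.
Proof.
apply: inc_ext => x z le_xz; rewrite inc_mul_unipotent_r; last exact: inc_delta_refl.
rewrite big1 ?addr0 // => y /andP[_ ne].
by rewrite inc_tot_delta // raddf0 mulr0 raddf0.
Qed.

(** The rank, rather than inclusion of intervals, is the induction measure. Stating this for
    operators lets left and right multiplication be treated at once. *)
Definition unipotent (A : incidence -> incidence) : Prop :=
  forall f g x z (le_xz : (x <= z)%O),
    (forall u v (le_uv : (u <= v)%O), (r u v < r x z)%N -> f u v le_uv = g u v le_uv) ->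
  A f x z le_xz - f x z le_xz = A g x z le_xz - g x z le_xz.

Lemma inc_mul_unipotent (kappa : incidence) :
    (forall y (le_yy : (y <= y)%O), kappa y y le_yy = 1) ->
  unipotent (inc_mul kappa) /\ unipotent (fun f => inc_mul f kappa).
Proof.
move=> k1; split=> f g x z le_xz fg.
  rewrite !inc_mul_unipotent_l // ![_ + _ - _]addrAC !subrr !add0r.
  rewrite big_seq_cond [RHS]big_seq_cond; apply: eq_bigr => y /and3P[].
  rewrite mem_itv_seq // => /andP[xy yz] _ ne.
  rewrite !(inc_totE _ yz) fg // -(rankD xy yz) -[X in (X < _)%N]add0n ltn_add2r.
  by rewrite rank_gt0 // lt_neqAle eq_sym ne.
rewrite !inc_mul_unipotent_r // ![_ + _ - _]addrAC !subrr !add0r.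
rewrite big_seq_cond [RHS]big_seq_cond; apply: eq_bigr => y /and3P[].
rewrite mem_itv_seq // => /andP[xy yz] _ ne.
rewrite !(inc_totE _ xy) fg // -(rankD xy yz) -[X in (X < _)%N]addn0 ltn_add2l.
by rewrite rank_gt0 // lt_neqAle ne.
Qed.

(** * Kazhdan-Lusztig-Stanley elements of a unipotent operator *)

Section Factorization.
(** A stands for multiplication by the kernel on one side, B for multiplication by its bar on the
    same side; [BA] condenses associativity and the kernel being inverse to its bar. *)
Variables A B : incidence -> incidence.
Hypotheses (uniA : unipotent A) (uniB : unipotent B).
Hypothesis A_refl : forall f x (le_xx : (x <= x)%O), A f le_xx = f x x le_xx.
Hypothesis A_eqv : forall f, inc_equivariant f -> inc_equivariant (A f).
Hypothesis A_deg : forall f, inc_deg f -> inc_deg (A f).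
Hypothesis BA : forall f, inc_equivariant f -> B (A f) = f.
Hypothesis barA : forall f, inc_deg f -> inc_bar r (A f) = B (inc_bar r f).

(** The bound i < [uphalf] r means 2 i < r, so this truncates strictly below the middle degree, as
    [scrI_half] demands. *)
Definition kls_step f : incidence := fun x z le_xz =>
  if x == z then 1 else - \poly_(i < uphalf (r x z)) (A f le_xz - f x z le_xz)`_i.

Definition kls_approx n : incidence := iter n kls_step (@inc_delta k W d P act).

(** Recursion on the rank unrolled as iteration: n steps settle the values at all pairs of rank
    below n, so one step more than the rank is enough. *)
Definition kls : incidence := fun x z le_xz => kls_approx (r x z).+1 le_xz.

Lemma kls_step_local f g x z (le_xz : (x <= z)%O) :
    (forall u v (le_uv : (u <= v)%O), (r u v < r x z)%N -> f u v le_uv = g u v le_uv) ->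
  kls_step f le_xz = kls_step g le_xz.
Proof. by move=> fg; rewrite /kls_step (uniA le_xz fg). Qed.

Lemma kls_approx_stable n x z (le_xz : (x <= z)%O) :
  (r x z < n)%N -> kls_approx n le_xz = kls le_xz.
Proof.
have step m u v (le_uv : (u <= v)%O) : (r u v < m)%N -> kls_approx m.+1 le_uv = kls_approx m le_uv.
  elim: m u v le_uv => // m IH u v le_uv ltm; apply: kls_step_local => u' v' le' lt'.
  by apply: IH; rewrite (leq_trans lt').
elim: n => // n IH; rewrite ltnS leq_eqVlt => /predU1P[<- //|lt_n].
by rewrite step ?IH.
Qed.

Lemma kls_fix : kls = kls_step kls.
Proof.
apply: inc_ext => x z le_xz; rewrite -(@kls_approx_stable (r x z).+1) //.
by apply: kls_step_local => u v le_uv lt; exact: kls_approx_stable.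
Qed.

Lemma kls_approx_equivariant n : inc_equivariant (kls_approx n).
Proof.
elim: n => [|n IH] s x z le_xz.
  by rewrite /= /inc_delta pact_eqE; case: eqP => _; rewrite ?rmorph1 ?rmorph0.
rewrite /= /kls_step pact_eqE; case: eqP => _; first by rewrite rmorph1.
apply/polyP => i; rewrite coef_map /= !coefN !coef_poly rank_act //.
case: ifP => _; last by rewrite !oppr0 raddf0.
rewrite raddfN; congr (- _); rewrite !coefB raddfB /=.
by rewrite (A_eqv IH s) (IH s x z le_xz) !coef_map.
Qed.

Lemma kls_equivariant : inc_equivariant kls.
Proof. by move=> s x z le_xz; rewrite /kls rank_act //; exact: kls_approx_equivariant. Qed.

Lemma kls_refl x (le_xx : (x <= x)%O) : kls le_xx = 1.
Proof. by rewrite kls_fix /kls_step eqxx. Qed.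

Lemma size_kls x z (le_xz : (x <= z)%O) : x != z -> (size (kls le_xz) <= uphalf (r x z))%N.
Proof. by move=> /negPf ne; rewrite kls_fix /kls_step ne size_polyN; exact: size_poly. Qed.

Lemma kls_deg : inc_deg kls.
Proof.
move=> x z le_xz; case: (eqVneq x z) le_xz => [->|ne] le_xz; first by rewrite kls_refl size_poly1.
by rewrite (leq_trans (size_kls le_xz ne)) // leq_uphalf_double -addnn; lia.
Qed.

Lemma kls_half : scrI_half r kls.
Proof.
split=> [|x z le_xz lt_xz|x le_xx]; [exact: kls_equivariant| |by rewrite kls_refl inc_delta_refl].
have := size_kls le_xz (negbT (lt_eqF lt_xz)); have := rank_gt0 lt_xz.
by move: (size _) (r x z) => a b; rewrite uphalf_half; have := odd_double_half b; lia.
Qed.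

Lemma inc_bar_kls : inc_bar r kls = A kls.
Proof.
apply: inc_ext => x z le_xz.
have [n] := ubnP (r x z); elim: n x z le_xz => // n IH x z le_xz /ltnSE le_n.
have [e|ne] := eqVneq x z.
  case: z / e le_xz le_n => le_xx _; rewrite A_refl kls_refl.
  apply/polyP => i; rewrite coef_poly rank_refl kls_refl !coef1.
  by case: i.
pose q := A kls le_xz - kls le_xz.
have Aq : A kls le_xz = q + kls le_xz by rewrite subrK.
(* Write f for [kls]. By induction bar f = A f at lower ranks, so unipotence of B gives B(bar f) -
   bar f = B(A f) - A f = f - A f = -q at (x, z). As B(bar f) = bar(A f), this says bar(A f) = bar f
   - q, while A f = q + f. *)
have revq : rev_poly (r x z) q = - q.
  have : rev_poly (r x z) (A kls le_xz) = rev_poly (r x z) (kls le_xz) - q.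
    rewrite -[LHS]/(inc_bar r (A kls) le_xz) (barA kls_deg).
    have E : B (inc_bar r kls) le_xz - inc_bar r kls le_xz = kls le_xz - A kls le_xz.
      rewrite (@uniB (inc_bar r kls) (A kls)) ?(BA kls_equivariant) // => u v le_uv lt.
      by apply: IH; apply: leq_trans lt le_n.
    rewrite -[rev_poly _ (kls _)]/(inc_bar r kls le_xz).
    by rewrite -[LHS](subrK (inc_bar r kls le_xz)) E addrC /q opprB.
  by rewrite Aq rev_polyD addrC => /addrI.
have szq i : (r x z < i)%N -> q`_i = 0.
  move=> lt; rewrite coefB !nth_default ?subrr //.
    by rewrite (leq_trans (kls_deg le_xz)).
  by rewrite (leq_trans (A_deg kls_deg le_xz)).
have klsE i : (kls le_xz)`_i = if (i < uphalf (r x z))%N then - q`_i else 0.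
  rewrite kls_fix /kls_step (negPf ne) coefN coef_poly -/q.
  by case: ifP; rewrite ?oppr0.
have qE i : (i <= r x z)%N -> q`_(r x z - i) = - q`_i.
  by move=> le_i; rewrite -coefN -revq coef_rev_poly le_i.
rewrite Aq; apply/polyP => i; rewrite coefD coef_poly ltnS !klsE.
case: (leqP i (r x z)) => [le_i|lt_i]; last first.
  by rewrite szq // add0r; case: ifP; rewrite ?oppr0.
have := qE i le_i; move: (r x z) le_i => m le_i qi.
(* Below the middle, the reflected coefficient of [kls] is beyond its degree and the right side
   cancels by construction; above it, antisymmetry turns -q_(m-i) into q_i. *)
case: (ltngtP (i + i) m) => [lt|gt|eq].
- rewrite ifF; last by apply/negbTE; rewrite -leqNgt uphalf_half; have := odd_double_half m; lia.
  rewrite ifT; last by rewrite uphalf_half; have := odd_double_half m; lia.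
  by rewrite subrr.
- rewrite ifT; last by rewrite uphalf_half; have := odd_double_half m; lia.
  rewrite ifF; last by apply/negbTE; rewrite -leqNgt uphalf_half; have := odd_double_half m; lia.
  by rewrite qi opprK addr0.
(* In the middle degree [kls] contributes to neither side, so q_i itself has to vanish; antisymmetry
   yields only q_i = -q_i. *)
- have e : (m - i)%N = i by rewrite -eq addnK.
  rewrite e !ifF; last by apply/negbTE; rewrite -leqNgt uphalf_half; have := odd_double_half m; lia.
  by rewrite addr0; apply/esym/VRep_double_eq0; rewrite -{1}e qi addNr.
Qed.

Lemma kls_unique f : scrI_half r f -> inc_bar r f = A f -> f = kls.
Proof.
move=> [eqvf halff reflf] barf; apply: inc_ext => x z le_xz.
have [n] := ubnP (r x z); elim: n x z le_xz => // n IH x z le_xz /ltnSE le_n.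
have [e|ne] := eqVneq x z.
  by case: z / e le_xz le_n => le_xx _; rewrite reflf kls_refl inc_delta_refl.
have lt_xz : (x < z)%O by rewrite lt_neqAle ne.
have coef0 i : (r x z <= i + i)%N -> (f x z le_xz)`_i = 0.
  move=> le_r; apply: nth_default; have := leq_trans (halff x z le_xz lt_xz) le_r.
  by case: (size _) => //= m; lia.
have qE : A f le_xz - f x z le_xz = A kls le_xz - kls le_xz.
  by apply: uniA => u v le_uv lt; apply: IH; apply: leq_trans lt le_n.
rewrite kls_fix /kls_step (negPf ne) -qE -barf.
apply/polyP => i; rewrite coefN coef_poly; case: ifP => [lt|/negbT].
  (* Below the middle, the coefficient of bar f is f_(r-i), zero by the degree bound, so the
     equation determines f_i as minus the coefficient of A f - f. *)
  have hi : (i + i < r x z)%N.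
    by move: lt; rewrite uphalf_half; have := odd_double_half (r x z); lia.
  rewrite coefB coef_poly ifT; last by lia.
  by rewrite (coef0 (r x z - i)%N) ?sub0r ?opprK //; lia.
rewrite oppr0 -leqNgt => h; apply: coef0.
by move: h; rewrite uphalf_half; have := odd_double_half (r x z); lia.
Qed.

End Factorization.

End IncidenceAlgebra.

Theorem theorem3p1 (k : fieldType) (W : finGroupType)
    (d : Order.disp_t) (P : porderType d) (act : poset_action W P)
    (locfinP : locally_finite P)
    (r : P -> P -> nat) (rankr : weak_rank_function act r)
    (kappa : incidence k act) (kerkappa : P_kernel r kappa) :
  exists! fg : incidence k act * incidence k act,
    [/\ scrI_half r fg.1,
        scrI_half r fg.2,
        inc_bar r fg.1 = inc_mul kappa fg.1
      & inc_bar r fg.2 = inc_mul fg.2 kappa].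
Proof.
have [[eqvk degk] kappa1 [kbk bkk]] := kerkappa.
have k1 y (le_yy : (y <= y)%O) : kappa y y le_yy = 1 by rewrite kappa1 inc_delta_refl.
(* On the diagonal the rank is 0 and bar changes nothing, so multiplication by the bar of the kernel
   is unipotent too. *)
have bk1 y (le_yy : (y <= y)%O) : inc_bar r kappa le_yy = 1.
  apply/polyP => i; rewrite coef_poly (rank_refl rankr) k1 !coef1.
  by case: i.
have eqvb : inc_equivariant (inc_bar r kappa) by exact: inc_bar_equivariant.
have [kl kr] := inc_mul_unipotent locfinP rankr k1.
have [bl br] := inc_mul_unipotent locfinP rankr bk1.
have degb : inc_deg r (inc_bar r kappa) by exact: inc_bar_deg.
have kl_refl f x (le_xx : (x <= x)%O) : inc_mul kappa f le_xx = f x x le_xx.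
  (* No pair has rank below r x x = 0, so unipotence allows f to be compared with the zero family,
     whose product with kappa is zero. *)
  apply/eqP; rewrite -subr_eq0 (kl f (fun _ _ _ => 0)) ?(rank_refl rankr) // subr0.
  rewrite inc_mulE // /tot_mul /pgam big1 // => y _.
  have -> : inc_tot (fun _ _ _ => 0 : {poly VRep k (stab2 act _ _)}) y x = 0.
    by rewrite /inc_tot; case: pselect.
  by rewrite raddf0 mulr0 raddf0.
have kr_refl f x (le_xx : (x <= x)%O) : inc_mul f kappa le_xx = f x x le_xx.
  apply/eqP; rewrite -subr_eq0 (kr f (fun _ _ _ => 0)) ?(rank_refl rankr) // subr0.
  rewrite inc_mulE // /tot_mul /pgam big1 // => y _.
  have -> : inc_tot (fun _ _ _ => 0 : {poly VRep k (stab2 act _ _)}) x y = 0.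
    by rewrite /inc_tot; case: pselect.
  by rewrite raddf0 mul0r raddf0.
have kl_eqv f : inc_equivariant f -> inc_equivariant (inc_mul kappa f).
  by move=> ?; exact: inc_mul_equivariant.
have kr_eqv f : inc_equivariant f -> inc_equivariant (inc_mul f kappa).
  by move=> ?; exact: inc_mul_equivariant.
have kl_deg f : inc_deg r f -> inc_deg r (inc_mul kappa f).
  by move=> ?; exact: inc_mul_deg.
have kr_deg f : inc_deg r f -> inc_deg r (inc_mul f kappa).
  by move=> ?; exact: inc_mul_deg.
have klK f : inc_equivariant f -> inc_mul (inc_bar r kappa) (inc_mul kappa f) = f.
  by move=> ?; rewrite inc_mulA // bkk inc_mul1l.
have krK f : inc_equivariant f -> inc_mul (inc_mul f kappa) (inc_bar r kappa) = f.
  by move=> ?; rewrite -inc_mulA // kbk inc_mul1r.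
have bar_l f : inc_deg r f ->
    inc_bar r (inc_mul kappa f) = inc_mul (inc_bar r kappa) (inc_bar r f).
  by move=> ?; exact: inc_bar_mul.
have bar_r f : inc_deg r f ->
    inc_bar r (inc_mul f kappa) = inc_mul (inc_bar r f) (inc_bar r kappa).
  by move=> ?; exact: inc_bar_mul.
exists (kls r (inc_mul kappa), kls r (fun f => inc_mul f kappa)); split=> [|[f g] [/= hf hg ef eg]].
  split=> /=; [exact: kls_half | exact: kls_half | |].
    exact (inc_bar_kls rankr kl bl kl_refl kl_eqv kl_deg klK bar_l).
  exact (inc_bar_kls rankr kr br kr_refl kr_eqv kr_deg krK bar_r).
congr (_, _); apply/esym.
  exact (kls_unique kl hf ef).
exact (kls_unique kr hg eg).
Qed.
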